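(* For a substitution tiling satisfying the standing assumptions given in the context, let $\mathcal{A}_N\subset C^\ast(R_{punc})$ ($N=0,1,2,\dots$) be the closed linear span of the functions $z^k\cdot e_N(p_i,t,t')$, where $p_i$ ranges over the proto-tiles, $t,t'$ over the tiles in $\omega^N(p_i)$, and $k$ over $\mathbb{Z}$. Then the inductive limit $$\mathcal{A}\mathbb{T}_T=\overline{\bigcup_{N=0}^\infty \mathcal{A}_N}$$ (closure in $C^\ast(R_{punc})$) is an $\mathcal{A}\mathbb{T}$-algebra.
   Context: **Tilings.** A tiling of $\mathbb{R}^2$ is a countable collection of closed polygonal subsets (tiles) covering $\mathbb{R}^2$ such that distinct tiles have disjoint interiors. A patch in a tiling is a finite subset of its tiles; $T\cap B(x,r)$ denotes the patch of tiles of $T$ completely contained in the open ball $B(x,r)$. $\Gamma=\mathbb{R}^2\rtimes \mathcal{S}^1$ is the group of orientation preserving isometries of $\mathbb{R}^2$, where $\mathcal{S}^1=SO(2,\mathbb{R})$ consists of the rotations $R_\theta$ about the origin; $(x,R_\theta)\in\Gamma$ acts on a tiling $T$ by $R_\theta(T+x)$. Put $d((x,R_\theta),(y,R_\phi))=|x-y|+\|R_\theta-R_\phi\|_{F}$ (Frobenius norm of the matrix difference). **Tiling metric.** For $0<\varepsilon<1$, say $T,T'$ are within $\varepsilon$ if there are $(x,R_\theta),(x',R_{\theta'})\in\Gamma$, each at $d$-distance $<\varepsilon$ from the identity, with $R_\theta(T+x)\cap B(0,\varepsilon^{-1})=R_{\theta'}(T'+x')\cap B(0,\varepsilon^{-1})$.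 Then $d_\Gamma(T,T')$ is the infimum of all such $\varepsilon$, or $1$ if there are none. The continuous hull $\Omega_T$ of a tiling $T$ is the completion of $\{T+x:x\in\mathbb{R}^2\}$ in $d_\Gamma$; its elements are tilings. **Standing assumptions.** There is a finite set of proto-tiles $\{p_1,\dots,p_n\}$ (closed polygons, pairwise not related by elements of $\Gamma$) such that each tile of each tiling in $\Omega_T$ is $\gamma(p_i)$ for some $\gamma\in\Gamma$ and some $i$. $\Gamma$ is the full group of orientation preserving isometries, in the sense that for every $\gamma\in\Gamma$ and proto-tile $p$ some tiling in $\Omega_T$ contains $\gamma(p)$, and $\Omega_T$ is invariant under rotations. $\Omega_T$ has finite local complexity with respect to $\Gamma$: for every $r>0$ the set $\{T'\cap B(x,r):T'\in\Omega_T,\ x\in\mathbb{R}^2\}$ is finite modulo $\Gamma$. $\Omega_T$ is strongly aperiodic: $T'+x\ne T'$ for all $T'\in\Omega_T$ and $x\neq 0$. **Punctures.** Each proto-tile $p_i$ has a chosen point $x(p_i)$ in its interior (its puncture) such that the pointed polygon $(p_i,x(p_i))$ has trivial symmetry group; proto-tiles are placed in a fixed orientation with $x(p_i)=0$. Every tile $t=\gamma(p_i)$ gets the puncture $x(t)=\gamma(x(p_i))$. For a tile $t=R_\theta(p_i)+v$ put $\angle t=\theta$ (mod $2\pi$). The discrete hull is $\Omega_{punc}=\{T'\in\Omega_T : \text{some tile } t\in T' \text{ has } x(t)=0\}$ with metric $d_\Gamma$; for $T'\in\Omega_{punc}$, $T'(0)$ is the tile of $T'$ containing the origin. **Equivalence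 relation and $C^\ast$-algebra.** $R_{punc}=\{(T',T'-x(t)):T'\in\Omega_{punc},\ t\in T'\}$ has the topology of the metric $d_R((T_1,T_1-x(t_1)),(T_2,T_2-x(t_2)))=d_\Gamma(T_1,T_2)+|x(t_1)-x(t_2)|$; $[T']$ is the equivalence class of $T'$. $C_c(R_{punc})$ is a $\ast$-algebra with $f\cdot g(T_1,T_2)=\sum_{T_3\in[T_1]}f(T_1,T_3)g(T_3,T_2)$ and $f^\ast(T_1,T_2)=\overline{f(T_2,T_1)}$. For $T_0\in\Omega_{punc}$, $\pi_{T_0}$ is the representation on $\ell^2([T_0])$ given by $(\pi_{T_0}(f)\xi)(T_1)=\sum_{T_2\in[T_0]}f(T_1,T_2)\xi(T_2)$. $C^\ast(R_{punc})$ is the completion of $C_c(R_{punc})$ in $\|f\|_{red}=\sup_{T_0\in\Omega_{punc}}\|\pi_{T_0}(f)\|$. The function $z$ is $z(T_1,T_2)=e^{i\angle T_1(0)}$ if $T_1=T_2$ and $0$ otherwise; $z^k$ is its $k$-th power (as a unitary). **Substitution.** There is a scaling factor $\lambda>1$ and a substitution $\omega$: for each $i$, $\omega(p_i)$ is a finite set of tiles, each of the form $\gamma(p_j)$ with $\gamma\in\Gamma$, with pairwise disjoint interiors and union $\lambda p_i$. It extends to tiles by $\omega(R_\theta(p_i)+v)=R_\theta(\omega(p_i))+\lambda v$, and to patches and tilings tile by tile; $\omega^0(p_i)=\{p_i\}$. It is primitive: for some $k\ge1$, for all $i,j$ the patch $\omega^k(p_j)$ contains an image of $p_i$ under $\Gamma$.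 The tiling $T$ is produced by iterating $\omega$ (every patch of $T$ is contained in some $\gamma(\omega^m(p_j))$, $\gamma\in\Gamma$). The following known facts are part of the setting: $\omega$ maps $\Omega_T$ continuously onto $\Omega_T$, and, $\Omega_T$ being strongly aperiodic, $\omega$ is injective on $\Omega_T$. **The functions $e_N$.** For $N\ge 0$, a proto-tile $p_i$ and $t,t'\in\omega^N(p_i)$, $e_N(p_i,t,t')$ is the characteristic function of $$V_N(p_i,t,t')=\{(\omega^N(T_1)-R_\theta(x(t)),\ \omega^N(T_1)-R_\theta(x(t'))) : T_1\in\Omega_T,\ R_\theta\in\mathcal{S}^1,\ R_\theta(p_i)\in T_1\}\subset R_{punc}.$$ **$\mathcal{A}\mathbb{T}$-algebra.** An inductive limit of a sequence of $C^\ast$-algebras each of which is a finite direct sum of matrix algebras over $C(\mathbb{T})$, $\mathbb{T}$ the unit circle. *)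

(* Defs.v *)
From HB Require Import structures.
From mathcomp Require Import all_boot all_order all_algebra.
From mathcomp Require Import complex.
From mathcomp Require Import all_classical all_reals all_analysis.

Set Implicit Arguments.
Unset Strict Implicit.
Unset Printing Implicit Defensive.

Import Order.TTheory GRing.Theory Num.Theory.
Import numFieldNormedType.Exports.

Local Open Scope classical_set_scope.
Local Open Scope ring_scope.
Local Open Scope complex_scope.

(** * The plane and its orientation preserving isometries *)

Section Plane.
Variable R : realType.

(* The library norm on matrices is the sup norm; distances in the tiling
   metric are Euclidean. *)
Definition frobenius (m n : nat) (M : 'M[R]_(m, n)) : R :=
  Num.sqrt (\sum_(i < m) \sum_(j < n) M i j ^+ 2).

Definition euclid (x : 'cV[R]_2) : R := frobenius x.

Definition eball (x : 'cV[R]_2) (r : R) : set 'cV[R]_2 :=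
  [set y | euclid (y - x) < r].

Definition rotmx (a : R) : 'M[R]_2 :=
  \matrix_(i < 2, j < 2)
    (if i == j then cos a else if i == 0 then - sin a else sin a).

(* [(x, a)] stands for the element (x, R_a) of the isometry group; it maps
   y to R_a (y + x).  The angle a matters only through [rotmx a]. *)
Definition plane_isom : Type := ('cV[R]_2 * R)%type.

Definition iso_act (g : plane_isom) (y : 'cV[R]_2) : 'cV[R]_2 :=
  rotmx g.2 *m (y + g.1).

Definition iso_dist (g h : plane_isom) : R :=
  euclid (g.1 - h.1) + frobenius (rotmx g.2 - rotmx h.2).

Definition iso_id : plane_isom := (0, 0).

(** * Tiles and tilings *)

Definition triangle (a b c : 'cV[R]_2) : set 'cV[R]_2 :=
  [set y | exists u v w : R, [/\ 0 <= u, 0 <= v, 0 <= w, u + v + w = 1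
     & y = u *: a + v *: b + w *: c]].

Definition nondegenerate_triangle (a b c : 'cV[R]_2) : Prop :=
  \det (row_mx (b - a) (c - a) : 'M[R]_(1 + 1)) != 0.

(* Closed polygonal sets: nonempty finite unions of nondegenerate closed
   triangles. *)
Definition polygonal (P : set 'cV[R]_2) : Prop :=
  exists (m : nat) (a b c : 'I_m.+1 -> 'cV[R]_2),
    (forall k, nondegenerate_triangle (a k) (b k) (c k)) /\
    P = \bigcup_(k in [set: 'I_m.+1]) triangle (a k) (b k) (c k).

(* A tile is a polygon together with its puncture.  A polygon with a
   rotational symmetry does not determine its puncture, even when the pointed
   polygon is asymmetric, so the puncture has to be part of the tile for
   x(gamma p) = gamma (x p) to make sense. *)
Definition tile : Type := (set 'cV[R]_2 * 'cV[R]_2)%type.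

Definition tile_shape (t : tile) : set 'cV[R]_2 := t.1.
Definition puncture (t : tile) : 'cV[R]_2 := t.2.

Definition is_tile (t : tile) : Prop :=
  polygonal (tile_shape t) /\ (tile_shape t)^° (puncture t).

Definition map_tile (f : 'cV[R]_2 -> 'cV[R]_2) (t : tile) : tile :=
  (f @` tile_shape t, f (puncture t)).

Definition iso_tile (g : plane_isom) : tile -> tile := map_tile (iso_act g).
Definition rot_tile (a : R) : tile -> tile := map_tile (mulmx (rotmx a)).
Definition shift_tile (v : 'cV[R]_2) : tile -> tile :=
  map_tile (fun y => y + v).

(* R_a(p) + v *)
Definition place (a : R) (v : 'cV[R]_2) (p : tile) : tile :=
  shift_tile v (rot_tile a p).

Definition disjoint_interiors (T : set tile) : Prop :=
  forall s t, T s -> T t -> s <> t ->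
    (tile_shape s)^° `&` (tile_shape t)^° = set0.

Definition tiling : Type := set tile.

Definition is_tiling (T : tiling) : Prop :=
  [/\ countable T,
      (forall t, T t -> is_tile t),
      \bigcup_(t in T) tile_shape t = [set: 'cV[R]_2]
    & disjoint_interiors T].

Definition iso_tiling (g : plane_isom) (T : tiling) : tiling := iso_tile g @` T.
Definition rot_tiling (a : R) (T : tiling) : tiling := rot_tile a @` T.
Definition shift_tiling (v : 'cV[R]_2) (T : tiling) : tiling :=
  shift_tile v @` T.

Definition tile_patch (T : tiling) (x : 'cV[R]_2) (r : R) : set tile :=
  [set t | T t /\ tile_shape t `<=` eball x r].

Definition within_eps (T T' : tiling) (e : R) : Prop :=
  [/\ 0 < e, e < 1 &
      exists g g' : plane_isom,
        [/\ iso_dist g iso_id < e, iso_dist g' iso_id < e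
          & tile_patch (iso_tiling g T) 0 e^-1 =
            tile_patch (iso_tiling g' T') 0 e^-1]].

Definition dGamma (T T' : tiling) : R :=
  if `[< within_eps T T' !=set0 >] then inf (within_eps T T') else 1.

(* The completion of the translation orbit of T, realised by tilings: the
   tilings that are limits of translates of T. *)
Definition hull (T : tiling) : set tiling :=
  [set T' | is_tiling T' /\
     forall e : R, 0 < e -> exists x, dGamma T' (shift_tiling x T) < e].

End Plane.

(** * Substitution tilings *)

Record substitution_tiling (R : realType) := SubstitutionTiling {
  st_num : nat;
  st_proto : 'I_st_num -> tile R;
  st_lambda : R;
  st_subst : 'I_st_num -> set (tile R);
  st_tiling : tiling R
}.

Section Substitution.
Variables (R : realType) (S : substitution_tiling R).

Local Notation p := (st_proto (s := S)).
Local Notation Omega := (hull (st_tiling S)).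

(* omega (R_a(p_i) + v) = R_a(omega p_i) + lambda v; under the standing
   assumptions i, R_a and v are determined by the tile. *)
Definition omega_tile (t : tile R) : set (tile R) :=
  [set s | exists i a v, t = place a v (p i) /\
     exists2 u, st_subst i u & s = place a (st_lambda S *: v) u].

Definition omega (P : set (tile R)) : set (tile R) :=
  \bigcup_(t in P) omega_tile t.

Definition omega_iter (N : nat) (P : set (tile R)) : set (tile R) :=
  iter N omega P.

(* omega^N(p_i) *)
Definition supertile (N : nat) (i : 'I_(st_num S)) : set (tile R) :=
  omega_iter N [set p i].

Record standing_assumptions : Prop := {
  sa_tiling : is_tiling (st_tiling S);
  sa_proto_tile : forall i, is_tile (p i);
  sa_proto_puncture : forall i, puncture (p i) = 0;
  sa_proto_asymmetric : forall i (g : plane_isom R),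
    iso_tile g (p i) = p i -> g.1 = 0 /\ rotmx g.2 = 1%:M;
  sa_proto_unrelated : forall i j (g : plane_isom R), i <> j ->
    iso_act g @` tile_shape (p i) <> tile_shape (p j);
  sa_proto_cover : forall T' t, Omega T' -> T' t ->
    exists g i, t = iso_tile g (p i);
  sa_full_group : forall (g : plane_isom R) i,
    exists2 T', Omega T' & T' (iso_tile g (p i));
  sa_rotation_invariant : forall a T', Omega T' -> Omega (rot_tiling a T');
  sa_flc : forall r : R, 0 < r ->
    exists F : set (set (tile R)), finite_set F /\
      forall T' x, Omega T' ->
        exists P g, F P /\ tile_patch T' x r = iso_tiling g P;
  sa_aperiodic : forall T' x, Omega T' -> x <> 0 -> shift_tiling x T' <> T';
  sa_lambda : 1 < st_lambda S;
  sa_subst_finite : forall i, finite_set (st_subst (s := S) i);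
  sa_subst_tiles : forall i t, st_subst (s := S) i t ->
    exists g j, t = iso_tile g (p j);
  sa_subst_disjoint : forall i, disjoint_interiors (st_subst (s := S) i);
  sa_subst_union : forall i,
    \bigcup_(t in st_subst (s := S) i) tile_shape t =
    *:%R (st_lambda S) @` tile_shape (p i);
  sa_primitive : exists2 k, (0 < k)%N &
    forall i j, exists g, supertile k j (iso_tile g (p i));
  sa_generated : forall P, finite_set P -> P `<=` st_tiling S ->
    exists g m j, P `<=` iso_tiling g (supertile m j);
  sa_omega_hull : forall T', Omega T' -> Omega (omega T');
  sa_omega_continuous : forall T', Omega T' -> forall e : R, 0 < e ->
    exists2 d : R, 0 < d & forall T'', Omega T'' ->
      dGamma T' T'' < d -> dGamma (omega T') (omega T'') < e;
  sa_omega_onto : forall T', Omega T' ->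
    exists2 T'', Omega T'' & omega T'' = T';
  sa_omega_injective : forall T' T'', Omega T' -> Omega T'' ->
    omega T' = omega T'' -> T' = T''
}.

(** * The discrete hull and the punctured equivalence relation *)

Definition Omega_punc : set (tiling R) :=
  [set T' | Omega T' /\ exists2 t, T' t & puncture t = 0].

Definition R_punc (T1 T2 : tiling R) : Prop :=
  Omega_punc T1 /\
  exists2 t, T1 t & T2 = shift_tiling (- puncture t) T1.

Definition punc_class (T1 : tiling R) : set (tiling R) :=
  [set T2 | R_punc T1 T2].

Definition R_punc_space : Type := {q : tiling R * tiling R | R_punc q.1 q.2}.

(* The vector x(t) of a pair (T1, T1 - x(t)); it is unique by strong
   aperiodicity. *)
Definition displacement (q : tiling R * tiling R) : 'cV[R]_2 :=
  xget 0 [set v | exists2 t, q.1 t &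
                    v = puncture t /\ q.2 = shift_tiling (- v) q.1].

Definition dR (q q' : R_punc_space) : R :=
  dGamma (sval q).1 (sval q').1 +
  euclid (displacement (sval q) - displacement (sval q')).

Definition R_punc_open (U : set R_punc_space) : Prop :=
  forall q, U q -> exists2 e : R, 0 < e & forall q', dR q q' < e -> U q'.

Lemma R_punc_openT : R_punc_open setT.
Proof. by move=> q _; exists 1. Qed.

Lemma R_punc_openI : setI_closed R_punc_open.
Proof.
move=> U V oU oV q [/oU[e e0 eU] /oV[d d0 dV]].
exists (Num.min e d); first by rewrite lt_min e0 d0.
by move=> q'; rewrite lt_min => /andP[qe qd]; split; [exact: eU|exact: dV].
Qed.

Lemma R_punc_open_bigU (I : Type) (f : I -> set R_punc_space) :
  (forall i, R_punc_open (f i)) -> R_punc_open (\bigcup_i f i).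
Proof.
move=> of_ q [i _ /of_[e e0 ef]]; exists e => // q' /ef fq'.
by exists i.
Qed.

HB.instance Definition _ := gen_eqMixin R_punc_space.
HB.instance Definition _ := gen_choiceMixin R_punc_space.
HB.instance Definition _ := isOpenTopological.Build R_punc_space
  R_punc_openT R_punc_openI R_punc_open_bigU.

End Substitution.

(** * Normed star-algebras *)

(* A signature without axioms: the elements of the algebra are the members of
   [nsa_dom], and the operations are only meaningful there. *)
Record normed_star_algebra (R : realType) := NormedStarAlgebra {
  nsa_carrier :> Type;
  nsa_dom : set nsa_carrier;
  nsa_add : nsa_carrier -> nsa_carrier -> nsa_carrier;
  nsa_scale : R[i] -> nsa_carrier -> nsa_carrier;
  nsa_mul : nsa_carrier -> nsa_carrier -> nsa_carrier;
  nsa_star : nsa_carrier -> nsa_carrier;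
  nsa_norm : nsa_carrier -> \bar R
}.

Definition star_hom (R : realType) (D E : normed_star_algebra R) (f : D -> E) :
    Prop :=
  [/\ (forall a, nsa_dom a -> nsa_dom (f a)),
      (forall a b, nsa_dom a -> nsa_dom b ->
         f (nsa_add a b) = nsa_add (f a) (f b)),
      (forall (c : R[i]) a, nsa_dom a -> f (nsa_scale c a) = nsa_scale c (f a)),
      (forall a b, nsa_dom a -> nsa_dom b ->
         f (nsa_mul a b) = nsa_mul (f a) (f b))
    & (forall a, nsa_dom a -> f (nsa_star a) = nsa_star (f a))].

Record cstar_algebra (R : realType) := CstarAlgebra {
  cs_space :> completeNormedModType R[i];
  cs_mul : cs_space -> cs_space -> cs_space;
  cs_star : cs_space -> cs_space;
  cs_mulA : forall a b c, cs_mul a (cs_mul b c) = cs_mul (cs_mul a b) c;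
  cs_mulDl : forall a b c, cs_mul (a + b) c = cs_mul a c + cs_mul b c;
  cs_mulDr : forall a b c, cs_mul a (b + c) = cs_mul a b + cs_mul a c;
  cs_scalel : forall (k : R[i]) a b, cs_mul (k *: a) b = k *: cs_mul a b;
  cs_scaler : forall (k : R[i]) a b, cs_mul a (k *: b) = k *: cs_mul a b;
  cs_starK : forall a, cs_star (cs_star a) = a;
  cs_starD : forall a b, cs_star (a + b) = cs_star a + cs_star b;
  cs_starZ : forall (k : R[i]) a, cs_star (k *: a) = k^* *: cs_star a;
  cs_starM : forall a b, cs_star (cs_mul a b) = cs_mul (cs_star b) (cs_star a);
  cs_normM : forall a b, `|cs_mul a b| <= `|a| * `|b|;
  cs_normC : forall a, `|cs_mul (cs_star a) a| = `|a| ^+ 2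
}.

(* Norms over R[i] take values in R[i]; this is their real value. *)
Definition cabs (R : realType) (V : normedModType R[i]) (a : V) : R :=
  complex.Re `|a|.

Section Cstar.
Variables (R : realType) (A : cstar_algebra R).

(* The subset B of A, as an algebra with the operations of A. *)
Definition cstar_sub (B : set A) : normed_star_algebra R :=
  @NormedStarAlgebra R A B (fun a b => a + b) (fun k a => k *: a)
    (@cs_mul R A) (@cs_star R A) (fun a => (cabs a)%:E).

Definition cstar_subalgebra (B : set A) : Prop :=
  [/\ closed B, B 0,
      (forall (k : R[i]) a b, B a -> B b -> B (k *: a + b)),
      (forall a b, B a -> B b -> B (cs_mul a b))
    & (forall a, B a -> B (cs_star a))].

Definition closed_span (X : set A) : set A :=
  closure [set a | exists (m : nat) (k : 'I_m -> R[i]) (x : 'I_m -> A),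
                     (forall j, X (x j)) /\ a = \sum_(j < m) k j *: x j].

(* A, with the map iota, is the completion of D. *)
Definition is_completion (D : normed_star_algebra R) (iota : D -> A) : Prop :=
  [/\ @star_hom R D (cstar_sub setT) iota,
      (forall a, nsa_dom a -> (cabs (iota a))%:E = nsa_norm a)
    & closure (iota @` @nsa_dom R D) = setT].

End Cstar.

Section InductiveLimit.
Variables (R : realType) (D : nat -> normed_star_algebra R).
Variable phi : forall n, D n -> D n.+1.

(* D n -> D (m + n) *)
Fixpoint connecting (n m : nat) : D n -> D (m + n)%N :=
  match m return D n -> D (m + n)%N with
  | 0%N => fun a => a
  | m'.+1 => fun a => phi (connecting m' a)
  end.

(* B is the C*-algebraic inductive limit of (D n, phi n), that is, the
   completion of the algebraic direct limit for the seminorm that sends the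
   class of a in D n to lim_m |phi_{n, n + m} a|. *)
Definition is_inductive_limit (A : cstar_algebra R) (B : set A)
    (psi : forall n, D n -> A) : Prop :=
  [/\ (forall n, star_hom (phi (n := n))),
      (forall n, @star_hom R (D n) (cstar_sub B) (psi n)),
      (forall n (a : D n), nsa_dom a -> psi n.+1 (phi a) = psi n a),
      (forall n (a : D n), nsa_dom a ->
         nsa_norm (connecting m a) @[m --> \oo] --> (cabs (psi n a))%:E)
    & B = closure (\bigcup_n (psi n @` @nsa_dom R (D n)))].

End InductiveLimit.

(** * Circle algebras and AT-algebras *)

Section Circle.
Variable R : realType.

Definition circle : set R[i]^o := [set w | `|w| = 1].

Definition hilbert_norm (n : nat) (v : 'cV[R[i]]_n) : R :=
  Num.sqrt (\sum_(i < n) cabs (v i 0 : R[i]^o) ^+ 2).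

Definition matrix_norm (n : nat) (M : 'M[R[i]]_n) : \bar R :=
  ereal_sup [set (hilbert_norm (M *m v))%:E | v in
             [set v : 'cV[R[i]]_n | hilbert_norm v <= 1]].

(* Describes the direct sum over j of the algebras M_(bdim j + 1)(C(T)). *)
Record circle_block := CircleBlock {
  bsize : nat;
  bdim : 'I_bsize -> nat
}.

Definition block_carrier (b : circle_block) : Type :=
  forall j : 'I_(bsize b), circle -> 'M[R[i]]_((bdim j).+1).

Definition block_algebra (b : circle_block) : normed_star_algebra R :=
  @NormedStarAlgebra R (block_carrier b)
    [set F | forall j k l, continuous (fun w : circle => F j w k l : R[i]^o)]
    (fun F G j w => F j w + G j w)
    (fun c F j w => c *: F j w)
    (fun F G j w => F j w *m G j w)
    (fun F j w => (map_mx (@conjc R) (F j w))^T)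
    (fun F => (\big[maxe/0]_(j < bsize b)
                 ereal_sup [set matrix_norm (F j w) | w in [set: circle]])%E).

Definition is_AT_algebra (A : cstar_algebra R) (B : set A) : Prop :=
  cstar_subalgebra B /\
  exists (b : nat -> circle_block)
         (phi : forall n, block_algebra (b n) -> block_algebra (b n.+1))
         (psi : forall n, block_algebra (b n) -> A),
    @is_inductive_limit R (fun n => block_algebra (b n)) phi A B psi.

End Circle.

(** * The algebra of the punctured equivalence relation *)

Section TilingAlgebra.
Variables (R : realType) (S : substitution_tiling R).

(* Functions on R_punc are represented by their extensions by zero. *)
Definition pair_fun : Type := tiling R -> tiling R -> R[i].

Definition pair_fun_on (f : pair_fun) (q : R_punc_space S) : R[i]^o :=
  f (sval q).1 (sval q).2.

Definition Cc : set pair_fun :=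
  [set f | [/\ forall T1 T2, ~ R_punc S T1 T2 -> f T1 T2 = 0,
               continuous (pair_fun_on f)
             & compact (closure [set q | pair_fun_on f q != 0])]].

(* The sums below have finitely many nonzero terms for f in [Cc]. *)
Definition convolution (f g : pair_fun) : pair_fun :=
  fun T1 T2 => \sum_(T3 \in punc_class S T1) f T1 T3 * g T3 T2.

Definition pair_fun_star (f : pair_fun) : pair_fun := fun T1 T2 => (f T2 T1)^*.

Definition pi_rep (T0 : tiling R) (f : pair_fun) (xi : tiling R -> R[i]) :
    tiling R -> R[i] :=
  fun T1 => \sum_(T2 \in punc_class S T0) f T1 T2 * xi T2.

(* Norm of l^2([T0]); only the values of xi on [T0] count. *)
Definition l2_norm (T0 : tiling R) (xi : tiling R -> R[i]) : \bar R :=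
  sqrte (\esum_(T1 in punc_class S T0) (cabs (xi T1 : R[i]^o) ^+ 2)%:E)%E.

Definition pi_norm (T0 : tiling R) (f : pair_fun) : \bar R :=
  ereal_sup [set l2_norm T0 (pi_rep T0 f xi) | xi in
             [set xi | (l2_norm T0 xi <= 1)%E]].

Definition red_norm (f : pair_fun) : \bar R :=
  ereal_sup [set pi_norm T0 f | T0 in Omega_punc S].

Definition Cc_algebra : normed_star_algebra R :=
  @NormedStarAlgebra R pair_fun Cc
    (fun f g T1 T2 => f T1 T2 + g T1 T2)
    (fun c f T1 T2 => c * f T1 T2)
    convolution pair_fun_star red_norm.

Definition expi (a : R) : R[i] := cos a +i* sin a.

Definition angle (t : tile R) : R :=
  xget 0 [set a | exists i v, t = place a v (st_proto (s := S) i)].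

Definition origin_tile (T' : tiling R) : tile R :=
  xget (set0, 0) [set t | T' t /\ tile_shape t 0].

Definition pair_fun1 : pair_fun :=
  fun T1 T2 => if `[< Omega_punc S T1 /\ T1 = T2 >] then 1 else 0.

Definition z_punc : pair_fun :=
  fun T1 T2 => if `[< Omega_punc S T1 /\ T1 = T2 >]
               then expi (angle (origin_tile T1)) else 0.

Definition zpow (k : int) : pair_fun :=
  match k with
  | Posz n => iter n (convolution z_punc) pair_fun1
  | Negz n => iter n.+1 (convolution (pair_fun_star z_punc)) pair_fun1
  end.

Definition V_ (N : nat) (i : 'I_(st_num S)) (t t' : tile R) :
    set (tiling R * tiling R) :=
  [set q | exists T1 a,
     [/\ hull (st_tiling S) T1, T1 (rot_tile a (st_proto i)),
         q.1 = shift_tiling (- (rotmx a *m puncture t)) (omega_iter S N T1)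
       & q.2 = shift_tiling (- (rotmx a *m puncture t')) (omega_iter S N T1)]].

Definition e_ (N : nat) (i : 'I_(st_num S)) (t t' : tile R) : pair_fun :=
  fun T1 T2 => if `[< V_ N i t t' (T1, T2) >] then 1 else 0.

(* A, with iota, is C*(R_punc). *)
Variables (A : cstar_algebra R) (iota : pair_fun -> A).

Definition A_ (N : nat) : set A :=
  closed_span [set a | exists (i : 'I_(st_num S)) (t t' : tile R) (k : int),
    [/\ supertile N i t, supertile N i t'
      & a = iota (convolution (zpow k) (e_ N i t t'))]].

Definition AT_T : set A := closure (\bigcup_N A_ N).

End TilingAlgebra.

(* Main.v *)
(** Fix N.  Recognizability (omega^N is a bijection of the hull) gives every
    tiling of the discrete hull a unique address: it is w(omega^N(T) - x(t))
    for one proto-tile p_i, one tiling T of the hull containing p_i, one w on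
    the unit circle and one tile t of omega^N(p_i).  Tilings that differ only
    in t form a block, a block lies in a single equivalence class, and a
    continuous matrix-valued function F on the circle for each i becomes a
    function on pairs of tilings, namely F_i(w)_{t,t'} on the pairs in a common
    block and 0 elsewhere.  By finite local complexity the tilings of the hull
    that contain p_i form a compact space, on which the address is continuous,
    so these functions lie in C_c; they multiply like matrices, and since every
    class is a disjoint union of blocks their reduced norm is the supremum of
    the matrix norms of F_i(w).  Hence the direct sum of matrix algebras over
    C(T) embeds isometrically, with z^k e_N(p_i, t, t') going to a scalar
    multiple of w^k times a matrix unit, and by density of trigonometric
    polynomials the closure of its image is A_N.  Splitting omega^(N+1)(p_j)
    into the patches omega^N of the tiles of omega(p_j) embeds level N into
    level N + 1. *)

Require Import Defs.
From mathcomp Require Import all_boot all_order all_algebra.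
From mathcomp Require Import complex.
From mathcomp Require Import all_classical all_reals all_analysis.
From mathcomp Require Import ring lra.

Set Implicit Arguments.
Unset Strict Implicit.
Unset Printing Implicit Defensive.

Import Order.TTheory GRing.Theory Num.Theory.
Import numFieldNormedType.Exports.

Local Open Scope classical_set_scope.
Local Open Scope ring_scope.
Local Open Scope complex_scope.

Import ComplexField.Normc.

(** * The plane as the complex numbers *)

(** The circle comes from the asymmetry of the pointed proto-tiles: the rotation of a placed copy of
    p_i is a well defined unit number w. Block functions see only i, w and the indices of the tiles,
    not the rest of the tiling, so no larger space than the circle enters. Identifying the plane
    with the complex numbers makes rotations commute visibly and puts the inflation by lambda on the
    same footing as the isometries. The delicate point is continuity. The tiling distance is an
    infimum over pairs of isometries, so balls of [dR] are not known to be open, and nothing is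
    assumed about the continuity of the inverse of omega. Limits are therefore taken along
    ultrafilters: pigeonhole turns finite local complexity into convergence of patches, and
    uniqueness of addresses identifies the limit. The connecting maps rotate w by the angle of a
    tile in omega(p_j), but the function on pairs of tilings stays the same; this makes them
    isometric homomorphisms without any matrix computation. Trigonometric approximation uses an
    explicit positive kernel averaged over roots of unity, so sums take the place of integrals. *)

Section ComplexPlane.
Variable R : realType.
Implicit Types (w z : R[i]) (x y v : 'cV[R]_2) (r : R).

Lemma normc_ge0 w : 0 <= normc w.
Proof. by case: w => a b; exact: sqrtr_ge0. Qed.

Lemma normc_norm w : `|w| = (normc w)%:C.
Proof. by []. Qed.

Lemma normc_real r : normc r%:C = `|r|.
Proof. by rewrite /= expr0n /= addr0 sqrtr_sqr. Qed.

Lemma normcB w z : normc (w - z) = normc (z - w).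
Proof. by rewrite -[LHS]normcN opprB. Qed.

Lemma normc_distm w w' z : normc (w - z) <= normc (w - w') + normc (w' - z).
Proof. by rewrite -[w - z](subrKA w'); exact: le_normcD. Qed.

Lemma normc_sum (I : finType) (f : I -> R[i]) :
  normc (\sum_j f j) <= \sum_j normc (f j).
Proof.
elim/big_ind2: _ => [|x1 x2 y1 y2 h1 h2|//]; first by rewrite normc0.
by apply: le_trans (le_normcD _ _) _; exact: lerD.
Qed.

Lemma normc_unit_neq0 w : normc w = 1 -> w != 0.
Proof. by move=> w1; apply/eqP=> w0; move: w1; rewrite w0 normc0 => /esym/eqP;
    rewrite oner_eq0. Qed.

Definition cplx (y : 'cV[R]_2) : R[i] := y 0 0 +i* y 1 0.

Lemma cplx_inj : injective cplx.
Proof.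
move=> x y [h0 h1]; apply/matrixP => i j; rewrite (ord1 j).
case: i => -[|[|//]] hi.
- by rewrite (_ : Ordinal hi = 0) //; apply/val_inj.
- by rewrite (_ : Ordinal hi = 1) //; apply/val_inj.
Qed.

Lemma cplxD x y : cplx (x + y) = cplx x + cplx y.
Proof. by rewrite /cplx !mxE. Qed.

Lemma cplxN x : cplx (- x) = - cplx x.
Proof. by rewrite /cplx !mxE. Qed.

Lemma cplxB x y : cplx (x - y) = cplx x - cplx y.
Proof. by rewrite cplxD cplxN. Qed.

Lemma cplx0 : cplx 0 = 0.
Proof. by rewrite /cplx !mxE. Qed.

Lemma cplxZ r x : cplx (r *: x) = r%:C * cplx x.
Proof. by rewrite /cplx !mxE; apply/eqP; rewrite eq_complex /= !mul0r subr0 addr0 !eqxx. Qed.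

(** The matrix of multiplication by w: a rotation for unit w, a dilation for real positive w. *)
Definition cmx w : 'M[R]_2 :=
  \matrix_(i < 2, j < 2)
    (if i == j then complex.Re w else if i == 0 then - complex.Im w else complex.Im w).

Lemma cplx_cmx w y : cplx (cmx w *m y) = w * cplx y.
Proof.
case: w => a b; rewrite /cplx !mxE !big_ord_recl !big_ord0 /= !mxE /= !addr0.
rewrite (_ : lift ord0 ord0 = 1); last exact/val_inj.
by apply/eqP; rewrite eq_complex /= mulNr [b * _ + _]addrC !eqxx.
Qed.

Lemma rotmxE (a : R) : rotmx a = cmx (expi a).
Proof. by []. Qed.

Lemma cmxM_vec w z y : cmx (w * z) *m y = cmx w *m (cmx z *m y).
Proof. by apply: cplx_inj; rewrite !cplx_cmx mulrA. Qed.

Lemma cmx1_vec y : cmx 1 *m y = y.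
Proof. by apply: cplx_inj; rewrite cplx_cmx mul1r. Qed.

Lemma cmx_real r y : cmx r%:C *m y = r *: y.
Proof. by apply: cplx_inj; rewrite cplx_cmx cplxZ. Qed.

Lemma cmx_inj : injective cmx.
Proof.
move=> [a b] [c d] /matrixP h; have := h 0 0; have := h 1 0.
by rewrite !mxE /= => -> ->.
Qed.

Lemma cmx1 : cmx 1 = 1%:M.
Proof.
apply/matrixP => i j; rewrite !mxE /=.
by case: (i == j); rewrite ?oppr0 //; case: ifP.
Qed.

Lemma euclidE y : euclid y = normc (cplx y).
Proof.
rewrite /euclid /frobenius /cplx /= !big_ord_recl !big_ord0 !addr0.
by rewrite (_ : lift ord0 ord0 = 1) //; exact/val_inj.
Qed.

Lemma frobenius_cmx w : frobenius (cmx w) = Num.sqrt 2 * normc w.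
Proof.
case: w => a b /=; rewrite /frobenius !big_ord_recl !big_ord0 !mxE /= !addr0.
rewrite -sqrtrM ?ler0n //; congr Num.sqrt; ring.
Qed.

Lemma cmxB w z : cmx (w - z) = cmx w - cmx z.
Proof.
case: w => a b; case: z => c d.
by apply/matrixP => i j; rewrite !mxE /=; case: ifP => // _; case: ifP => // _; rewrite opprD.
Qed.

Lemma euclid_ge0 y : 0 <= euclid y.
Proof. by rewrite euclidE normc_ge0. Qed.

Lemma euclid0 : euclid (0 : 'cV[R]_2) = 0.
Proof. by rewrite euclidE cplx0 normc0. Qed.

Lemma euclid_eq0 y : euclid y = 0 -> y = 0.
Proof. by rewrite euclidE => /eq0_normc y0; apply: cplx_inj; rewrite cplx0. Qed.

Lemma euclidD x y : euclid (x + y) <= euclid x + euclid y.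
Proof. by rewrite !euclidE cplxD le_normcD. Qed.

Lemma euclidN y : euclid (- y) = euclid y.
Proof. by rewrite !euclidE cplxN normcN. Qed.

Lemma euclidB x y : euclid (x - y) = euclid (y - x).
Proof. by rewrite -euclidN opprB. Qed.

Lemma euclid_distm x y v : euclid (x - v) <= euclid (x - y) + euclid (y - v).
Proof. by rewrite !euclidE !cplxB; exact: normc_distm. Qed.

Lemma euclid_cmx w y : euclid (cmx w *m y) = normc w * euclid y.
Proof. by rewrite !euclidE cplx_cmx normcM. Qed.

Lemma euclidZ r y : euclid (r *: y) = `|r| * euclid y.
Proof. by rewrite -cmx_real euclid_cmx normc_real. Qed.

Lemma expi_unit (a : R) : normc (expi a) = 1.
Proof. by rewrite /= cos2Dsin2 sqrtr1. Qed.

Lemma expiD (a b : R) : expi (a + b) = expi a * expi b.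
Proof. by rewrite /expi cosD sinD; apply/eqP;
    rewrite eq_complex /= [cos a * sin b + _]addrC !eqxx. Qed.

Lemma expi0 : expi 0 = 1 :> R[i].
Proof. by rewrite /expi cos0 sin0. Qed.

Lemma expi_surj w : normc w = 1 -> exists2 a, - pi <= a <= pi & w = expi a.
Proof.
case: w => a b /= h.
have h2 : a ^+ 2 + b ^+ 2 = 1.
  by rewrite -[LHS]sqr_sqrtr ?h ?expr1n // addr_ge0 // sqr_ge0.
have a1 : -1 <= a <= 1 by apply/andP; split; nra.
have sE : b = sin (acos a) \/ b = - sin (acos a).
  have : b ^+ 2 = sin (acos a) ^+ 2.
    by rewrite sin2cos2 acosK ?in_itv //=; lra.
  by move/eqP; rewrite eqf_sqr => /orP[] /eqP ->; [left|right].
have p0 := acos_ge0 a1; have p1 := acos_lepi a1.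
have [bE|bE] := sE; [exists (acos a)|exists (- acos a)];
    rewrite /expi ?cosN ?sinN ?acosK ?in_itv //= ?bE //; lra.
Qed.

Lemma normc_unitV w : normc w = 1 -> normc w^-1 = 1.
Proof. by rewrite normcV => ->; rewrite invr1. Qed.

Lemma normc_unitM w z : normc w = 1 -> normc z = 1 -> normc (w * z) = 1.
Proof. by rewrite normcM => -> ->; rewrite mulr1. Qed.

End ComplexPlane.

(** * Similarities acting on tiles *)

Section Tiles.
Variable R : realType.
Implicit Types (w z : R[i]) (x y v : 'cV[R]_2) (r : R) (t : tile R) (T : tiling R).

(* Isometries preserving orientation are the maps with |w| = 1; the inflation
   by lambda is also of this form. *)
Definition sim w v y : 'cV[R]_2 := cmx w *m y + v.

Lemma sim_comp w v w' v' y : sim w v (sim w' v' y) = sim (w * w') (cmx w *m v' + v) y.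
Proof. by rewrite /sim cmxM_vec mulmxDr addrA. Qed.

Lemma sim1 y : sim 1 0 y = y.
Proof. by rewrite /sim cmx1_vec addr0. Qed.

Lemma euclid_sim w v y y' : euclid (sim w v y - sim w v y') = normc w * euclid (y - y').
Proof. by rewrite /sim opprD addrACA subrr addr0 -mulmxBr euclid_cmx. Qed.

(* [sim w^-1 (invv w v)] is the inverse of [sim w v]. *)
Definition invv w v : 'cV[R]_2 := - (cmx w^-1 *m v).

Lemma simK w v y : w != 0 -> sim w^-1 (invv w v) (sim w v y) = y.
Proof. by move=> w0; rewrite sim_comp mulVf // /invv subrr sim1. Qed.

Lemma simVK w v y : w != 0 -> sim w v (sim w^-1 (invv w v) y) = y.
Proof.
by move=> w0; rewrite sim_comp divff // /invv mulmxN -cmxM_vec divff // cmx1_vec addNr sim1.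
Qed.

Lemma sim_inj w v : w != 0 -> injective (sim w v).
Proof. by move=> w0 y y' h; rewrite -(simK v y w0) h simK. Qed.

(** The common form of [place], [rot_tile], [shift_tile] and [iso_tile], closed under composition
    and inversion. *)
Definition plc w v : tile R -> tile R := map_tile (sim w v).
Definition plt w v : tiling R -> tiling R := fun T => plc w v @` T.

Lemma map_tile_comp (f g : 'cV[R]_2 ->
    'cV[R]_2) t : map_tile f (map_tile g t) = map_tile (f \o g) t.
Proof. by rewrite /map_tile /= image_comp. Qed.

Lemma eq_map_tile (f g : 'cV[R]_2 -> 'cV[R]_2) t : f =1 g -> map_tile f t = map_tile g t.
Proof. by move=> /funext ->. Qed.

Lemma plc_comp w v w' v' t : plc w v (plc w' v' t) = plc (w * w') (cmx w *m v' + v) t.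
Proof. by rewrite /plc map_tile_comp; apply: eq_map_tile => y /=; rewrite sim_comp. Qed.

Lemma plc1 t : plc 1 0 t = t.
Proof.
case: t => X y; rewrite /plc /map_tile /= sim1; congr pair.
by rewrite (_ : sim 1 0 = id) ?image_id //; apply/funext => u; rewrite sim1.
Qed.

Lemma plcK w v : w != 0 -> cancel (plc w v) (plc w^-1 (invv w v)).
Proof. by move=> w0 t; rewrite plc_comp mulVf // /invv subrr plc1. Qed.

Lemma plcVK w v : w != 0 -> cancel (plc w^-1 (invv w v)) (plc w v).
Proof.
by move=> w0 t; rewrite plc_comp divff // /invv mulmxN -cmxM_vec divff // cmx1_vec addNr plc1.
Qed.

Lemma plc_inj w v : w != 0 -> injective (plc w v).
Proof. by move=> w0; exact: can_inj (plcK v w0). Qed.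

Lemma plt_comp w v w' v' T : plt w v (plt w' v' T) = plt (w * w') (cmx w *m v' + v) T.
Proof.
rewrite /plt image_comp; congr image.
by apply/funext => t /=; rewrite plc_comp.
Qed.

Lemma plt1 T : plt 1 0 T = T.
Proof. by rewrite /plt (_ : plc 1 0 = id) ?image_id //; apply/funext => t; rewrite plc1. Qed.

Lemma pltK w v : w != 0 -> cancel (plt w v) (plt w^-1 (invv w v)).
Proof. by move=> w0 T; rewrite plt_comp mulVf // /invv subrr plt1. Qed.

Lemma pltVK w v : w != 0 -> cancel (plt w^-1 (invv w v)) (plt w v).
Proof.
by move=> w0 T; rewrite plt_comp divff // /invv mulmxN -cmxM_vec divff // cmx1_vec addNr plt1.
Qed.

Lemma plt_mem w v T t : w != 0 -> plt w v T (plc w v t) = T t.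
Proof.
move=> w0; apply/propext; split; last by exists t.
by case=> s Ts /(plc_inj w0) <-.
Qed.

Lemma puncture_plc w v t : puncture (plc w v t) = sim w v (puncture t).
Proof. by []. Qed.

Lemma shape_plc w v t : tile_shape (plc w v t) = sim w v @` tile_shape t.
Proof. by []. Qed.

Lemma placeE (a : R) v t : place a v t = plc (expi a) v t.
Proof. by rewrite /place /shift_tile /rot_tile map_tile_comp. Qed.

Lemma rot_tileE (a : R) t : rot_tile a t = plc (expi a) 0 t.
Proof. by apply: eq_map_tile => y; rewrite /sim addr0. Qed.

Lemma shift_tileE v t : shift_tile v t = plc 1 v t.
Proof. by apply: eq_map_tile => y; rewrite /sim cmx1_vec. Qed.

Lemma iso_tileE (g : plane_isom R) t :
  iso_tile g t = plc (expi g.2) (cmx (expi g.2) *m g.1) t.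
Proof. by apply: eq_map_tile => y; rewrite /iso_act mulmxDr. Qed.

Lemma shift_tilingE v T : shift_tiling v T = plt 1 v T.
Proof. by rewrite /shift_tiling /plt; congr image; apply/funext => t; exact: shift_tileE. Qed.

Lemma rot_tilingE (a : R) T : rot_tiling a T = plt (expi a) 0 T.
Proof. by rewrite /rot_tiling /plt; congr image; apply/funext => t; exact: rot_tileE. Qed.

Lemma iso_tilingE (g : plane_isom R) T :
  iso_tiling g T = plt (expi g.2) (cmx (expi g.2) *m g.1) T.
Proof. by rewrite /iso_tiling /plt; congr image; apply/funext => t; exact: iso_tileE. Qed.

Lemma shift_tilingD v v' T : shift_tiling v (shift_tiling v' T) = shift_tiling (v' + v) T.
Proof. by rewrite !shift_tilingE plt_comp mulr1 cmx1_vec. Qed.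

Lemma shift_tiling0 T : shift_tiling 0 T = T.
Proof. by rewrite shift_tilingE plt1. Qed.

Lemma mem_shift_tiling v T t : shift_tiling v T t = T (shift_tile (- v) t).
Proof.
rewrite shift_tilingE shift_tileE -[in LHS](_ : plc 1 v (plc 1 (- v) t) = t).
  by rewrite plt_mem ?oner_eq0.
by rewrite plc_comp mulr1 cmx1_vec addNr plc1.
Qed.

(** Interiors of tiles refer to the entrywise topology on matrices, the tiling metric to Euclidean
    balls; this lets the two be exchanged. *)
Lemma nbhs_eball y (A : set 'cV[R]_2) :
  nbhs y A <-> exists2 e : R, 0 < e & eball y e `<=` A.
Proof.
split.
- move=> /nbhs_ballP[e e0 eA]; exists e => // z zye; apply: eA; split => // i j.
  rewrite /ball /= -[_ - _]opprB normrN.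
  apply: le_lt_trans zye; rewrite /euclid /frobenius.
  rewrite -sqrtr_sqr ler_sqrt; last first.
    by apply: sumr_ge0 => ? _; apply: sumr_ge0 => ? _; exact: sqr_ge0.
  rewrite (bigD1 i) //= (bigD1 j) //= !mxE -addrA lerDl.
  by apply: addr_ge0; do ?[apply: sumr_ge0 => ? _]; exact: sqr_ge0.
(* Half the radius is enough in dimension two, since sqrt 2 * (e / 2) < e. *)
- case=> e e0 eA; apply/nbhs_ballP; exists (e / 2); first by rewrite /= divr_gt0.
  move=> z [_ bz]; apply: eA; rewrite /eball /=.
  have h (i : 'I_2) : (z i 0 - y i 0) ^+ 2 <= (e / 2) ^+ 2.
    have := bz i 0; rewrite /ball /= => /ltW; rewrite -[_ - _]opprB normrN.
    by move=> h; rewrite -[leLHS]real_normK ?num_real // lerXn2r // nnegrE; lra.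
  rewrite /euclid /frobenius !big_ord_recl !big_ord0 !addr0.
  rewrite -[ltRHS]gtr0_norm // -sqrtr_sqr ltr_sqrt ?exprn_gt0 //.
  rewrite !mxE /=; have := h ord0; have := h (lift ord0 ord0).
  rewrite !(ord1 ord0); nra.
Qed.

Lemma interiorE (A : set 'cV[R]_2) y : A^° y <-> exists2 e : R, 0 < e & eball y e `<=` A.
Proof. exact: nbhs_eball. Qed.

Lemma interior_sim w v (A : set 'cV[R]_2) y : w != 0 ->
  (sim w v @` A)^° (sim w v y) <-> A^° y.
Proof.
move=> w0; have nw : 0 < normc w.
  rewrite lt_neqAle normc_ge0 andbT eq_sym; apply/eqP => /eq0_normc.
  by move/eqP; apply/negP.
rewrite !interiorE; split=> -[e e0 eA].
- exists (e / normc w); first by rewrite divr_gt0.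
  move=> u; rewrite /eball /= => uy.
  have /eA[u' Au' /sim_inj] : eball (sim w v y) e (sim w v u).
    by rewrite /eball /= euclid_sim mulrC -ltr_pdivlMr.
  by move=> <-.
- exists (e * normc w); first by rewrite mulr_gt0.
  move=> u uy; exists (sim w^-1 (invv w v) u); last exact: simVK.
  apply: eA; rewrite /eball /=.
  by move: uy; rewrite /eball /= -{1}(simVK v u w0) euclid_sim mulrC ltr_pM2r.
Qed.

Lemma interior_sim_ex w v (A : set 'cV[R]_2) y : w != 0 ->
  (sim w v @` A)^° y -> exists2 y', A^° y' & y = sim w v y'.
Proof.
move=> w0 h; exists (sim w^-1 (invv w v) y); last by rewrite simVK.
have [h1 _] := interior_sim v A (sim w^-1 (invv w v) y) w0.
by apply: h1; rewrite simVK.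
Qed.

(** The determinant with columns x and y. *)
Definition cross (x y : 'cV[R]_2) : R := x 0 0 * y 1 0 - x 1 0 * y 0 0.

Lemma nondegenerateE (a b c : 'cV[R]_2) :
  nondegenerate_triangle a b c <-> cross (b - a) (c - a) != 0.
Proof.
have det2 (M : 'M[R]_2) : \det M = M 0 0 * M 1 1 - M 1 0 * M 0 1.
  rewrite (expand_det_col _ 0) !big_ord_recl big_ord0 /cofactor !det_mx11 !mxE /=.
  rewrite addr0 expr0 expr1 mul1r mulN1r mulrN.
  by do ![congr (_ - _) | congr (_ * _) | congr (M _ _)]; apply/val_inj.
rewrite /nondegenerate_triangle (det2 _ : \det (_ : 'M[R]_2) = _).
set M := row_mx _ _.
have e0 i : M i (0 : 'I_2) = (b - a) i 0.
  by rewrite /M -(row_mxEl (b - a) (c - a)); congr (row_mx _ _ _ _); exact/val_inj.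
have e1 i : M i (1 : 'I_2) = (c - a) i 0.
  by rewrite /M -(row_mxEr (b - a) (c - a)); congr (row_mx _ _ _ _); exact/val_inj.
by rewrite !e0 !e1 /cross; split.
Qed.

Lemma le_euclid_coord x (i : 'I_2) : `|x i 0| <= euclid x.
Proof.
rewrite -sqrtr_sqr /euclid /frobenius ler_sqrt; last first.
  by apply: sumr_ge0 => ? _; apply: sumr_ge0 => ? _; exact: sqr_ge0.
rewrite (bigD1 i) //= big_ord1 lerDl; apply: sumr_ge0 => j _.
by rewrite big_ord1 sqr_ge0.
Qed.

Lemma le_cross x y : `|cross x y| <= 2 * euclid x * euclid y.
Proof.
rewrite /cross; apply: le_trans (ler_normB _ _) _; rewrite !normrM.
have -> : 2 * euclid x * euclid y = euclid x * euclid y + euclid x * euclid y by ring.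
by apply: lerD; apply: ler_pM => //; exact: le_euclid_coord.
Qed.

(** Cramer's rule. *)
Lemma cross_decomp x y (z : 'cV[R]_2) : cross x y != 0 ->
  z = (cross z y / cross x y) *: x + (cross x z / cross x y) *: y.
Proof.
move=> D0; apply: cplx_inj; apply/eqP; rewrite eq_complex /= !mxE.
by move: D0; rewrite /cross => D0; apply/andP; split; apply/eqP; field.
Qed.

(** By Cramer's rule a displacement changes the barycentric coordinates of b and c by amounts
    proportional to its length. The coordinate of a loses both changes, so each is kept below half
    of the least coordinate. *)
Lemma triangle_interior (a b c : 'cV[R]_2) (u v w : R) :
  nondegenerate_triangle a b c -> 0 < u -> 0 < v -> 0 < w -> u + v + w = 1 ->
  (triangle a b c)^° (u *: a + v *: b + w *: c).
Proof.
move=> /nondegenerateE D0 u0 v0 w0 uvw; apply/interiorE.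
set D := cross (b - a) (c - a) in D0.
set m := Num.min u (Num.min v w).
have m0 : 0 < m by rewrite !lt_min u0 v0 w0.
have [mu mv mw] : [/\ m <= u, m <= v & m <= w].
  by rewrite /m; split; rewrite !ge_min lexx ?orbT.
(* One Lipschitz constant for both coordinates, from [le_cross]; the added 1 makes it positive. *)
set K := (2 * euclid (b - a) + 2 * euclid (c - a)) / `|D| + 1.
have D1 : 0 < `|D| by rewrite normr_gt0.
have K0 : 0 < K.
  by rewrite ltr_wpDl // divr_ge0 // addr_ge0 // mulr_ge0 // euclid_ge0.
exists (m / (2 * K)); first by rewrite divr_gt0 // mulr_gt0.
move=> z; rewrite /eball /=; set y := u *: a + v *: b + w *: c => zy.
have hK : euclid (z - y) * K < m / 2.
  by rewrite -ltr_pdivlMr // -mulrA -invfM.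
set al := cross (z - y) (c - a) / D; set be := cross (b - a) (z - y) / D.
have hD : z - y = al *: (b - a) + be *: (c - a) by exact: cross_decomp.
have KD : K * `|D| = 2 * euclid (b - a) + 2 * euclid (c - a) + `|D|.
  by rewrite /K mulrDl mul1r divfK // gt_eqF.
have hal : `|al| <= m / 2.
  apply: le_trans (ltW hK); rewrite /al normrM normfV ler_pdivrMr //.
  apply: le_trans (le_cross _ _) _.
  rewrite -[leRHS]mulrA KD.
  have := euclid_ge0 (z - y); have := euclid_ge0 (b - a); have := euclid_ge0 (c - a).
  by move: (euclid _) (euclid _) (euclid _) => A1 A2 A3 *; nra.
have hbe : `|be| <= m / 2.
  apply: le_trans (ltW hK); rewrite /be normrM normfV ler_pdivrMr //.
  apply: le_trans (le_cross _ _) _.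
  rewrite -[leRHS]mulrA KD.
  have := euclid_ge0 (z - y); have := euclid_ge0 (b - a); have := euclid_ge0 (c - a).
  by move: (euclid _) (euclid _) (euclid _) => A1 A2 A3 *; nra.
have [hal1 hal2] : - (m / 2) <= al /\ al <= m / 2 by move: hal; rewrite ler_norml => /andP[].
have [hbe1 hbe2] : - (m / 2) <= be /\ be <= m / 2 by move: hbe; rewrite ler_norml => /andP[].
exists (u - al - be), (v + al), (w + be); split; [lra|lra|lra|lra|].
rewrite -[LHS](subrK y) hD /y; apply: cplx_inj; apply/eqP; rewrite eq_complex /= !mxE.
by apply/andP; split; apply/eqP; ring.
Qed.

(** A small step from y towards the centroid makes all barycentric coordinates positive. *)
Lemma triangle_sub_closure (a b c : 'cV[R]_2) y (e : R) :
  nondegenerate_triangle a b c -> triangle a b c y -> 0 < e ->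
  exists2 y', (triangle a b c)^° y' & eball y e y'.
Proof.
move=> nd [u [v [w [u0 v0 w0 uvw ->]]]] e0.
pose m := 3^-1 *: (a + b + c) - (u *: a + v *: b + w *: c).
pose s := e / (euclid m + e).
have m0 := euclid_ge0 m.
have s0 : 0 < s by rewrite divr_gt0 // ltr_wpDl.
have s1 : s <= 1 by rewrite ler_pdivrMr ?ltr_wpDl // mul1r lerDr.
have se : s * euclid m < e.
  rewrite mulrAC ltr_pdivrMr ?ltr_wpDl // ltr_pM2l //; lra.
exists ((u + s * (3^-1 - u)) *: a + (v + s * (3^-1 - v)) *: b + (w + s * (3^-1 - w)) *: c).
  apply: triangle_interior => //; [nra|nra|nra|].
  have -> : u + s * (3^-1 - u) + (v + s * (3^-1 - v)) + (w + s * (3^-1 - w)) =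
     (u + v + w) + s * (1 - (u + v + w)) by field.
  by rewrite uvw subrr mulr0 addr0.
rewrite /eball /= (_ : _ - _ = s *: m).
  by rewrite euclidZ gtr0_norm.
rewrite /m; apply: cplx_inj; apply/eqP; rewrite eq_complex /= !mxE.
by apply/andP; split; apply/eqP; ring.
Qed.

(** Excludes that a tile meets the interior of another one only in boundary points of its own. *)
Lemma polygonal_sub_closure (P : set 'cV[R]_2) y (e : R) :
  polygonal P -> P y -> 0 < e -> exists2 y', P^° y' & eball y e y'.
Proof.
move=> [m [a [b [c [nd ->]]]]] [k _ tk] e0.
have [y' iy' ey'] := triangle_sub_closure (nd k) tk e0; exists y' => //.
by move: iy'; apply: interiorS => z tz; exists k.
Qed.

Lemma polygonal_neq0 (P : set 'cV[R]_2) : polygonal P -> P !=set0.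
Proof.
move=> [m [a [b [c [nd ->]]]]]; exists (a ord0); exists ord0 => //.
by exists 1, 0, 0; split => //; rewrite ?addr0 // scale1r !scale0r !addr0.
Qed.

Lemma polygonal_bounded (P : set 'cV[R]_2) : polygonal P ->
  exists2 D : R, 0 < D & P `<=` eball 0 D.
Proof.
move=> [m [a [b [c [nd ->]]]]].
exists (1 + \sum_k (euclid (a k) + euclid (b k) + euclid (c k))).
  rewrite ltr_wpDr // sumr_ge0 // => k _; do 2?apply: addr_ge0; exact: euclid_ge0.
move=> y [k _ [u [v [w [u0 v0 w0 uvw ->]]]]]; rewrite /eball /= subr0.
rewrite (bigD1 k) //=.
set S := \sum_(_ | _) _; have S0 : 0 <= S.
  by rewrite sumr_ge0 // => j _; do 2?apply: addr_ge0; exact: euclid_ge0.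
have := euclidD (u *: a k + v *: b k) (w *: c k).
have := euclidD (u *: a k) (v *: b k); rewrite !euclidZ !ger0_norm //.
have := euclid_ge0 (a k); have := euclid_ge0 (b k); have := euclid_ge0 (c k).
by move: (euclid (a k)) (euclid (b k)) (euclid (c k)) => A1 A2 A3 *; nra.
Qed.

Lemma polygonal_shift (P : set 'cV[R]_2) x :
  polygonal P -> polygonal ((fun y => y + x) @` P).
Proof.
move=> [m [a [b [c [nd ->]]]]].
exists m, (fun k => a k + x), (fun k => b k + x), (fun k => c k + x); split.
  move=> k; rewrite /nondegenerate_triangle.
  have eB u v : u + x - (v + x) = u - v by rewrite opprD addrACA subrr addr0.
  by rewrite !eB; exact: nd.
have key k (u v w : R) : u + v + w = 1 ->
    u *: (a k + x) + v *: (b k + x) + w *: (c k + x) = u *: a k + v *: b k + w *: c k + x.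
  move=> uvw; rewrite -[X in _ = _ + X]scale1r -uvw.
  apply: cplx_inj; apply/eqP; rewrite eq_complex /= !mxE.
  by apply/andP; split; apply/eqP; ring.
apply/seteqP; split=> y.
- case=> z [k _ [u [v [w [u0 v0 w0 uvw ->]]]]] <-; exists k => //.
  by exists u, v, w; split=> //; rewrite key.
- case=> k _ [u [v [w [u0 v0 w0 uvw ->]]]].
  exists (u *: a k + v *: b k + w *: c k); first by exists k => //; exists u, v, w.
  by rewrite key.
Qed.

End Tiles.

(** * The tiling metric *)

Section Closeness.
Variable R : realType.
Implicit Types (w z : R[i]) (x y v : 'cV[R]_2) (r e : R) (t : tile R) (T : tiling R).

(** Equality of the patches inside B(0, r), read tile by tile; see [agreeE]. *)
Definition agree T T' r := forall t, tile_shape t `<=` eball 0 r -> T t <-> T' t.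

Lemma agreeE T T' r : tile_patch T 0 r = tile_patch T' 0 r <-> agree T T' r.
Proof.
split=> [/seteqP[h1 h2] t tr|h].
  by split=> Tt; [have [] := h1 t (conj Tt tr)|have [] := h2 t (conj Tt tr)].
by apply/seteqP; split=> t [Tt tr]; split=> //; apply/(h _ tr).
Qed.

Lemma eball_mono x r r' : r <= r' -> eball x r `<=` eball x r'.
Proof. by move=> rr y; rewrite /eball /= => /lt_le_trans; apply. Qed.

Lemma agree_mono T T' r r' : r' <= r -> agree T T' r -> agree T T' r'.
Proof. by move=> rr h t tr; apply: h; exact: subset_trans (eball_mono rr). Qed.

Lemma agree_sym T T' r : agree T T' r -> agree T' T r.
Proof. by move=> h t /h[? ?]; split. Qed.

Lemma agree_trans T T' T'' r : agree T T' r -> agree T' T'' r -> agree T T'' r.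
Proof. by move=> h h' t tr; split; [move=> /(h _ tr)/(h' _ tr)|move=> /(h' _ tr)/(h _ tr)]. Qed.

Lemma agree_plt w v T T' r r' : normc w = 1 -> r' + euclid v <= r ->
  agree T T' r -> agree (plt w v T) (plt w v T') r'.
Proof.
move=> w1 hr h t tr; have w0 := normc_unit_neq0 w1.
rewrite -(plcVK v w0 t) !plt_mem //; apply: h => y [u tu <-].
have /tr : tile_shape t u by [].
rewrite /eball /= !subr0 /sim => ur; apply: le_lt_trans (euclidD _ _) _.
rewrite /invv euclidN !euclid_cmx normc_unitV // !mul1r; lra.
Qed.

Lemma frobenius_rotB (a b : R) :
  frobenius (rotmx a - rotmx b) = Num.sqrt 2 * normc (expi a - expi b).
Proof. by rewrite !rotmxE -cmxB frobenius_cmx. Qed.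

(** The factor sqrt 2 converts the modulus of w - 1 into the Frobenius norm of the corresponding
    matrix. *)
Definition near_id w v e := euclid v + Num.sqrt 2 * normc (w - 1) < e.

Lemma pos_below1 e : 0 < e -> exists e1, [/\ 0 < e1, e1 < e & e1 < 1].
Proof.
move=> e0; have m0 : 0 < Num.min e 1 by rewrite lt_min e0 ltr01.
exists (Num.min e 1 / 2); rewrite divr_gt0 //; split=> //.
  by rewrite ltr_pdivrMr // (le_lt_trans _ (_ : e < _)) ?ge_min ?lexx // ltr_pMr // ltr1n.
rewrite ltr_pdivrMr // mul1r (le_lt_trans _ (_ : 1 < _)) ?ltr1n //.
by rewrite ge_min lexx orbT.
Qed.

(** Passing from R(y + x) to R y + v replaces x by v = R x, which has the same length, so the
    distances to the identity do not change. *)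
Lemma within_epsE T T' e : within_eps T T' e <->
  [/\ 0 < e, e < 1 & exists w v w' v', [/\ normc w = 1, normc w' = 1, near_id w v e,
     near_id w' v' e & agree (plt w v T) (plt w' v' T') e^-1]].
Proof.
split.
- case=> e0 e1 [[x a] [[x' a'] [/= d1 d2]]]; rewrite !iso_tilingE => /agreeE ag.
  split=> //; exists (expi a), (cmx (expi a) *m x), (expi a'), (cmx (expi a') *m x').
  split; rewrite ?expi_unit //.
  + by move: d1; rewrite /iso_dist /= subr0 frobenius_rotB expi0 /near_id euclid_cmx
      expi_unit mul1r.
  + by move: d2; rewrite /iso_dist /= subr0 frobenius_rotB expi0 /near_id euclid_cmx
      expi_unit mul1r.
- case=> e0 e1 [w [v [w' [v' [w1 w1' n1 n2 ag]]]]]; split=> //.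
  have [a _ wE] := expi_surj w1; have [a' _ wE'] := expi_surj w1'; subst w w'.
  exists (cmx (expi a)^-1 *m v, a), (cmx (expi a')^-1 *m v', a'); split.
  + by rewrite /iso_dist /= subr0 frobenius_rotB expi0 euclid_cmx normc_unitV // mul1r.
  + by rewrite /iso_dist /= subr0 frobenius_rotB expi0 euclid_cmx normc_unitV // mul1r.
  + rewrite !iso_tilingE /= -!cmxM_vec !divff ?normc_unit_neq0 // !cmx1_vec; exact/agreeE.
Qed.

Lemma within_eps_sym T T' e : within_eps T T' e -> within_eps T' T e.
Proof.
move=> /within_epsE[e0 e1 [w [v [w' [v' [h1 h2 h3 h4 h5]]]]]]; apply/within_epsE.
by split=> //; exists w', v', w, v; split=> //; exact: agree_sym.
Qed.

Lemma within_eps_mono T T' e e' : e <= e' -> e' < 1 -> within_eps T T' e -> within_eps T T' e'.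
Proof.
move=> ee e'1 /within_epsE[e0 e1 [w [v [w' [v' [h1 h2 h3 h4 h5]]]]]]; apply/within_epsE.
have e'0 := lt_le_trans e0 ee.
split=> //; exists w, v, w', v'; split=> //; [exact: lt_le_trans h3 _|exact: lt_le_trans h4 _|].
by apply: agree_mono h5; rewrite lef_pV2.
Qed.

Lemma dGamma_ltW T T' e : e <= 1 -> dGamma T T' < e -> exists2 e', e' < e & within_eps T T' e'.
Proof.
rewrite /dGamma; case: asboolP => [ne _ h|_ e1 /lt_le_trans/(_ e1)]; last by rewrite ltxx.
have hi : has_inf (within_eps T T') by split=> //; exists 0 => y [/ltW].
have de : 0 < e - inf (within_eps T T') by rewrite subr_gt0.
have [e' we' e'e] := inf_adherent de hi.
by exists e' => //; move: e'e; rewrite addrC subrK.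
Qed.

(** Together with [within_dGamma_lt], this replaces the infimum by the relation [within_eps], which
    is upward closed below 1. *)
Lemma dGamma_lt_within T T' e : e < 1 -> dGamma T T' < e -> within_eps T T' e.
Proof.
move=> e1 /(dGamma_ltW (ltW e1))[e' /ltW e'e]; exact: within_eps_mono.
Qed.

Lemma within_dGamma_lt T T' e e' : e < e' -> within_eps T T' e -> dGamma T T' < e'.
Proof.
move=> ee h; apply: le_lt_trans ee; rewrite /dGamma; case: asboolP => [_|[]]; last by exists e.
by apply: ge_inf => //; exists 0 => y [/ltW].
Qed.

Lemma dGamma_ge0 T T' : 0 <= dGamma T T'.
Proof.
rewrite /dGamma; case: asboolP => // ne.
by apply: lb_le_inf => // y [/ltW].
Qed.

(* Conjugating by [sim u x] moves the centre of the ball, so the radius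
   shrinks and the isometries get further from the identity. *)
Lemma within_eps_plt u x e : normc u = 1 -> 0 < e -> e < 1 -> exists d,
  [/\ 0 < d, d < 1 &
      forall T T', within_eps T T' d -> within_eps (plt u x T) (plt u x T') e].
Proof.
move=> u1 e0 e1; have u0 := normc_unit_neq0 u1; have x0 := euclid_ge0 x.
have K0 : 0 < 1 + euclid x by rewrite ltr_pwDl.
(* Conjugation adds |z - 1| |x| to the translation, and d (1 + |x|) = e pays for both terms; the
   radius 1/d is then at least 1/e + |x| because e < 1. *)
exists (e / (1 + euclid x)); split; first by rewrite divr_gt0.
  by rewrite ltr_pdivrMr // mul1r; lra.
set d := e / _ => T T' /within_epsE[d0 d1 [w [v [w' [v' [h1 h2 h3 h4 h5]]]]]].
have dE : d * (1 + euclid x) = e by rewrite divfK // gt_eqF.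
have s2 : 1 <= Num.sqrt 2 :> R by rewrite -[leLHS]sqrtr1 ler_sqrt ?ler1n ?ler0n.
have nid z y : near_id z y d -> near_id z (cmx u *m y + x - cmx z *m x) e.
  rewrite /near_id => hz.
  have : euclid (cmx u *m y + x - cmx z *m x) <= euclid y + normc (z - 1) * euclid x.
    rewrite -addrA; apply: le_trans (euclidD _ _) _.
    rewrite euclid_cmx u1 mul1r lerD2l -euclidN opprB -{2}(cmx1_vec x) -mulmxBl -cmxB.
    by rewrite euclid_cmx.
  have := euclid_ge0 y; have := normc_ge0 (z - 1).
  move=> A0 B0 hC.
  have Ad : normc (z - 1) <= d by move: (normc _) A0 hz => A A0 hz; nra.
  have := ler_wpM2r x0 Ad; rewrite -dE mulrDr mulr1; lra.
have conj z y T1 : plt z (cmx u *m y + x - cmx z *m x) (plt u x T1) = plt u x (plt z y T1).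
  by rewrite !plt_comp mulrC addrC subrK.
apply/within_epsE; split=> //.
exists w, (cmx u *m v + x - cmx w *m x), w', (cmx u *m v' + x - cmx w' *m x).
split; rewrite ?conj //; [exact: nid|exact: nid|].
apply: agree_plt h5 => //; rewrite /d invf_div mulrDl mul1r lerD2l.
by rewrite ler_peMr // invf_ge1 // ltW.
Qed.

End Closeness.

(** * Substitution and hull *)

Section Subst.
Variables (R : realType) (S : substitution_tiling R).
Hypothesis hS : standing_assumptions S.
Implicit Types (i j : 'I_(st_num S)) (w z : R[i]) (x y v : 'cV[R]_2) (r e : R) (t s : tile
    R) (T : tiling R).

Local Notation p := (st_proto (s := S)).
Local Notation Omega := (hull (st_tiling S)).
Local Notation lam := (st_lambda S).

Lemma lam_gt0 : 0 < lam.
Proof. exact: lt_trans ltr01 (sa_lambda hS). Qed.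

Lemma lamX_gt0 N : 0 < lam ^+ N.
Proof. by rewrite exprn_gt0 // lam_gt0. Qed.

Lemma iso_of w v : normc w = 1 ->
  exists2 g : plane_isom R, expi g.2 = w & iso_act g =1 sim w v.
Proof.
move=> w1; have [a _ wE] := expi_surj w1.
exists (cmx w^-1 *m v, a) => // y.
by rewrite /iso_act /= rotmxE -wE mulmxDr -cmxM_vec divff ?normc_unit_neq0 // cmx1_vec.
Qed.

Lemma proto0 i : puncture (p i) = 0.
Proof. exact: sa_proto_puncture hS i. Qed.

Lemma puncture_plc_proto w v i : puncture (plc w v (p i)) = v.
Proof. by rewrite puncture_plc /sim proto0 mulmx0 add0r. Qed.

(** The punctures give v, the proto-tiles being unrelated gives i, and the trivial symmetry group of
    the pointed proto-tile gives w. *)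
Lemma plc_proto_inj w v i w' v' j : normc w = 1 -> normc w' = 1 ->
  plc w v (p i) = plc w' v' (p j) -> [/\ i = j, w = w' & v = v'].
Proof.
move=> w1 w1' E.
have vv : v = v' by rewrite -(puncture_plc_proto w v i) E puncture_plc_proto.
have w0 := normc_unit_neq0 w1; have w0' := normc_unit_neq0 w1'.
have E2 : plc (w'^-1 * w) 0 (p i) = p j.
  move/(congr1 (plc w'^-1 (invv w' v'))): E; rewrite plcK // plc_comp => <-.
  by rewrite vv /invv subrr.
have u1 : normc (w'^-1 * w) = 1 by rewrite normc_unitM // normc_unitV.
have [g gE gA] := iso_of 0 u1.
have ij : i = j.
  case: (EM (i = j)) => // /(sa_proto_unrelated hS (g := g)) []; rewrite -E2.
  by rewrite shape_plc; congr image; apply/funext.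
split=> //; subst j; have := sa_proto_asymmetric hS (i := i) (g := g); case.
  by rewrite -[RHS]E2; exact: eq_map_tile.
move=> _; rewrite rotmxE gE -cmx1 => /cmx_inj h.
by rewrite -[w](mulVKf w0') h mulr1.
Qed.

Definition proto_tile t := exists i w v, normc w = 1 /\ t = plc w v (p i).
Definition proto_tiles (P : set (tile R)) := P `<=` proto_tile.

Lemma proto_tile_iso g i : proto_tile (iso_tile g (p i)).
Proof.
by exists i, (expi g.2), (cmx (expi g.2) *m g.1); rewrite expi_unit iso_tileE.
Qed.

Lemma hull_proto T : Omega T -> proto_tiles T.
Proof. by move=> OT t /(sa_proto_cover hS OT)[g [i ->]]; exact: proto_tile_iso. Qed.

Lemma hull_tiling T : Omega T -> is_tiling T.
Proof. by case. Qed.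

Lemma subst_proto i : proto_tiles (st_subst i).
Proof. by move=> t /(sa_subst_tiles hS)[g [j ->]]; exact: proto_tile_iso. Qed.

Lemma proto_tile_plc w v t : normc w = 1 -> proto_tile t -> proto_tile (plc w v t).
Proof.
move=> w1 [i [w' [v' [w1' ->]]]]; exists i, (w * w'), (cmx w *m v' + v).
by rewrite normc_unitM // plc_comp.
Qed.

Lemma omega_tileE t s : omega_tile S t s <-> exists i w v,
  [/\ normc w = 1, t = plc w v (p i) & exists2 u, st_subst i u & s = plc w (lam *: v) u].
Proof.
split.
- case=> i [a [v [-> [u iu ->]]]]; exists i, (expi a), v; rewrite !placeE expi_unit.
  by split=> //; exists u => //; rewrite placeE.
- case=> i [w [v [w1 -> [u iu ->]]]]; have [a _ wE] := expi_surj w1.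
  exists i, a, v; rewrite placeE -wE; split=> //; exists u => //.
  by rewrite placeE -wE.
Qed.

(** [omega_tile] ranges over all ways to write the tile as a placed proto-tile; [plc_proto_inj]
    leaves only one. *)
Lemma omega_tile_proto w v i : normc w = 1 ->
  omega_tile S (plc w v (p i)) = plt w (lam *: v) (st_subst i).
Proof.
move=> w1; apply/seteqP; split=> s.
- move=> /omega_tileE[j [w' [v' [w1' /(plc_proto_inj w1 w1')[-> -> ->] [u iu ->]]]]].
  by exists u.
- by case=> u iu <-; apply/omega_tileE; exists i, w, v; split=> //; exists u.
Qed.

Lemma omega_tile_plc w v t s : normc w = 1 ->
  omega_tile S t s -> omega_tile S (plc w v t) (plc w (lam *: v) s).
Proof.
move=> w1 /omega_tileE[i [w' [v' [w1' -> [u iu ->]]]]]; apply/omega_tileE.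
exists i, (w * w'), (cmx w *m v' + v); rewrite normc_unitM // !plc_comp; split=> //.
by exists u => //; rewrite scalerDr scalemxAr.
Qed.

Lemma omega_plt w v T : normc w = 1 -> omega S (plt w v T) = plt w (lam *: v) (omega S T).
Proof.
move=> w1; have w0 := normc_unit_neq0 w1; apply/seteqP; split=> s.
- case=> _ [t Tt <-] h; exists (plc w^-1 (invv w (lam *: v)) s); last by rewrite plcVK.
  exists t => //.
  have := omega_tile_plc (invv w v) (normc_unitV w1) h; rewrite plcK //.
  by rewrite /invv scalerN scalemxAr.
- by case=> s' [t Tt h] <-; exists (plc w v t); [exists t|exact: omega_tile_plc].
Qed.

Lemma omega_iter_plt N w v T : normc w = 1 ->
  omega_iter S N (plt w v T) = plt w (lam ^+ N *: v) (omega_iter S N T).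
Proof.
move=> w1; rewrite /omega_iter; elim: N => [|N IH] /=; first by rewrite scale1r.
by rewrite IH omega_plt // scalerA -exprS.
Qed.

Lemma omega_iter_bigcup N T s :
  omega_iter S N T s <-> exists2 t, T t & omega_iter S N [set t] s.
Proof.
rewrite /omega_iter; elim: N s => [|N IH] s /=.
  by split=> [Ts|[t Tt ->]] //; exists s.
split.
- by case=> u /IH[t Tt tu] us; exists t => //; exists u.
- by case=> t Tt [u tu us]; exists u => //; apply/IH; exists t.
Qed.

Lemma omega_iter1 N w v i : normc w = 1 ->
  omega_iter S N [set plc w v (p i)] = plt w (lam ^+ N *: v) (supertile N i).
Proof. by move=> w1; rewrite -omega_iter_plt //; congr omega_iter; rewrite /plt image_set1. Qed.

Lemma omega_proto T : proto_tiles (omega S T).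
Proof.
move=> s [t Tt /omega_tileE[i [w [v [w1 _ [u iu ->]]]]]].
by apply: proto_tile_plc => //; exact: subst_proto iu.
Qed.

Lemma omega_iter_proto N T : proto_tiles T -> proto_tiles (omega_iter S N T).
Proof. by case: N => [//|N] _; exact: omega_proto. Qed.

Lemma proto_tiles1 i : proto_tiles [set p i].
Proof. by move=> _ ->; exists i, 1, 0; rewrite plc1 normc1. Qed.

Lemma supertile_proto N i : proto_tiles (supertile N i).
Proof. by apply: omega_iter_proto; exact: proto_tiles1. Qed.

Lemma omega_tile_shape t s : omega_tile S t s ->
  tile_shape s `<=` *:%R lam @` tile_shape t.
Proof.
move=> /omega_tileE[i [w [v [w1 -> [u iu ->]]]]] _ [y uy <-].
have : (\bigcup_(t in st_subst i) tile_shape t) y by exists u.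
rewrite (sa_subst_union hS) => -[y' py' <-]; exists (sim w v y'); first by exists y'.
by rewrite /sim scalerDr scalemxAr.
Qed.

Lemma omega_iter_shape N T s : omega_iter S N T s ->
  exists2 t, T t & tile_shape s `<=` *:%R (lam ^+ N) @` tile_shape t.
Proof.
rewrite /omega_iter; elim: N s => [|N IH] s /=.
  by move=> Ts; exists s => // y sy; exists y; rewrite ?scale1r.
case=> u /IH[t Tt ut] /omega_tile_shape su; exists t => // y /su[y' /ut[y'' ty'' <-] <-].
by exists y'' => //; rewrite scalerA -exprS.
Qed.

Lemma omega_tile_neq0 t : proto_tile t -> omega_tile S t !=set0.
Proof.
move=> [i [w [v [w1 ->]]]]; rewrite omega_tile_proto //.
have [poly _] := sa_proto_tile hS i; have [y py] := polygonal_neq0 poly.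
have : (\bigcup_(t in st_subst i) tile_shape t) (lam *: y).
  by rewrite (sa_subst_union hS); exists y.
by case=> u iu _; exists (plc w (lam *: v) u); exists u.
Qed.

Lemma supertile_neq0 N i : supertile N i !=set0.
Proof.
rewrite /supertile /omega_iter; elim: N => [|N [s Ns]] /=; first by exists (p i).
have /omega_tile_neq0[u us] := supertile_proto Ns.
by exists u; exists s.
Qed.

Lemma supertile_finite N i : finite_set (supertile N i).
Proof.
rewrite /supertile /omega_iter; elim: N => [|N IH] /=; first exact: finite_set1.
apply: bigcup_finite => // t Nt.
have [j [w [v [w1 ->]]]] := supertile_proto (Nt : supertile N i t).
by rewrite omega_tile_proto //; apply: finite_image; exact: sa_subst_finite hS j.
Qed.

Lemma omega_iter_hull N T : Omega T -> Omega (omega_iter S N T).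
Proof. by move=> OT; elim: N => [//|N IH] /=; exact: sa_omega_hull hS _ IH. Qed.

Lemma omega_iter_onto N T : Omega T -> exists2 T', Omega T' & omega_iter S N T' = T.
Proof.
elim: N T => [|N IH] T OT; first by exists T.
have [T1 OT1 <-] := sa_omega_onto hS OT; have [T2 OT2 <-] := IH _ OT1.
by exists T2.
Qed.

Lemma omega_iter_inj N T T' : Omega T -> Omega T' ->
  omega_iter S N T = omega_iter S N T' -> T = T'.
Proof.
move=> OT OT'; elim: N => [//|N IH] /= h; apply: IH.
by apply: (sa_omega_injective hS) h; exact: omega_iter_hull.
Qed.

Lemma shift_is_tiling v T : is_tiling T -> is_tiling (shift_tiling v T).
Proof.
have i1 (A : set 'cV[R]_2) y : (sim 1 v @` A)^° (sim 1 v y) <-> A^° y.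
  by apply: interior_sim; exact: oner_neq0.
move=> [cT tT covT dT]; rewrite shift_tilingE; split.
- by apply: sub_countable cT; exact: card_image_le.
- move=> _ [t /tT[pt it] <-]; split; last exact/i1.
  rewrite shape_plc (_ : sim 1 v = fun y => y + v); first exact: polygonal_shift.
  by apply/funext => y; rewrite /sim cmx1_vec.
- apply/seteqP; split=> // y _; have : [set: 'cV[R]_2] (y - v) by [].
  rewrite -covT => -[t Tt ty]; exists (plc 1 v t); first by exists t.
  by exists (y - v) => //; rewrite /sim cmx1_vec subrK.
- move=> _ _ [s Ts <-] [t Tt <-] st; rewrite -subset0 => y [y1 y2].
  have [y' _ yE] := interior_sim_ex (oner_neq0 _) y1.
  move: y1 y2; rewrite yE => /i1 y1 /i1 y2.
  have nst : s <> t by move=> E; apply: st; rewrite E.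
  by have := dT _ _ Ts Tt nst; rewrite -subset0 => /(_ y'); apply.
Qed.

Lemma hull_shift v T : Omega T -> Omega (shift_tiling v T).
Proof.
move=> [tT hT]; split; first exact: shift_is_tiling.
move=> e /pos_below1[e1 [e10 e1e e11]].
have [d [d0 d1 hd]] := within_eps_plt v (normc1 R) e10 e11.
have [x xd] := hT _ d0; exists (x + v).
rewrite -shift_tilingD ![shift_tiling v _]shift_tilingE.
apply: within_dGamma_lt e1e _.
by apply: hd; exact: dGamma_lt_within.
Qed.

Lemma hull_rot w T : normc w = 1 -> Omega T -> Omega (plt w 0 T).
Proof.
move=> w1 OT; have [a _ ->] := expi_surj w1.
by rewrite -rot_tilingE; exact: sa_rotation_invariant hS a _ OT.
Qed.

Lemma hull_plt w v T : normc w = 1 -> Omega T -> Omega (plt w v T).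
Proof.
move=> w1 OT; have := hull_shift v (hull_rot w1 OT).
by rewrite shift_tilingE plt_comp mul1r cmx1_vec add0r.
Qed.

Lemma tiling_interior_inj T t t' y : is_tiling T -> T t -> T t' ->
  (tile_shape t)^° y -> (tile_shape t')^° y -> t = t'.
Proof.
move=> [_ _ _ dT] Tt Tt' ty t'y; case: (EM (t = t')) => // /(dT _ _ Tt Tt')/eqP h.
by move: h; apply: contraTeq => _; apply/set0P; exists y.
Qed.

Lemma puncture_inj T t t' : Omega T -> T t -> T t' -> puncture t = puncture t' -> t = t'.
Proof.
move=> OT Tt Tt' E; have [_ tT _ _] := hull_tiling OT.
apply: (tiling_interior_inj (hull_tiling OT) Tt Tt' (y := puncture t)).
  by case: (tT _ Tt).
by rewrite E; case: (tT _ Tt').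
Qed.

Lemma ord_pos_lower (n : nat) (f : 'I_n -> R) : (forall k, 0 < f k) ->
  exists2 m, 0 < m & forall k, m <= f k.
Proof.
elim: n f => [|n IH] f f0; first by exists 1 => // -[].
have [m m0 hm] := IH (fun k => f (lift ord0 k)) (fun k => f0 _).
exists (Num.min m (f ord0)); first by rewrite lt_min m0 f0.
move=> k; rewrite ge_min; case: (unliftP ord0 k) => [j ->|->]; last by rewrite lexx orbT.
by rewrite hm.
Qed.

Lemma ord_upper (n : nat) (f : 'I_n -> R) : exists2 m, 0 < m & forall k, f k <= m.
Proof.
elim: n f => [|n IH] f; first by exists 1 => // -[].
have [m m0 hm] := IH (fun k => f (lift ord0 k)).
exists (Num.max m (f ord0)); first by rewrite lt_max m0.
move=> k; rewrite le_max; case: (unliftP ord0 k) => [j ->|->]; last by rewrite lexx orbT.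
by rewrite hm.
Qed.

Lemma inner_radius : exists2 r, 0 < r & forall i, eball 0 r `<=` tile_shape (p i).
Proof.
have h i : exists r, 0 < r /\ eball 0 r `<=` tile_shape (p i).
  have [_] := sa_proto_tile hS i; rewrite proto0 => /interiorE[r r0 hr].
  by exists r.
have [m m0 hm] := ord_pos_lower (fun i => (svalP (cid (h i))).1).
exists m => // i; apply: subset_trans (svalP (cid (h i))).2.
exact: eball_mono.
Qed.

Lemma outer_radius : exists2 D, 0 < D & forall i, tile_shape (p i) `<=` eball 0 D.
Proof.
have h i : exists D, 0 < D /\ tile_shape (p i) `<=` eball 0 D.
  have [/polygonal_bounded[D D0 hD] _] := sa_proto_tile hS i.
  by exists D.
have [m m0 hm] := ord_upper (fun i => sval (cid (h i))).
exists m => // i; apply: subset_trans (svalP (cid (h i))).2 _.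
exact: eball_mono.
Qed.

Lemma sim_eball w v y r : normc w = 1 -> sim w v @` eball y r = eball (sim w v y) r.
Proof.
move=> w1; have w0 := normc_unit_neq0 w1; apply/seteqP; split=> u.
  by case=> u' u'r <-; rewrite /eball /= euclid_sim w1 mul1r.
move=> ur; exists (sim w^-1 (invv w v) u); last exact: simVK.
move: ur; rewrite -{1}(simVK v u w0) /eball /= euclid_sim w1 mul1r.
by [].
Qed.

Lemma tile_outer_radius : exists2 D, 0 < D &
  forall t, proto_tile t -> tile_shape t `<=` eball (puncture t) D.
Proof.
have [D D0 hD] := outer_radius; exists D => // _ [i [w [v [w1 ->]]]].
rewrite puncture_plc -sim_eball // proto0 shape_plc.
exact: image_subset.
Qed.

Lemma tile_diameter : exists2 D, 0 < D &
  forall t y r, proto_tile t -> tile_shape t y -> euclid y < r ->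
      tile_shape t `<=` eball 0 (r + D).
Proof.
have [D D0 hD] := tile_outer_radius; exists (2 * D) => [|t y r pt ty yr u tu];
    first by rewrite mulr_gt0.
have /= hu := hD _ pt _ tu; have /= hy := hD _ pt _ ty; rewrite /eball /= subr0 in hu hy *.
have := euclid_distm u (puncture t) y; rewrite (euclidB (puncture t) y).
have := euclid_distm u y 0; rewrite !subr0; lra.
Qed.

(** A puncture closer than the common inner radius to that of t' is an interior point of t', and
    interiors are disjoint. *)
Lemma puncture_discrete : exists2 r, 0 < r & forall T t t', Omega T -> T t -> T t' ->
  euclid (puncture t - puncture t') < r -> t = t'.
Proof.
have [r r0 hr] := inner_radius; exists r => // T t t' OT Tt Tt' tt'.
have [_ tT _ _] := hull_tiling OT.
apply: (tiling_interior_inj (hull_tiling OT) Tt Tt' (y := puncture t)).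
  by case: (tT _ Tt).
have [i [w [v [w1 E]]]] := hull_proto OT Tt'.
apply/interiorE; exists (r - euclid (puncture t - puncture t')); first by rewrite subr_gt0.
move=> u ut; have : eball (puncture t') r u.
  move: ut; rewrite /eball /=; have := euclid_distm u (puncture t) (puncture t'); lra.
rewrite E puncture_plc -sim_eball // proto0 shape_plc; apply: image_subset; exact: hr.
Qed.

(* A tile of omega^N(t) lies in lambda^N t, so its puncture, scaled back, is
   interior to t. *)
Lemma block_disjoint N T t t' s : Omega T -> T t -> T t' ->
  omega_iter S N [set t] s -> omega_iter S N [set t'] s -> t = t'.
Proof.
move=> OT Tt Tt' ts t's.
have [_ tT _ _] := hull_tiling (omega_iter_hull N OT).
have /tT[_ si] : omega_iter S N T s by apply/omega_iter_bigcup; exists t.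
have l0 : (lam ^+ N)%:C != 0 :> R[i].
  by apply/eqP => -[] h; have := lamX_gt0 N; rewrite h ltxx.
have hl : *:%R (lam ^+ N) = sim (lam ^+ N)%:C 0 :> ('cV[R]_2 -> 'cV[R]_2).
  by apply/funext => y; rewrite /sim cmx_real addr0.
have key u : omega_iter S N [set u] s ->
    (tile_shape u)^° (sim (lam ^+ N)%:C^-1 (invv (lam ^+ N)%:C 0) (puncture s)).
  move=> /omega_iter_shape[_ -> sub].
  have := interiorS sub si; rewrite hl => h.
  by rewrite -(interior_sim 0 _ _ l0) simVK.
exact: tiling_interior_inj (hull_tiling OT) Tt Tt' (key _ ts) (key _ t's).
Qed.

(** * Addresses in supertiles *)

Definition hull_at i T := Omega T /\ T (p i).

(* The tiling w(omega^N(T) - x(t)); V_N(p_i, t, t') consists of the pairs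
   (pt N w T t, pt N w T t') with T containing p_i. *)
Definition pt N w T t : tiling R := plt w (- (cmx w *m puncture t)) (omega_iter S N T).

Lemma hull_at_neq0 i : exists T, hull_at i T.
Proof.
have [T OT Tp] := sa_full_group hS (iso_id R) i; exists T; split=> //.
by move: Tp; rewrite iso_tileE /= expi0 mulmx0 plc1.
Qed.

Lemma pt_hull N w T t i : normc w = 1 -> hull_at i T -> Omega (pt N w T t).
Proof. by move=> w1 [OT _]; apply: hull_plt => //; exact: omega_iter_hull. Qed.

Lemma supertile_sub N i T : hull_at i T -> supertile N i `<=` omega_iter S N T.
Proof. by move=> [_ Tp] s Ns; apply/omega_iter_bigcup; exists (p i). Qed.

Lemma pt_mem N w T t s i : normc w = 1 -> hull_at i T -> supertile N i s ->
  pt N w T t (plc w (- (cmx w *m puncture t)) s).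
Proof. by move=> w1 XT Ns; exists s => //; exact: supertile_sub XT _ Ns. Qed.

Lemma pt_puncture w t s :
  puncture (plc w (- (cmx w *m puncture t)) s) = cmx w *m (puncture s - puncture t).
Proof. by rewrite puncture_plc /sim mulmxBr. Qed.

Lemma pt_Omega_punc N w T t i : normc w = 1 -> hull_at i T -> supertile N i t ->
  Omega_punc S (pt N w T t).
Proof.
move=> w1 XT Nt; split; first exact: pt_hull XT.
by exists (plc w (- (cmx w *m puncture t)) t);
    [exact: pt_mem XT _|rewrite pt_puncture subrr mulmx0].
Qed.

Lemma pt_shift N w T t t' :
  pt N w T t' = shift_tiling (- (cmx w *m (puncture t' - puncture t))) (pt N w T t).
Proof.
rewrite shift_tilingE /pt plt_comp mul1r cmx1_vec; congr plt.
by rewrite mulmxBr opprB addrA addNr sub0r.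
Qed.

Lemma pt_R_punc N w T t t' i : normc w = 1 -> hull_at i T -> supertile N i t ->
    supertile N i t' ->
  R_punc S (pt N w T t) (pt N w T t').
Proof.
move=> w1 XT Nt Nt'; split; first exact: pt_Omega_punc XT Nt.
exists (plc w (- (cmx w *m puncture t)) t'); first exact: pt_mem XT _.
by rewrite pt_puncture -pt_shift.
Qed.

(** Undo omega^N: the tile of T at the origin lies in omega^N(u) for a tile u of the preimage, and
    moving u onto its proto-tile yields T0 and w. *)
Lemma addr_exists N T : Omega_punc S T ->
  exists i T0 w t, [/\ hull_at i T0, normc w = 1, supertile N i t & T = pt N w T0 t].
Proof.
move=> [OT [s Ts s0]]; have [T' OT' E] := omega_iter_onto N OT.
have /omega_iter_bigcup[u T'u us] : omega_iter S N T' s by rewrite E.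
have [i [w [v [w1 uE]]]] := hull_proto OT' T'u; have w0 := normc_unit_neq0 w1.
move: us; rewrite uE omega_iter1 // => -[t Nt sE].
exists i, (plt w^-1 (invv w v) T'), w, t; split=> //.
- split; first by apply: hull_plt => //; exact: normc_unitV.
  by exists u => //; rewrite uE plcK.
rewrite -E -[in LHS](pltVK v w0 T') omega_iter_plt // /pt; congr plt.
(* The puncture of s being 0 forces lambda^N v = - w x(t), the translation in [pt]. *)
move: s0; rewrite -sE puncture_plc /sim => /eqP; rewrite addrC addr_eq0 => /eqP.
by [].
Qed.

(** With the translations divided by lambda^N, both sides are omega^N of tilings of the hull, which
    agree by injectivity. The tile at the origin is common to both, [block_disjoint] identifies the
    tile it comes from, and [plc_proto_inj] reads off i, w and the translation. *)
Lemma addr_unique N i T w t j T' w' t' : hull_at i T -> hull_at j T' -> normc w = 1 ->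
    normc w' = 1 ->
  supertile N i t -> supertile N j t' -> pt N w T t = pt N w' T' t' ->
  [/\ i = j, T = T', w = w' & t = t'].
Proof.
move=> XT XT' w1 w1' Nt Nt' E; have w0 := normc_unit_neq0 w1; have w0' := normc_unit_neq0 w1'.
have lN := lamX_gt0 N; have lN0 : lam ^+ N != 0 by rewrite gt_eqF.
pose v := - ((lam ^+ N)^-1 *: (cmx w *m puncture t)).
pose v' := - ((lam ^+ N)^-1 *: (cmx w' *m puncture t')).
have vE u x : lam ^+ N *: - ((lam ^+ N)^-1 *: (cmx u *m x)) = - (cmx u *m x).
  by rewrite scalerN scalerA divff // scale1r.
have ptE : pt N w T t = omega_iter S N (plt w v T) by rewrite omega_iter_plt // vE.
have ptE' : pt N w' T' t' = omega_iter S N (plt w' v' T') by rewrite omega_iter_plt // vE.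
have [[OT Tp] [OT' Tp']] := (XT, XT').
have TT : plt w v T = plt w' v' T'.
  by apply: (omega_iter_inj (N := N)); [exact: hull_plt|exact: hull_plt|rewrite -ptE E].
have O2 : Omega (plt w v T) by exact: hull_plt.
have ss : plc w (- (cmx w *m puncture t)) t = plc w' (- (cmx w' *m puncture t')) t'.
  apply: (puncture_inj (pt_hull N t w1 XT)); first exact: pt_mem XT _.
    by rewrite E; exact: pt_mem XT' _.
  by rewrite !pt_puncture !subrr !mulmx0.
have : plc w v (p i) = plc w' v' (p j).
  apply: (block_disjoint (N := N) O2); [by exists (p i)|by rewrite TT; exists (p j)|..].
  - by rewrite omega_iter1 // vE; exists t.
  - by rewrite omega_iter1 // vE ss; exists t'.
move=> /(plc_proto_inj w1 w1')[ij ww vv]; subst j w'.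
have tt : puncture t = puncture t'.
  move/oppr_inj/(scalerI (invr_neq0 lN0)): vv => /(congr1 (fun y => cmx w^-1 *m y)).
  by rewrite -!cmxM_vec mulVf // !cmx1_vec.
split=> //.
- by rewrite -(pltK v w0 T) TT /v' -tt -/v pltK.
- apply: (puncture_inj (omega_iter_hull N OT)) tt; first exact: supertile_sub XT _ Nt.
  exact: supertile_sub XT _ Nt'.
Qed.

(** Turning the tiling back until R_a(p_i) becomes p_i moves the rotation outside omega^N. *)
Lemma mem_V N i t t' T1 T2 : V_ N i t t' (T1, T2) <->
  exists T0 w, [/\ hull_at i T0, normc w = 1, T1 = pt N w T0 t & T2 = pt N w T0 t'].
Proof.
split.
- case=> T [a [OT Ta /= -> ->]]; rewrite rot_tileE in Ta.
  have u1 := expi_unit a; have u0 := normc_unit_neq0 u1.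
  exists (plt (expi a)^-1 (invv (expi a) 0) T), (expi a); split=> //.
  + split; first by apply: hull_plt => //; exact: normc_unitV.
    by rewrite -(plt_mem 0 _ _ u0) pltVK.
  + rewrite shift_tilingE rotmxE -[in LHS](pltVK 0 u0 T) omega_iter_plt // plt_comp.
    by rewrite scaler0 mulmx0 add0r mul1r.
  + rewrite shift_tilingE rotmxE -[in LHS](pltVK 0 u0 T) omega_iter_plt // plt_comp.
    by rewrite scaler0 mulmx0 add0r mul1r.
- case=> T [w [[OT Tp] w1 -> ->]]; have [a _ wE] := expi_surj w1; subst w.
  exists (plt (expi a) 0 T), a; split=> /=.
  + exact: hull_plt.
  + by rewrite rot_tileE; exists (p i).
  + by rewrite shift_tilingE rotmxE omega_iter_plt // plt_comp scaler0 mulmx0 add0r mul1r.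
  + by rewrite shift_tilingE rotmxE omega_iter_plt // plt_comp scaler0 mulmx0 add0r mul1r.
Qed.

Lemma expi_angle w v i : normc w = 1 -> expi (angle S (plc w v (p i))) = w.
Proof.
move=> w1; rewrite /angle; case: xgetP => [a _ [j [v' E]]|h].
  by move: E; rewrite placeE => /plc_proto_inj[]//; rewrite expi_unit.
have [a _ wE] := expi_surj w1; case: (h a).
by exists i, v; rewrite placeE wE.
Qed.

(** [origin_tile] chooses any tile through the origin. Since 0 is interior to t, another tile
    through 0 would have interior points inside t. *)
Lemma origin_tileE T t : Omega T -> T t -> puncture t = 0 -> origin_tile T = t.
Proof.
move=> OT Tt t0; have [_ tT _ _] := hull_tiling OT.
have [pt it] := tT _ Tt; rewrite t0 in it.
rewrite /origin_tile; case: xgetP => [s _ [Ts s0]|h]; last first.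
  by case: (h t); split=> //; exact: interior_subset.
have [ps _] := tT _ Ts.
have [r r0 hr] := (interiorE _ _).1 it.
have [y iy yr] := polygonal_sub_closure ps s0 r0.
apply: (tiling_interior_inj (hull_tiling OT) Ts Tt iy).
apply/interiorE; exists (r - euclid y); first by rewrite subr_gt0; move: yr;
    rewrite /eball /= subr0.
move=> u; rewrite /eball /= => uy; apply: hr; rewrite /eball /=.
have := euclid_distm u y 0; rewrite !subr0; lra.
Qed.

End Subst.

(** * Compactness of the hull *)

Lemma ultraI (Q : Type) (F : set_system Q) (A B : set Q) :
  UltraFilter F -> F A -> F B -> F (A `&` B).
Proof. by move=> ? FA FB; exact: filterI. Qed.

Section Ultra.
Variables (R : realType) (Q : Type) (F : set_system Q).
Context {FU : UltraFilter F}.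

(** Pigeonhole for ultrafilters; it plays the role of passing to a subsequence. *)
Lemma ultra_finite (U : eqType) (A : set U) (P : Q -> U -> Prop) : finite_set A ->
  F [set q | exists2 a, A a & P q a] -> exists2 a, A a & F [set q | P q a].
Proof.
move=> /finite_seqP[s ->]; elim: s => [|a s IH] /= h.
  have F0 : F set0 by apply: filterS h => q [].
  by case: (@filter_not_empty _ F _ F0).
have [Pa|nPa] := in_ultra_setVsetC [set q | P q a] FU.
  by exists a => //=; rewrite mem_head.
have [|b bs Pb] := IH; last by exists b => //=; rewrite inE bs orbT.
apply: filterS (ultraI FU h nPa) => q [[b]]; rewrite /= inE => /orP[/eqP->|bs Pb _] //.
by exists b.
Qed.

(** The limit is the supremum of the numbers that stay below f on a set of F. *)
Lemma ultra_cvgR (f : Q -> R) (K : R) : F [set q | `|f q| <= K] ->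
  exists a, forall e, 0 < e -> F [set q | `|f q - a| < e].
Proof.
move=> FK; pose A := [set x | F [set q | x <= f q]].
have hA : has_sup A.
  split; first by exists (- K); apply: filterS FK => q /=; rewrite ler_norml => /andP[].
  exists K => x Ax; have /filter_ex[q [/= xq]] := ultraI FU Ax FK.
  by rewrite ler_norml => /andP[_]; exact: le_trans xq.
exists (sup A) => e e0; have e2 : 0 < e / 2 by rewrite divr_gt0.
have [x Ax xe] := sup_adherent e2 hA.
have : ~ A (sup A + e / 2).
  move=> h; have := ub_le_sup hA.2 h; lra.
have [//|nA _] := in_ultra_setVsetC [set q | sup A + e / 2 <= f q] FU.
apply: filterS (ultraI FU Ax nA) => q /= [xq /negP]; rewrite -ltNge => fq.
by rewrite ltr_norml; apply/andP; split; lra.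
Qed.

Lemma normc_le_ReIm (w : R[i]) : normc w <= `|complex.Re w| + `|complex.Im w|.
Proof.
case: w => a b /=; rewrite -[leRHS]ger0_norm ?addr_ge0 // -sqrtr_sqr.
rewrite ler_sqrt ?sqr_ge0 // sqrrD !real_normK ?num_real //.
by rewrite -addrA lerD2l lerDr mulrn_wge0 // mulr_ge0.
Qed.

Lemma Re_le_normc (w : R[i]) : `|complex.Re w| <= normc w.
Proof.
case: w => a b /=; rewrite -sqrtr_sqr ler_sqrt ?addr_ge0 ?sqr_ge0 //.
by rewrite lerDl sqr_ge0.
Qed.

Lemma Im_le_normc (w : R[i]) : `|complex.Im w| <= normc w.
Proof.
case: w => a b /=; rewrite -sqrtr_sqr ler_sqrt ?addr_ge0 ?sqr_ge0 //.
by rewrite lerDr sqr_ge0.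
Qed.

Lemma ultra_cvgC (f : Q -> R[i]) (K : R) : F [set q | normc (f q) <= K] ->
  exists a, forall e, 0 < e -> F [set q | normc (f q - a) < e].
Proof.
move=> FK.
have [a ha] : exists a, forall e, 0 < e -> F [set q | `|complex.Re (f q) - a| < e].
  by apply: (@ultra_cvgR _ K); apply: filterS FK => q /=; apply: le_trans; exact: Re_le_normc.
have [b hb] : exists a, forall e, 0 < e -> F [set q | `|complex.Im (f q) - a| < e].
  by apply: (@ultra_cvgR _ K); apply: filterS FK => q /=; apply: le_trans; exact: Im_le_normc.
exists (a +i* b) => e e0; have e2 : 0 < e / 2 by rewrite divr_gt0.
apply: filterS (ultraI FU (ha _ e2) (hb _ e2)) => q /= [h1 h2].
apply: le_lt_trans (normc_le_ReIm _) _.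
move: h1 h2; case: (f q) => c d /=; lra.
Qed.

Lemma ultra_cvg_circle (f : Q -> R[i]) : F [set q | normc (f q) = 1] ->
  exists2 a, normc a = 1 & forall e, 0 < e -> F [set q | normc (f q - a) < e].
Proof.
move=> F1; have [|a ha] := @ultra_cvgC f 1; first by apply: filterS F1 => q /= ->.
exists a => //; apply/eqP; rewrite -subr_eq0 -normr_eq0; apply/eqP.
apply/le_anti; rewrite normr_ge0 andbT; apply/ler_addgt0Pr => e e0; rewrite add0r.
have /filter_ex[q /= [fq qe]] := ultraI FU F1 (ha _ e0).
have := le_normcD (f q - a) a; rewrite subrK.
have := le_normcD (a - f q) (f q); rewrite subrK fq.
have := normcB (f q) a; rewrite ler_norml; move=> *; apply/andP; split; lra.
Qed.

End Ultra.

(** * Limits of tilings in the hull and continuity of addresses *)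

Section Hull.
Variables (R : realType) (S : substitution_tiling R).
Hypothesis hS : standing_assumptions S.
Implicit Types (i j : 'I_(st_num S)) (w z : R[i]) (x y v : 'cV[R]_2) (r e : R) (t s : tile
    R) (T : tiling R).

Local Notation p := (st_proto (s := S)).
Local Notation Omega := (hull (st_tiling S)).
Local Notation lam := (st_lambda S).

(* A nonprincipal ultrafilter on an infinite patch would make punctures
   cluster. *)
Lemma patch_finite T r : Omega T -> finite_set (tile_patch T 0 r).
Proof.
move=> OT; apply: contrapT => ninf; set A := tile_patch T 0 r in ninf.
(* The sets containing all but finitely many tiles of the patch; a proper filter because the patch
   is infinite. *)
pose G : set_system (tile R) := [set B | finite_set (A `\` B)].
have GF : ProperFilter G.
  split; first by rewrite /G /= setD0.
  split=> [|B C|B C BC]; rewrite /G /=.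
  - by rewrite setDT; exact: finite_set0.
  - by rewrite setDIr => ? ?; rewrite finite_setU.
  - by apply: sub_finite_set; exact: setDS.
have [F [FU GsF]] := ultraFilterLemma GF.
have FA : F A by apply: GsF; rewrite /G /= setDv; exact: finite_set0.
have F1 t : F (~` [set t]).
  by apply: GsF; rewrite /G /= setDE setCK; apply: finite_setIr; exact: finite_set1.
have [a ha] : exists a, forall e, 0 < e -> F [set t | normc (cplx (puncture t) - a) < e].
  apply: (@ultra_cvgC _ _ _ _ _ r); apply: filterS FA => t [Tt tr] /=.
  have [_ tT _ _] := hull_tiling OT; have [_ /interior_subset/tr] := tT _ Tt.
  by rewrite /eball /= subr0 euclidE => /ltW.
have [r0 r00 hr0] := puncture_discrete hS.
have r02 : 0 < r0 / 2 by rewrite divr_gt0.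
have FAa := ultraI FU FA (ha _ r02).
have /filter_ex[t [[Tt _] /= ta]] := FAa.
have /filter_ex[t' [[[Tt' _] /= t'a] /=]] := ultraI FU FAa (F1 t); apply.
apply: (hr0 _ _ _ OT) => //; rewrite euclidE cplxB.
have := normc_distm (cplx (puncture t')) a (cplx (puncture t)).
by rewrite (normcB a); lra.
Qed.

(* Once the tile p_i is fixed, the isometry that moves a model patch into
   place is determined by the tile of the model that goes to p_i. *)
Lemma flc_ultra (Q : Type) (F : set_system Q) (FU : UltraFilter F) i (T : Q -> tiling R) r :
  F [set q | hull_at i (T q)] ->
  exists2 T0, hull_at i T0 & F [set q | hull_at i (T q) /\ agree T0 (T q) r].
Proof.
move=> FX; have [D D0 hD] := outer_radius hS.
(* The radius is at least D so that p_i itself belongs to the patch. *)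
pose r' := Num.max r D; have r'0 : 0 < r' by rewrite lt_max D0 orbT.
have [Fs [finFs hFs]] := sa_flc hS r'0.
have [|P FsP FP] := ultra_finite
  (P := fun q P => hull_at i (T q) /\ exists g, tile_patch (T q) 0 r' = iso_tiling g P) finFs.
  apply: filterS FX => q /= Xq; have [P [g [FP E]]] := hFs _ 0 Xq.1.
  by exists P => //; split=> //; exists g.
have Pfin : finite_set P.
  have /filter_ex[q [[OT _] [g E]]] := FP.
  have := patch_finite r' OT; rewrite E iso_tilingE.
  set w := expi g.2; set v := cmx _ *m _.
  have w0 : w != 0 by apply: normc_unit_neq0; exact: expi_unit.
  by move=> fin; rewrite -(pltK v w0 P); exact: finite_image.
have [|t0 Pt0 Ft0] := ultra_finite
  (P := fun q t => hull_at i (T q) /\ exists w v, [/\ normc w = 1,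
     tile_patch (T q) 0 r' = plt w v P & p i = plc w v t]) Pfin.
  apply: filterS FP => q [Xq [g E]]; move: (E); rewrite iso_tilingE => E'.
  have : tile_patch (T q) 0 r' (p i).
    split; first by case: Xq.
    by apply: subset_trans (hD i) _; apply: eball_mono; rewrite le_max lexx orbT.
  rewrite E' => -[t Pt tE]; exists t => //; split=> //.
  by exists (expi g.2), (cmx (expi g.2) *m g.1); rewrite expi_unit.
have /filter_ex[q0 [Xq0 [w [v [w1 E Et]]]]] := Ft0; exists (T q0) => //.
apply: filterS Ft0 => q [Xq [w' [v' [w1' E' Et']]]]; split=> //.
apply: (@agree_mono _ _ _ r'); first by rewrite le_max lexx.
have w0 := normc_unit_neq0 w1; have w0' := normc_unit_neq0 w1'.
apply/agreeE; rewrite E E'.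
have : plc w^-1 (invv w v) (p i) = plc w'^-1 (invv w' v') (p i).
  by rewrite {1}Et Et' !plcK.
move=> /(plc_proto_inj hS (normc_unitV w1) (normc_unitV w1'))[_ /invr_inj ww vv].
subst w'; congr plt.
by have := pltVK v w0; move: vv; rewrite /invv => /oppr_inj/(congr1 (fun y => cmx w *m y));
  rewrite -!cmxM_vec divff // !cmx1_vec.
Qed.

(** Tiles have bounded diameter, so each axiom of a tiling is tested inside a ball where T coincides
    with a member of the hull. *)
Lemma hull_closed T : @proto_tiles R S T ->
  (forall r, exists2 T', Omega T' & agree T T' r) -> Omega T.
Proof.
move=> pT hT.
have [D D0 hD] := tile_diameter hS; have [D' D'0 hD'] := tile_outer_radius hS.
have bT t : T t -> tile_shape t `<=` eball 0 (euclid (puncture t) + D').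
  move=> /pT/hD' tD; apply: subset_trans tD _ => y; rewrite /eball /= subr0 => yt.
  by have := euclid_distm y (puncture t) 0; rewrite !subr0; lra.
split; first split.
- pose T_ n : tiling R := sval (cid2 (hT n%:R)).
  have OT n : Omega (T_ n) by rewrite /T_; case: cid2.
  have ag n : agree T (T_ n) n%:R by rewrite /T_; case: cid2.
  apply: (@sub_countable _ _ _ (\bigcup_n T_ n)).
    apply: subset_card_le => t Tt.
    pose m := Num.bound (euclid (puncture t) + D').
    have hm : euclid (puncture t) + D' < m%:R.
      by apply: archi_boundP; rewrite addr_ge0 ?euclid_ge0 // ltW.
    exists m => //; apply/(ag m) => //; apply: subset_trans (bT _ Tt) _.
    by apply: eball_mono; exact: ltW.
  by apply: bigcup_countable => // n _; have [] := hull_tiling (OT n).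
- move=> t Tt; have [T' OT' ag] := hT (euclid (puncture t) + D').
  have [_ tT _ _] := hull_tiling OT'; apply: tT; apply/(ag t) => //; exact: bT.
- apply/seteqP; split=> // y _.
  have [T' OT' ag] := hT (euclid y + 1 + D).
  have [_ _ cov _] := hull_tiling OT'.
  have : [set: 'cV[R]_2] y by []; rewrite -cov => -[t T't ty].
  exists t => //; apply/(ag t) => //; apply: (hD _ y) => //; last by rewrite ltrDl.
  exact: (hull_proto hS OT').
- move=> s t Ts Tt st.
  have [T' OT' ag] := hT (euclid (puncture t) + D' + (euclid (puncture s) + D')).
  have [_ _ _ dT] := hull_tiling OT'; apply: dT => //.
    apply/(ag s) => //; apply: subset_trans (bT _ Ts) _; apply: eball_mono.
    by rewrite lerDr addr_ge0 ?euclid_ge0 // ltW.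
  apply/(ag t) => //; apply: subset_trans (bT _ Tt) _; apply: eball_mono.
  by rewrite lerDl addr_ge0 ?euclid_ge0 // ltW.
- move=> e /pos_below1[e1 [e10 e1e e11]].
  (* The isometry in [within_eps] translates by less than e1 < 1, so one extra unit of radius is
     lost at most. *)
  have [T' [_ hT'] ag] := hT (e1^-1 + 1).
  have [x /(dGamma_lt_within e11)/within_epsE[_ _ [w [v [w' [v' [h1 h2 h3 h4 h5]]]]]]] :=
      hT' _ e10.
  exists x; apply: within_dGamma_lt e1e _; apply/within_epsE; split=> //.
  exists w, v, w', v'; split=> //; apply: agree_trans h5.
  apply: agree_plt ag => //; rewrite lerD2l.
  have : 0 <= Num.sqrt 2 * normc (w - 1) by rewrite mulr_ge0 ?sqrtr_ge0 ?normc_ge0.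
  by move: h3; rewrite /near_id; lra.
Qed.

(** The limit consists of the tiles that lie in T q for a set of q belonging to F. By [flc_ultra] it
    coincides on every ball with members of the hull, hence lies in the hull. *)
Lemma hull_at_compact (Q : Type) (F : set_system Q) (FU : UltraFilter F) i (T : Q -> tiling R) :
  F [set q | hull_at i (T q)] ->
  exists2 T0, hull_at i T0 & forall r, F [set q | hull_at i (T q) /\ agree T0 (T q) r].
Proof.
move=> FX; pose T0 : tiling R := [set t | F [set q | T q t]].
have ag r : exists2 T', hull_at i T' & agree T0 T' r /\ F [set q | hull_at i (T q) /\ agree
    T0 (T q) r].
  have [T' XT' F'] := flc_ultra FU r FX; exists T' => //.
  have ag : agree T0 T' r.
    move=> t tr; split.
      by move=> /(ultraI FU F')/filter_ex[q [[_ h] Tt]]; apply/(h t).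
    by move=> T't; apply: filterS F' => q [_ h]; apply/(h t).
  by split=> //; apply: filterS F' => q [Xq h]; split=> //; exact: agree_trans h.
exists T0; last by move=> r; have [? _ []] := ag r.
split; last by apply: filterS FX => q [].
apply: hull_closed.
  by move=> t /(ultraI FU FX)/filter_ex[q [[OT _] Tt]]; exact: (hull_proto hS OT).
by move=> r; have [T' [OT' _] [? _]] := ag r; exists T'.
Qed.

(** A tile of omega^N(T) inside B(0, r) lies in lambda^N t for some tile t of T. As lambda^N >= 1, t
    meets B(0, r) and so fits in B(0, r + D). *)
Lemma agree_omega N : exists2 D, 0 < D & forall T T' r, Omega T -> Omega T' ->
  agree T T' (r + D) -> agree (omega_iter S N T) (omega_iter S N T') r.
Proof.
have [D D0 hD] := tile_diameter hS; exists D => // T T' r OT OT' ag.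
have l1 : 1 <= lam ^+ N by apply: exprn_ege1; exact: ltW (sa_lambda hS).
have half T1 T2 s : Omega T1 -> agree T1 T2 (r + D) -> tile_shape s `<=` eball 0 r ->
    omega_iter S N T1 s -> omega_iter S N T2 s.
  move=> O1 ag1 sr N1s; have [_ tT _ _] := hull_tiling (omega_iter_hull hS N O1).
  have [ps _] := tT _ N1s; have [y sy] := polygonal_neq0 ps.
  have /omega_iter_bigcup[t T1t ts] := N1s.
  have [_ -> /(_ _ sy)[y' ty' yE]] := omega_iter_shape hS ts.
  apply/omega_iter_bigcup; exists t => //; apply/(ag1 t) => //.
  apply: (hD _ y' r) => //; first exact: (hull_proto hS O1).
  have := sr _ sy; rewrite /eball /= subr0 -yE euclidZ ger0_norm; last exact: le_trans l1.
  by apply: le_lt_trans; rewrite ler_peMl // euclid_ge0.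
move=> s sr; split; first exact: half.
by apply: half => //; exact: agree_sym.
Qed.

(** Turning the first tiling by w' / w removes the difference in rotation, after which the two agree
    exactly on a large ball. *)
Lemma pt_continuous N w T t i e : normc w = 1 -> hull_at i T -> 0 < e ->
  exists r d, 0 < d /\ forall w' T', normc w' = 1 -> hull_at i T' -> agree T T' r ->
    normc (w' - w) < d -> dGamma (pt S N w T t) (pt S N w' T' t) < e.
Proof.
move=> w1 [OT _] e0; have w0 := normc_unit_neq0 w1.
have [e1 [e10 e1e e11]] := pos_below1 e0.
have [D D0 hD] := agree_omega N.
(* The radius allows for the translation by x(t) and for the loss D in [agree_omega]; half of e1
   suffices because sqrt 2 < 2. *)
exists (e1^-1 + euclid (puncture t) + D), (e1 / 2); split; first by rewrite divr_gt0.
move=> w' T' w1' [OT' _] ag ww.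
apply: within_dGamma_lt e1e _; apply/within_epsE; split=> //.
have w0' := normc_unit_neq0 w1'.
exists (w' / w), 0, 1, 0; split.
- by rewrite normc_unitM // normc_unitV.
- exact: normc1.
- rewrite /near_id euclid0 add0r (_ : w' / w - 1 = (w' - w) / w); last first.
    by rewrite mulrBl divff.
  rewrite normcM normc_unitV // mulr1.
  have s2 : Num.sqrt 2 < 2 :> R.
    rewrite -[ltRHS]ger0_norm ?ler0n // -sqrtr_sqr ltr_sqrt; first by rewrite expr2; lra.
    by rewrite exprn_gt0.
  have := normc_ge0 (w' - w); have := sqrtr_ge0 (2 : R); move: (normc _) ww => A; nra.
- by rewrite /near_id euclid0 subrr normc0 mulr0 addr0.
rewrite plt1 /pt plt_comp divfK // addr0 mulmxN -cmxM_vec divfK //.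
apply: agree_plt (hD _ _ _ OT OT' ag) => //.
by rewrite euclidN euclid_cmx w1' mul1r.
Qed.

(** Move the tile by the first isometry, transfer it to T' by agreement, and undo the second
    isometry. The unit in r + 1 covers the displacement by the first one. *)
Lemma near_tile T T' w v i e r : within_eps T T' e -> normc w = 1 -> T (plc w v (p i)) ->
  tile_shape (plc w v (p i)) `<=` eball 0 r -> r + 1 <= e^-1 ->
  exists w' v', [/\ normc w' = 1, T' (plc w' v' (p i)), normc (w' - w) < 2 * e
    & euclid (v' - v) < 2 * e * (1 + euclid v)].
Proof.
move=> /within_epsE[e0 e1 [a [b [a' [b' [a1 a1' n1 n2 ag]]]]]] w1 Tt tr re.
have a0 := normc_unit_neq0 a1; have a0' := normc_unit_neq0 a1'.
have s2 : 1 <= Num.sqrt 2 :> R by rewrite -[leLHS]sqrtr1 ler_sqrt ?ler1n ?ler0n.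
have hn c d : near_id c d e -> normc (c - 1) <= e /\ euclid d <= e /\ normc (c - 1) +
    euclid d < e.
  rewrite /near_id; have := normc_ge0 (c - 1); have := euclid_ge0 d.
  by move: (normc _) (euclid _) => A B *; split; [|split]; nra.
have [na [nb nab]] := hn _ _ n1; have [na' [nb' nab']] := hn _ _ n2.
have : plt a' b' T' (plc a b (plc w v (p i))).
  apply/(ag _) => [|]; last by exists (plc w v (p i)).
  move=> _ [y ty <-]; have := tr _ ty; rewrite /eball /= !subr0 /sim => yr.
  by have := euclidD (cmx a *m y) b; rewrite euclid_cmx a1 mul1r; lra.
case=> t T't tE.
have tE2 : t = plc (a'^-1 * (a * w)) (cmx a'^-1 *m (cmx a *m v + b) + invv a' b') (p i).
  by rewrite -(plcK b' a0' t) tE [plc a b _]plc_comp plc_comp.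
exists (a'^-1 * (a * w)), (cmx a'^-1 *m (cmx a *m v + b) + invv a' b'); split.
- by rewrite normc_unitM ?normc_unitV // normc_unitM.
- by rewrite -tE2.
- rewrite (_ : a'^-1 * (a * w) - w = a'^-1 * w * (a - a')); last by field.
  rewrite !normcM normc_unitV // w1 !mul1r.
  have := normc_distm a 1 a'; rewrite (normcB 1).
  have := euclid_ge0 b; have := euclid_ge0 b'; lra.
- rewrite (_ : _ - v = cmx a'^-1 *m (cmx (a - a') *m v + (b - b'))); last first.
    by apply: cplx_inj; rewrite /invv !(cplxB, cplxD, cplxN, cplx_cmx); field.
  rewrite euclid_cmx normc_unitV // mul1r; apply: le_lt_trans (euclidD _ _) _.
  rewrite euclid_cmx.
  have haa : normc (a - a') <= 2 * e.
    have := normc_distm a 1 a'; rewrite (normcB 1); lra.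
  have := ler_wpM2r (euclid_ge0 v) haa.
  have := euclidD b (- b'); rewrite euclidN.
  have hbb : euclid b < e by have := normc_ge0 (a - 1); lra.
  by rewrite mulrDr mulr1; lra.
Qed.

(** Punctures in T' are discrete, so all sufficiently good approximants are one and the same tile,
    which must be the limit. *)
Lemma near_limit_mem T T' w v i : Omega T' -> normc w = 1 ->
  (forall e, 0 < e -> exists w' v', [/\ normc w' = 1, T' (plc w' v' (p i)),
     normc (w' - w) < e & euclid (v' - v) < e]) -> T' (plc w v (p i)).
Proof.
move=> OT' w1 h; have [r r0 hr] := puncture_discrete hS.
have r2 : 0 < r / 2 by rewrite divr_gt0.
have [w0 [v0 [w01 T'0 _ vv0]]] := h _ r2.
have key e : 0 < e -> normc (w0 - w) < e /\ euclid (v0 - v) < e.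
  move=> e0; have m0 : 0 < Num.min e (r / 2) by rewrite lt_min e0.
  have [w' [v' [w'1 T'1]]] := h _ m0; rewrite !lt_min => /andP[we _] /andP[ve vr].
  have : plc w0 v0 (p i) = plc w' v' (p i).
    apply: (hr _ _ _ OT') => //; rewrite !puncture_plc_proto //.
    by have := euclid_distm v0 v v'; rewrite (euclidB v); lra.
  by move=> /(plc_proto_inj hS w01 w'1)[_ -> ->].
have wE : w0 = w.
  apply/eqP; rewrite -subr_eq0; apply/eqP/eq0_normc.
  by apply/le_anti; rewrite normc_ge0 andbT; apply/ler_addgt0Pr => e e0;
      rewrite add0r ltW //; case: (key _ e0).
have vE : v0 = v.
  apply/eqP; rewrite -subr_eq0; apply/eqP/euclid_eq0.
  by apply/le_anti; rewrite euclid_ge0 andbT; apply/ler_addgt0Pr => e e0;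
      rewrite add0r ltW //; case: (key _ e0).
by rewrite -wE -vE.
Qed.

(** The intermediate tiling T'' stands in for the triangle inequality: each tile is followed from T
    to T'' and on to T'. *)
Lemma hull_separated_sub T T' : Omega T -> Omega T' ->
  (forall e, 0 < e -> e < 1 -> exists2 T'', within_eps T T'' e & within_eps T'' T' e) ->
      T `<=` T'.
Proof.
move=> OT OT' h t Tt; have [i [w [v [w1 tE]]]] := hull_proto hS OT Tt; subst t.
apply: near_limit_mem => // e e0.
have [D D0 hD] := tile_outer_radius hS.
have Dp w' v' : normc w' = 1 -> tile_shape (plc w' v' (p i)) `<=` eball 0 (euclid v' + D).
  move=> w1' y ty; have pp : proto_tile S (plc w' v' (p i)) by exists i, w', v'.
  have := hD _ pp _ ty; rewrite puncture_plc_proto // /eball /= subr0 => yv.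
  by have := euclid_distm y v' 0; rewrite !subr0; lra.
have v0 := euclid_ge0 v.
pose K := 4 + 4 * euclid v + D + 4.
have K0 : 0 < K by rewrite /K; lra.
(* Two uses of [near_tile] cost at most 4c in rotation and 4c (2 + |v|) in position, kept below e by
   the first two bounds. The third gives |v'| <= |v| + 1, and the last keeps the tiles inside the
   ball of agreement. *)
pose c := Num.min (Num.min (e / 8) (e / (8 * (1 + euclid v + 1)))) (Num.min (1 / (4 * (1 +
    euclid v))) K^-1).
have V0 : 0 < 1 + euclid v by lra.
have c0 : 0 < c.
  by rewrite !lt_min !divr_gt0 ?invr_gt0 //=; rewrite ?mulr_gt0 //; lra.
have cE1 : c <= e / 8 by rewrite /c !ge_min lexx.
have cE2 : c * (8 * (1 + euclid v + 1)) <= e.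
  by rewrite -ler_pdivlMr; [rewrite /c !ge_min lexx ?orbT|lra].
have cE3 : c * (4 * (1 + euclid v)) <= 1.
  by rewrite -ler_pdivlMr; [rewrite /c !ge_min lexx ?orbT|lra].
have cE4 : K <= c^-1.
  by rewrite -[K]invrK lef_pV2 ?posrE ?invr_gt0 // /c !ge_min lexx ?orbT.
have c1 : c < 1.
  have : c <= K^-1 by rewrite /c !ge_min lexx ?orbT.
  by move/le_lt_trans; apply; rewrite invf_lt1 // /K; lra.
have [T'' W1 W2] := h _ c0 c1.
have [|w' [v' [w'1 T''t ww vv]]] := near_tile W1 w1 Tt (Dp _ _ w1).
  by apply: le_trans cE4; rewrite /K; lra.
have v'1 : euclid v' <= euclid v + 1.
  have := euclidD (v' - v) v; rewrite subrK; nra.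
have [|w2 [v2 [w21 T't ww2 vv2]]] := near_tile W2 w'1 T''t (Dp _ _ w'1).
  by apply: le_trans cE4; rewrite /K; lra.
exists w2, v2; split=> //.
- by have := normc_distm w2 w' w; lra.
- have := euclid_distm v2 v' v.
  have := euclid_ge0 v'; nra.
Qed.

Lemma hull_separated T T' : Omega T -> Omega T' ->
  (forall e, 0 < e -> e < 1 -> exists2 T'', within_eps T T'' e & within_eps T'' T' e) -> T = T'.
Proof.
move=> OT OT' h; apply/seteqP; split; apply: hull_separated_sub => // e e0 e1;
    have [T'' W1 W2] := h _ e0 e1.
by exists T''; exact: within_eps_sym.
Qed.

(* Addresses depend continuously on the tiling: a limit of addresses exists by
   compactness and is the address of the limit tiling, as the hull is Hausdorff
   and addresses are unique. *)
Lemma addr_limit (Q : Type) (F : set_system Q) (FU : UltraFilter F) N i T w t (T1 : Q ->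
    tiling R) :
  hull_at i T -> normc w = 1 -> supertile N i t ->
  F [set q | Omega_punc S (T1 q)] ->
  (forall e, 0 < e -> F [set q | dGamma (pt S N w T t) (T1 q) < e]) ->
  forall e, 0 < e -> F [set q | exists T' w',
    [/\ hull_at i T', normc w' = 1, T1 q = pt S N w' T' t & normc (w' - w) < e]].
Proof.
move=> XT w1 Nt FO Fd.
pose P q j t' := exists T' w', [/\ hull_at j T', normc w' = 1,
    supertile N j t' & T1 q = pt S N w' T' t'].
have [|j _ Fj] := ultra_finite (P := fun q j => exists t',
    P q j t') (finite_finset : finite_set [set: 'I_(st_num S)]).
  apply: filterS FO => q /(addr_exists hS N)[j [T' [w' [t' [h1 h2 h3 h4]]]]].
  by exists j => //; exists t', T', w'.
have [|t' Nt' Ft'] := ultra_finite (P := fun q t' => P q j t') (supertile_finite hS N j).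
  by apply: filterS Fj => q [t' [T' [w' h]]]; exists t'; [case: h|exists T', w'].
(* A chosen address of T1 q with the fixed j and t', and a dummy pair where there is none. *)
pose c q := if pselect (P q j t') is left h then (sval (cid h),
    sval (cid (svalP (cid h)))) else (set0, 0).
have hc q : P q j t' -> [/\ hull_at j (c q).1,
    normc (c q).2 = 1 & T1 q = pt S N (c q).2 (c q).1 t'].
  move=> Pq; rewrite /c; case: pselect => // h /=.
  by case: (svalP (cid (svalP (cid h)))).
have [w' w'1 Fw] : exists2 a, normc a = 1 & forall e, 0 < e ->
    F [set q | normc ((c q).2 - a) < e].
  by apply: ultra_cvg_circle; apply: filterS Ft' => q /hc[].
have [T' XT' FT] : exists2 T0, hull_at j T0 & forall r,
    F [set q | hull_at j (c q).1 /\ agree T0 (c q).1 r].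
  by apply: hull_at_compact; apply: filterS Ft' => q /hc[].
have E : pt S N w T t = pt S N w' T' t'.
  apply: hull_separated; [exact: (pt_hull hS _ _ w1 XT)|exact: (pt_hull hS _ _ w'1 XT')|].
  move=> e e0 e1; have [r [d [d0 hd]]] := pt_continuous N t' w'1 XT' e0.
  have /filter_ex[q [[/= Fq1 [Fq2 Fq3]] [/= Fq4 Fq5]]] :=
    ultraI FU (ultraI FU (Fd _ e0) (FT r)) (ultraI FU (Fw _ d0) Ft').
  have [Xc c1 T1E] := hc _ Fq5.
  exists (T1 q); first exact: dGamma_lt_within.
  by apply: within_eps_sym; rewrite T1E; apply: dGamma_lt_within => //; exact: hd.
have [ij TT ww tt] := addr_unique hS XT XT' w1 w'1 Nt Nt' E.
subst j T' w' t' => e e0.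
apply: filterS (ultraI FU Ft' (Fw _ e0)) => q [/hc[h1 h2 h3] /= h4].
by exists (c q).1, (c q).2.
Qed.

End Hull.

(** * Neighbourhoods and continuity on the circle *)

Section CircleTopology.
Variable R : realType.
Implicit Types (z : R[i]) (e : R).
Local Notation S1 := (set_type (@circle R)).

(** Radii of balls over the complex numbers are themselves complex; being positive forces them to be
    real. *)
Lemma nbhsC (z : R[i]^o) (A : set R[i]^o) :
  nbhs z A <-> exists2 e, 0 < e & forall z', normc (z' - z) < e -> A z'.
Proof.
split.
- move=> /nbhs_ballP[[a b] /=]; rewrite ltcE /= => /andP[/eqP b0 a0]; subst b => h.
  exists a => // z' zz; apply: h; rewrite -ball_normE /= normc_norm normcB.
  by rewrite -[_ +i* _]/(a%:C) ltcR.
- case=> e e0 h; apply/nbhs_ballP; exists e%:C => /=; first by rewrite ltcR.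
  move=> z' /=; rewrite -ball_normE /= normc_norm normcB ltcR; exact: h.
Qed.

Lemma circle_unit (w : S1) : normc (val w) = 1.
Proof. by have := set_mem (valP w); rewrite /circle /= normc_norm => -[]. Qed.

Lemma circleP (w : R[i]) : normc w = 1 -> exists u : S1, val u = w.
Proof.
move=> w1; have h : (w : R[i]^o) \in @circle R.
  by rewrite inE /circle /= normc_norm w1.
by exists (exist _ w h).
Qed.

Lemma circle_continuous (g : S1 -> R[i]^o) : continuous g <->
  forall (w : S1) e, 0 < e -> exists2 d : R, 0 < d &
    forall w' : S1, normc (val w' - val w) < d -> normc (g w' - g w) < e.
Proof.
split=> [cg w e e0|h w A].
- have : nbhs (g w) [set z | normc (z - g w) < e] by apply/nbhsC; exists e.
  move=> /(cg w); rewrite nbhsE => -[U [[V oV VU] Uw] UA].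
  have : nbhs (val w : R[i]^o) V.
    by rewrite nbhsE; exists V => //; split=> //; move: Uw; rewrite -VU.
  move=> /nbhsC[d d0 hd]; exists d => // w' ww; apply: UA; rewrite -VU; exact: hd.
- move=> /nbhsC[e e0 hA]; have [d d0 hd] := h w _ e0.
  have : nbhs w (val @^-1` [set z : R[i]^o | normc (z - val w) < d] : set S1).
    apply: (@initial_continuous _ _ (@set_val _ (@circle R))).
    by apply/nbhsC; exists d.
  move=> nw; apply: (@filterS _ (nbhs w) _ _ _ _ nw) => w' /= /hd/hA.
  by [].
Qed.

End CircleTopology.

(** * Functions on blocks *)

Section Blocks.
Variables (R : realType) (S : substitution_tiling R).
Hypothesis hS : standing_assumptions S.
Implicit Types (i j : 'I_(st_num S)) (x y v : 'cV[R]_2) (r e : R) (t s : tile R) (T : tiling R).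

Local Notation p := (st_proto (s := S)).
Local Notation Omega := (hull (st_tiling S)).
Local Notation lam := (st_lambda S).
Local Notation S1 := (set_type (@circle R)).

(* The tiles of omega^N(p_i), indexed by 'I_(level_dim N i).+1 to match the
   sizes of [circle_block]. *)
Definition tiles N i : seq (tile R) := finmap.enum_fset (fset_set (supertile N i)).
Definition level_dim N i : nat := (size (tiles N i)).-1.
Definition level_tile N i (k : 'I_(level_dim N i).+1) : tile R := nth (set0, 0) (tiles N i) k.
Definition level_block N : circle_block := @CircleBlock (st_num S) (level_dim N).

Lemma mem_tiles N i t : (t \in tiles N i) <-> supertile N i t.
Proof.
have := in_fset_set (supertile_finite hS N i) t; rewrite /tiles => ->.
by rewrite inE.
Qed.

Lemma size_tiles N i : size (tiles N i) = (level_dim N i).+1.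
Proof.
rewrite /level_dim; have [t /mem_tiles] := supertile_neq0 hS N i.
by case: (tiles N i).
Qed.

Lemma level_tile_supertile N i (k : 'I_(level_dim N i).+1) : supertile N i (level_tile k).
Proof. by apply/mem_tiles; rewrite mem_nth // size_tiles. Qed.

Lemma level_tile_inj N i : injective (@level_tile N i).
Proof.
move=> k l /eqP; rewrite nth_uniq ?size_tiles ?finmap.fset_uniq //.
by move=> /eqP/val_inj.
Qed.

Lemma level_tile_surj N i t : supertile N i t ->
    exists k : 'I_(level_dim N i).+1, t = level_tile k.
Proof.
move=> /mem_tiles ti; have h : (index t (tiles N i) < (level_dim N i).+1)%N.
  by rewrite -size_tiles index_mem.
by exists (Ordinal h); rewrite /level_tile /= nth_index.
Qed.

Definition pnt N i T (w : S1) (k : 'I_(level_dim N i).+1) : tiling R :=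
    pt S N (val w) T (level_tile k).

(** The indices are compared as natural numbers because their types depend on i and j. *)
Lemma pnt_inj N i T w (k : 'I_(level_dim N i).+1) j T' w' (l : 'I_(level_dim N j).+1) :
    hull_at i T -> hull_at j T' ->
  pnt T w k = pnt T' w' l -> [/\ i = j, T = T', w = w' & k = l :> nat].
Proof.
move=> XT XT' E.
have [ij TT ww tt] := addr_unique hS XT XT' (circle_unit w) (circle_unit w')
    (level_tile_supertile k) (level_tile_supertile l) E.
subst j; split=> //; first exact/val_inj.
by rewrite (level_tile_inj tt).
Qed.

Lemma pnt_exists N T : Omega_punc S T ->
  exists i T0 w (k : 'I_(level_dim N i).+1), hull_at i T0 /\ T = pnt T0 w k.
Proof.
move=> /(addr_exists hS N)[i [T0 [w [t [XT /circleP[u <-] /level_tile_surj[k ->] ->]]]]].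
by exists i, T0, u, k.
Qed.

Lemma pnt_R_punc N i T w (k l : 'I_(level_dim N i).+1) : hull_at i T ->
  R_punc S (pnt T w k) (pnt T w l).
Proof.
by move=> XT; apply: (pt_R_punc hS (circle_unit w) XT); exact: level_tile_supertile.
Qed.

Definition same_block N T1 T2 := exists i T w (k l : 'I_(level_dim N i).+1),
  [/\ hull_at i T, T1 = pnt T w k & T2 = pnt T w l].

Lemma same_block_R_punc N T1 T2 : same_block N T1 T2 -> R_punc S T1 T2.
Proof. by move=> [i [T [w [k [l [XT -> ->]]]]]]; exact: pnt_R_punc. Qed.

(** One record, so that a single choice yields i together with the indices whose type depends on
    it. *)
Record adr N := Adr {
  adr_i : 'I_(st_num S); adr_T : tiling R; adr_w : S1;
  adr_k : 'I_(level_dim N adr_i).+1; adr_l : 'I_(level_dim N adr_i).+1 }.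

Definition adr_of N (D : adr N) T1 T2 := [/\ hull_at (adr_i D) (adr_T D),
  T1 = pnt (adr_T D) (adr_w D) (adr_k D) & T2 = pnt (adr_T D) (adr_w D) (adr_l D)].

(** The chosen address does not matter, because addresses are unique; see [block_fun_pnt]. *)
Definition block_fun N (F : block_algebra R (level_block N)) : pair_fun R := fun T1 T2 =>
  if pselect (exists D : adr N, adr_of D T1 T2) is left h then
    let D := sval (cid h) in F (adr_i D) (adr_w D) (adr_k D) (adr_l D)
  else 0.

Lemma block_fun_pnt N (F : block_algebra R (level_block N)) i T w (k l : 'I_(level_dim N
    i).+1) : hull_at i T ->
  block_fun F (pnt T w k) (pnt T w l) = F i w k l.
Proof.
move=> XT; rewrite /block_fun; case: pselect => [h|[]]; last by exists (@Adr N i T w k l).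
case: (cid h) => -[j T' w' k' l'] /= [/= XT' E1 E2].
have [ij TT ww kk] := pnt_inj XT XT' E1; have [_ _ _ ll] := pnt_inj XT XT' E2.
by subst j T' w'; rewrite (val_inj kk) (val_inj ll).
Qed.

Lemma block_fun_out N (F : block_algebra R (level_block N)) T1 T2 : ~ same_block N T1 T2 ->
    block_fun F T1 T2 = 0.
Proof.
move=> h; rewrite /block_fun; case: pselect => // -[[i T w k l] [/= XT E1 E2]].
by case: h; exists i, T, w, k, l.
Qed.

(** Two displacements leading to the same tiling would differ by a period, which strong aperiodicity
    forbids. *)
Lemma displacementE T1 v t : Omega T1 -> T1 t -> puncture t = v ->
  displacement (T1, shift_tiling (- v) T1) = v.
Proof.
move=> OT Tt tv; rewrite /displacement; case: xgetP => /= [v' _ [t' _ [_ E]]|h]; last first.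
  by case: (h v); exists t.
apply/eqP; rewrite -subr_eq0; apply/negP => /negP/eqP nv.
have := sa_aperiodic hS OT nv; apply.
move/(congr1 (shift_tiling v')): E; rewrite !shift_tilingD addNr shift_tiling0.
by rewrite addrC.
Qed.

Lemma displacement_pt N i T w t t' : hull_at i T -> normc w = 1 -> supertile N i t ->
    supertile N i t' ->
  displacement (pt S N w T t, pt S N w T t') = cmx w *m (puncture t' - puncture t).
Proof.
move=> XT w1 Nt Nt'; rewrite (pt_shift _ _ _ _ t t').
apply: (displacementE (t := plc w (- (cmx w *m puncture t)) t')).
- exact: (pt_hull hS _ _ w1 XT).
- exact: (pt_mem _ w1 XT).
- by rewrite pt_puncture.
Qed.

Local Notation RS := (R_punc_space S).

(* Continuity and compactness are tested on ultrafilters, so that no triangle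
   inequality for dGamma is needed. *)
Definition metric_cvg (F : set_system RS) (q : RS) := forall e, 0 < e ->
    F [set q' | dR q q' < e].

(** If P failed arbitrarily close to q, the nearby points of failure would generate a proper filter,
    and an ultrafilter above it would converge to q without containing P. *)
Lemma local_of_ultra (q : RS) (P : RS -> Prop) :
  (forall F, UltraFilter F -> metric_cvg F q -> F P) ->
  exists2 e, 0 < e & forall q', dR q q' < e -> P q'.
Proof.
move=> h; apply: contrapT => nh.
pose G : set_system RS := [set A | exists2 e, 0 < e & forall q', dR q q' < e -> ~ P q' -> A q'].
have GF : ProperFilter G.
  split.
  - case=> e e0 hG; apply: nh; exists e => // q' qq'; apply: contrapT => nP.
    exact: hG qq' nP.
  - split=> [|A B|A B AB]; first by exists 1.
    + move=> [a a0 ha] [b b0 hb]; exists (Num.min a b); first by rewrite lt_min a0.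
      by move=> q'; rewrite lt_min => /andP[qa qb] nP; split; [exact: ha|exact: hb].
    + by move=> [a a0 ha]; exists a => // q' qa nP; apply: AB; exact: ha.
have [F [FU GsF]] := ultraFilterLemma GF.
have FP : F P by apply: h => // e e0; apply: GsF; exists e.
have FnP : F (~` P) by apply: GsF; exists 1.
by have /filter_ex[q' []] := ultraI FU FP FnP.
Qed.

(** The neighbourhood used is the whole set where f is within e of its value at q; its openness
    comes from the hypothesis at each of its points, as balls of [dR] are not known to be open. *)
Lemma metric_continuous (f : pair_fun R) :
  (forall q : RS, forall e, 0 < e -> forall F, UltraFilter F -> metric_cvg F q ->
     F [set q' | normc (pair_fun_on f q' - pair_fun_on f q) < e]) ->
  continuous (pair_fun_on (S := S) f).
Proof.
move=> h q A /nbhsC[e e0 hA]; rewrite /nbhs /=.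
apply: (@filterS _ (nbhs q) _ [set q' | normc (pair_fun_on f q' - pair_fun_on f q) < e]).
  by move=> q' /hA.
rewrite nbhsE; exists [set q' | normc (pair_fun_on f q' - pair_fun_on f q) < e] => //.
split; last by rewrite /= subrr normc0.
move=> q1 /= q1e; have e1 : 0 < e - normc (pair_fun_on f q1 - pair_fun_on f q) by rewrite
    subr_gt0.
have [d d0 hd] := local_of_ultra (h q1 _ e1); exists d => // q' /hd /=.
have := normc_distm (pair_fun_on f q') (pair_fun_on f q1) (pair_fun_on f q); lra.
Qed.

Lemma metric_cvg_nbhs (F : set_system RS) (q : RS) : UltraFilter F -> metric_cvg F q -> F --> q.
Proof.
move=> FU h A; rewrite nbhsE => -[U [oU Uq] UA]; have [e e0 he] := oU _ Uq.
by apply: filterS (h _ e0) => q' /he/UA.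
Qed.

Lemma dR_dGamma (q q' : RS) e : dR q q' < e -> dGamma (sval q).1 (sval q').1 < e.
Proof. by apply: le_lt_trans; rewrite /dR lerDl euclid_ge0. Qed.

Lemma dR_displacement (q q' : RS) e : dR q q' < e ->
  euclid (displacement (sval q) - displacement (sval q')) < e.
Proof. by apply: le_lt_trans; rewrite /dR lerDr dGamma_ge0. Qed.

(** By [addr_limit] the first tiling keeps t and has w' near w. The displacement is then close to
    the puncture of the tile of index t', and discreteness of punctures makes it equal. *)
Lemma pair_limit_in (F : set_system RS) (q : RS) N i T w t t' : UltraFilter F ->
    metric_cvg F q ->
  hull_at i T -> normc w = 1 -> supertile N i t -> supertile N i t' ->
  sval q = (pt S N w T t, pt S N w T t') ->
  forall e, 0 < e -> F [set q' | exists T' w', [/\ hull_at i T', normc w' = 1,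
    sval q' = (pt S N w' T' t, pt S N w' T' t') & normc (w' - w) < e]].
Proof.
move=> FU Fq XT w1 Nt Nt' qE e e0.
have [r r0 hr] := puncture_discrete hS.
have dE := displacement_pt XT w1 Nt Nt'.
pose c := euclid (puncture t' - puncture t).
have c0 : 0 <= c by exact: euclid_ge0.
(* Changing w by d moves the puncture by at most r / 2, leaving r / 2 for the error in the
   displacement. *)
pose d := Num.min e (r / (2 * (1 + c))).
have d0 : 0 < d by rewrite lt_min e0 divr_gt0 // mulr_gt0 // ltr_pwDl.
have dr : d * (2 * (1 + c)) <= r.
  by rewrite -ler_pdivlMr ?ge_min ?lexx ?orbT // mulr_gt0 // ltr_pwDl.
have r2 : 0 < r / 2 by rewrite divr_gt0.
have FA := addr_limit hS FU (T1 := fun q' : RS => (sval q').1) XT w1 Nt.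
have FO : F [set q' : RS | Omega_punc S (sval q').1].
  by apply: filterS (Fq _ e0) => q' _; case: (svalP q').
have Fd e' : 0 < e' -> F [set q' : RS | dGamma (pt S N w T t) (sval q').1 < e'].
  by move=> e'0; apply: filterS (Fq _ e'0) => q' /dR_dGamma; rewrite qE.
apply: filterS (ultraI FU (FA FO Fd _ d0) (Fq _ r2)) => q' /= [[T' [w' [XT' w1' T1E ww]]]
    /dR_displacement].
rewrite qE dE; case: q' T1E => -[T1 T2] /= [OP1 [s T1s T2E]] /= T1E.
subst T1 T2; rewrite (displacementE _ T1s) //; last by case: OP1.
move=> ds; exists T', w'; split=> //; last by move: ww; rewrite lt_min => /andP[].
congr pair; have : s = plc w' (- (cmx w' *m puncture t)) t'.
  apply: (hr _ _ _ OP1.1 T1s); first exact: (pt_mem _ w1' XT').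
  rewrite pt_puncture.
  have := euclid_distm (puncture s) (cmx w *m (puncture t' - puncture t)) (cmx w' *m
      (puncture t' - puncture t)).
  rewrite (euclidB (puncture s)) -mulmxBl -cmxB euclid_cmx normcB -/c => h.
  have wd : normc (w' - w) * c <= r / 2.
    have := normc_ge0 (w' - w); move: (normc _) ww h => A ww h A0; nra.
  move: ds; rewrite euclidB; lra.
by move=> ->; rewrite pt_puncture -pt_shift.
Qed.

(** Otherwise pairs in common blocks converge to q. Pigeonhole fixes the second tile t', the
    displacement of q becomes w (x(t') - x(t)) in the limit, and q itself lies in a block. *)
Lemma pair_limit_out (F : set_system RS) (q : RS) N : UltraFilter F -> metric_cvg F q ->
  ~ same_block N (sval q).1 (sval q).2 ->
  F [set q' : RS | ~ same_block N (sval q').1 (sval q').2].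
Proof.
move=> FU Fq nb.
have [Fs|//] := in_ultra_setVsetC [set q' : RS | same_block N (sval q').1 (sval q').2] FU.
have [OP1 [s T1s T2E]] := svalP q.
have [i [T [w [k [XT T1E]]]]] := pnt_exists N OP1.
have w1 := circle_unit w; have Nt := level_tile_supertile k.
have FO : F [set q' : RS | Omega_punc S (sval q').1].
  by apply: filterS (Fq _ ltr01) => q' _; case: (svalP q').
have Fd e' : 0 < e' -> F [set q' : RS | dGamma (pt S N (val w) T (level_tile k)) (sval
    q').1 < e'].
  by move=> e'0; apply: filterS (Fq _ e'0) => q' /dR_dGamma; rewrite T1E.
have FA := addr_limit hS FU (T1 := fun q' : RS => (sval q').1) XT w1 Nt FO Fd.
(* Quantified over all addresses of the first tiling, so that it applies to those produced later by
   [FA]. *)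
pose P (q' : RS) t' := forall T' w', hull_at i T' -> normc w' = 1 ->
  (sval q').1 = pt S N w' T' (level_tile k) -> (sval q').2 = pt S N w' T' t'.
have [|t' Nt' Ft'] := ultra_finite (P := P) (supertile_finite hS N i).
  apply: filterS (ultraI FU Fs (FA _ ltr01)) => q' /= [[j [T' [w' [k' [l' [XT' E1 E2]]]]]]
      [T'' [w'' [XT'' w1'' E3 _]]]].
  have [ij _ _ _] : [/\ i = j, T'' = T', w'' = val w' & level_tile k = level_tile k'].
    apply: (addr_unique hS XT'' XT' w1'' (circle_unit w') Nt (level_tile_supertile k')).
    by rewrite -E3 E1.
  subst j; exists (level_tile l'); first exact: level_tile_supertile.
  move=> T3 w3 XT3 w31 E4.
  have [_ -> -> _] : [/\ i = i, T3 = T', w3 = val w' & level_tile k = level_tile k'].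
    apply: (addr_unique hS XT3 XT' w31 (circle_unit w') Nt (level_tile_supertile k')).
    by rewrite -E4 E1.
  by rewrite E2.
case: nb.
have dE : displacement (sval q) = cmx (val w) *m (puncture t' - puncture (level_tile k)).
  apply/eqP; rewrite -subr_eq0; apply/eqP/euclid_eq0.
  apply/le_anti; rewrite euclid_ge0 andbT; apply/ler_addgt0Pr => e e0; rewrite add0r.
  pose c := euclid (puncture t' - puncture (level_tile k)).
  have c0 : 0 <= c by exact: euclid_ge0.
  have e2 : 0 < e / (2 * (1 + c)) by rewrite divr_gt0 // mulr_gt0 // ltr_pwDl.
  have e3 : 0 < e / 2 by rewrite divr_gt0.
  have /filter_ex[q' [[/= F1 F2] [T' [w' [XT' w1' E1 ww]]]]] :=
      ultraI FU (ultraI FU Ft' (Fq _ e3)) (FA _ e2).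
  have E2 := F1 _ _ XT' w1' E1.
  move: (dR_displacement F2); rewrite [sval q']surjective_pairing E1 E2.
  rewrite (displacement_pt XT' w1' Nt Nt') => h.
  have := euclid_distm (displacement (sval q)) (cmx w' *m (puncture t' - puncture
      (level_tile k)))
    (cmx (val w) *m (puncture t' - puncture (level_tile k))).
  rewrite -[X in _ <= _ + euclid X]mulmxBl -cmxB euclid_cmx -/c => h2.
  have : normc (w' - val w) * c <= e / 2.
    move: ww; rewrite ltr_pdivlMr ?mulr_gt0 ?ltr_pwDl // => ww.
    have := normc_ge0 (w' - val w); move: (normc _) ww => A ww A0; nra.
  lra.
have [l tE] := level_tile_surj Nt'.
exists i, T, w, k, l; split=> //.
rewrite /pnt -tE (pt_shift _ _ _ _ (level_tile k)) -[pt _ _ _ _ _]T1E -dE.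
have -> : sval q = ((sval q).1,
    shift_tiling (- puncture s) (sval q).1) by rewrite -T2E -surjective_pairing.
by rewrite (displacementE OP1.1 T1s).
Qed.

Definition block_set N : set RS := [set q | same_block N (sval q).1 (sval q).2].

Lemma block_set_closed N : closed (block_set N).
Proof.
rewrite -[block_set N]setCK; apply: open_closedC.
have oB : R_punc_open (~` block_set N).
  by move=> q nq; apply: local_of_ultra => F FU Fq; exact: pair_limit_out Fq nq.
exact: oB.
Qed.

(** Along an ultrafilter, i and both indices become constant, w converges on the circle and T
    converges by [hull_at_compact]; the limits form the address of the limit pair. *)
Lemma block_set_compact N : compact (block_set N).
Proof.
rewrite compact_ultra => F FU FB.
pose P (q : RS) i (kl : 'I_(level_dim N i).+1 * 'I_(level_dim N i).+1) T (w : S1) :=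
  hull_at i T /\ sval q = (pnt T w kl.1, pnt T w kl.2).
have [|i _ Fi] := ultra_finite (P := fun q i => exists kl T w, @P q i kl T w)
  (finite_finset : finite_set [set: 'I_(st_num S)]).
  apply: filterS FB => q [i [T [w [k [l [XT E1 E2]]]]]]; exists i => //.
  by exists (k, l), T, w; split=> //; rewrite [LHS]surjective_pairing E1 E2.
have [|kl _ Fkl] := ultra_finite (P := fun q kl => exists T w, @P q i kl T w)
  (finite_finset : finite_set [set: 'I_(level_dim N i).+1 * 'I_(level_dim N i).+1]).
  by apply: filterS Fi => q [kl h]; exists kl.
have ex0 q : exists Tw : tiling R * R[i], (exists T w, @P q i kl T w) ->
    [/\ hull_at i Tw.1, normc Tw.2 = 1 & sval q = (pt S N Tw.2 Tw.1 (level_tile kl.1),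
        pt S N Tw.2 Tw.1 (level_tile kl.2))].
  have [[T [w [XT E]]]|nh] := EM (exists T w, @P q i kl T w); last by exists (set0, 0).
  by exists (T, val w) => _; split=> //; exact: circle_unit.
pose c q := sval (cid (ex0 q)).
have hc q := svalP (cid (ex0 q)).
have [w w1 Fw] : exists2 a, normc a = 1 & forall e, 0 < e ->
    F [set q | normc ((c q).2 - a) < e].
  by apply: ultra_cvg_circle; apply: filterS Fkl => q /hc[].
have [T XT FT] : exists2 T0, hull_at i T0 & forall r,
    F [set q | hull_at i (c q).1 /\ agree T0 (c q).1 r].
  by apply: (hull_at_compact hS); apply: filterS Fkl => q /hc[].
have Nk := level_tile_supertile kl.1; have Nl := level_tile_supertile kl.2.
have Rq : R_punc S (pt S N w T (level_tile kl.1)) (pt S N w T (level_tile kl.2)) by exact: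
    (pt_R_punc hS w1 XT).
pose q0 : RS := exist _ (pt S N w T (level_tile kl.1), pt S N w T (level_tile kl.2)) Rq.
have [u uw] := circleP w1.
exists q0; split.
  by exists i, T, u, kl.1, kl.2; split=> //=; rewrite /pnt uw.
apply: metric_cvg_nbhs => e e0.
have e2 : 0 < e / 2 by rewrite divr_gt0.
have [r [d [d0 hd]]] := pt_continuous hS N (level_tile kl.1) w1 XT e2.
pose b := euclid (puncture (level_tile kl.2) - puncture (level_tile kl.1)).
have b0 : 0 <= b by exact: euclid_ge0.
have e3 : 0 < e / (2 * (1 + b)) by rewrite divr_gt0 // mulr_gt0 // ltr_pwDl.
apply: filterS (ultraI FU (ultraI FU Fkl (FT r)) (ultraI FU (Fw _ d0) (Fw _ e3))).
move=> q [[/hc[Xc c1 qE] [_ ag]] [/= wd we]].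
rewrite /dR qE /= (displacement_pt XT w1 Nk Nl) (displacement_pt Xc c1 Nk Nl).
rewrite -mulmxBl -cmxB euclid_cmx -/b normcB.
have := hd _ _ c1 Xc ag wd.
have : normc ((c q).2 - w) * b <= e / 2.
  move: we; rewrite ltr_pdivlMr ?mulr_gt0 ?ltr_pwDl // => we.
  have := normc_ge0 ((c q).2 - w); move: (normc _) we => A we A0; nra.
rewrite -/(c q); lra.
Qed.

(** By the two limit lemmas, pairs near one in a common block stay in a block and pairs near an
    outside one stay outside, so extension by zero is continuous; the support lies in the compact
    [block_set]. *)
Lemma block_fun_Cc N (F : block_algebra R (level_block N)) : nsa_dom F -> Cc S (block_fun F).
Proof.
move=> dF; split.
- move=> T1 T2 nR; apply: block_fun_out => /same_block_R_punc; exact: nR.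
- apply: metric_continuous => q e e0 G GU Gq.
  have [[i [T [w [k [l [XT E1 E2]]]]]]|nb] := EM (same_block N (sval q).1 (sval q).2).
  + have [d d0 hd] := (circle_continuous _).1 (dF i k l) w e e0.
    have qE : sval q = (pnt T w k, pnt T w l) by rewrite -E1 -E2 -surjective_pairing.
    have := pair_limit_in GU Gq XT (circle_unit w) (level_tile_supertile k)
        (level_tile_supertile l) qE d0.
    apply: filterS => q' [T' [w' [XT' /circleP[u uE] q'E ww]]]; subst w'.
    rewrite /mkset /pair_fun_on qE q'E /=.
    have := block_fun_pnt F u k l XT'; rewrite /pnt => ->.
    by rewrite -[pt _ _ _ _ (level_tile k)]/(pnt T w k) -[pt _ _ _ _ (level_tile l)]/(pnt T
        w l) block_fun_pnt //; exact: hd.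
  + apply: filterS (pair_limit_out GU Gq nb) => q' nb'.
    by rewrite /pair_fun_on /= !block_fun_out // subrr normc0.
- apply: (subclosed_compact (@closed_closure _ _) (@block_set_compact N)).
  have /closure_id -> := @block_set_closed N; apply: closureS.
  move=> q /= fq; apply: contrapT => nb; move: fq.
  by rewrite /pair_fun_on block_fun_out ?eqxx.
Qed.

End Blocks.

(** * The star-algebra of block functions *)

Section Algebra.
Variables (R : realType) (S : substitution_tiling R).
Hypothesis hS : standing_assumptions S.
Implicit Types (i j : 'I_(st_num S)) (x y v : 'cV[R]_2) (r e : R) (t s : tile R) (T : tiling R).

Local Notation p := (st_proto (s := S)).
Local Notation Omega := (hull (st_tiling S)).
Local Notation lam := (st_lambda S).
Local Notation S1 := (set_type (@circle R)).
Local Notation BA N := (block_algebra R (level_block S N)).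

Lemma same_block_pnt N i T w (k : 'I_(level_dim N i).+1) T2 : hull_at i T ->
  same_block S N (pnt T w k) T2 <-> exists l : 'I_(level_dim N i).+1, T2 = pnt T w l.
Proof.
move=> XT; split; last by case=> l ->; exists i, T, w, k, l.
case=> j [T' [w' [k' [l' [XT' E ->]]]]].
have [ij TT ww _] := pnt_inj hS XT XT' E; subst j T' w'.
by exists l'.
Qed.

Lemma same_block_sym N T1 T2 : same_block S N T1 T2 -> same_block S N T2 T1.
Proof. by case=> i [T [w [k [l [XT E1 E2]]]]]; exists i, T, w, l, k. Qed.

Lemma block_sum N i T (w : S1) (P : set (tiling R)) (h : tiling R -> R[i]) : hull_at i T ->
  (forall l : 'I_(level_dim N i).+1, P (pnt T w l)) ->
  (forall T3, P T3 -> (forall l : 'I_(level_dim N i).+1, T3 <> pnt T w l) -> h T3 = 0) ->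
  \sum_(T3 \in P) h T3 = \sum_(l < (level_dim N i).+1) h (pnt T w l).
Proof.
move=> XT sub supp.
rewrite -(fsbig_widen (range (fun l : 'I_(level_dim N i).+1 => pnt T w l))).
- rewrite (reindex_fsbig (fun l : 'I_(level_dim N i).+1 => pnt T w l) setT).
    rewrite [RHS]fsbig_seq ?index_enum_uniq //; apply: eq_fsbigl.
    by apply/seteqP; split=> // l _ /=; rewrite mem_index_enum.
  split; [by move=> l _; exists l| |by move=> _ [l _ <-]; exists l].
  by move=> l l' _ _ E; apply: val_inj; have [] := pnt_inj hS XT XT E.
- by move=> _ [l _ <-].
- move=> T3 [PT3 nT3]; apply: supp => // l E; apply: nT3; by exists l.
Qed.

Lemma punc_class_pnt N i T w (k l : 'I_(level_dim N i).+1) : hull_at i T ->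
  punc_class S (pnt T w k) (pnt T w l).
Proof. by move=> XT; exact: pnt_R_punc. Qed.

Lemma block_fun_add N (F G : BA N) :
  block_fun (nsa_add F G) = nsa_add (n := Cc_algebra S) (block_fun F) (block_fun G).
Proof.
apply/funext => T1; apply/funext => T2.
have [[i [T [w [k [l [XT -> ->]]]]]]|nb] := EM (same_block S N T1 T2).
  by rewrite /= !block_fun_pnt // mxE.
by rewrite /= !block_fun_out // addr0.
Qed.

Lemma block_fun_scale N c (F : BA N) :
  block_fun (nsa_scale c F) = nsa_scale (n := Cc_algebra S) c (block_fun F).
Proof.
apply/funext => T1; apply/funext => T2.
have [[i [T [w [k [l [XT -> ->]]]]]]|nb] := EM (same_block S N T1 T2).
  by rewrite /= !block_fun_pnt // mxE.
by rewrite /= !block_fun_out // mulr0.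
Qed.

Lemma block_fun_star N (F : BA N) :
  block_fun (nsa_star F) = nsa_star (n := Cc_algebra S) (block_fun F).
Proof.
apply/funext => T1; apply/funext => T2; rewrite /= /pair_fun_star.
have [[i [T [w [k [l [XT -> ->]]]]]]|nb] := EM (same_block S N T1 T2).
  by rewrite /= !block_fun_pnt // !mxE.
rewrite /= !block_fun_out ?conjc0 //; by move=> /same_block_sym.
Qed.

Lemma conv_out T1 T2 (f g : pair_fun R) : ~ Omega_punc S T1 -> convolution S f g T1 T2 = 0.
Proof.
move=> nO; rewrite /convolution (_ : punc_class S T1 = set0) ?fsbig_set0 //.
by rewrite -subset0 => T3 [].
Qed.

(** F vanishes outside blocks, so the sum over the class of T1 reduces to the block of T1, where it
    is a matrix product. *)
Lemma block_fun_mul N (F G : BA N) :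
  block_fun (nsa_mul F G) = nsa_mul (n := Cc_algebra S) (block_fun F) (block_fun G).
Proof.
apply/funext => T1; apply/funext => T2; rewrite /=.
have [OT1|nO] := EM (Omega_punc S T1); last first.
  by rewrite conv_out // block_fun_out // => /(same_block_R_punc hS)[/nO].
have [i [T [w [k [XT ->]]]]] := pnt_exists hS N OT1.
rewrite /convolution (@block_sum N i T w) //; last 2 first.
- by move=> l; exact: punc_class_pnt.
- move=> T3 _ nT3; rewrite block_fun_out ?mul0r // => /(same_block_pnt w k _ XT)[l E].
  exact: nT3 E.
have [/(same_block_pnt w k _ XT)[m ->]|nb] := EM (same_block S N (pnt T w k) T2).
  by rewrite block_fun_pnt // mxE; apply: eq_bigr => l _; rewrite !block_fun_pnt.
rewrite block_fun_out // big1 // => l _; rewrite [X in _ * X]block_fun_out ?mulr0 //.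
by move=> /(same_block_pnt w l _ XT)[m E]; apply: nb; apply/(same_block_pnt w k _ XT); exists m.
Qed.

Definition diagf (a : tiling R -> R[i]) : pair_fun R :=
  fun T1 T2 => if `[< Omega_punc S T1 /\ T1 = T2 >] then a T1 else 0.

Lemma R_punc_refl T : Omega_punc S T -> R_punc S T T.
Proof.
move=> OT; split=> //; case: OT => _ [t Tt t0]; exists t => //.
by rewrite t0 oppr0 shift_tiling0.
Qed.

Lemma conv_diag (a : tiling R -> R[i]) (g : pair_fun R) T1 T2 :
  convolution S (diagf a) g T1 T2 = if `[< Omega_punc S T1 >] then a T1 * g T1 T2 else 0.
Proof.
case: asboolP => [OT|nO]; last exact: conv_out.
rewrite /convolution -(fsbig_widen [set T1]).
- by rewrite fsbig_set1 /diagf asboolT.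
- by move=> _ ->; exact: R_punc_refl.
- by move=> T3 [_ /= nT]; rewrite /diagf asboolF ?mul0r // => -[_ E]; exact: nT.
Qed.

Lemma conv_diag_diag (a b : tiling R -> R[i]) :
  convolution S (diagf a) (diagf b) = diagf (fun T => a T * b T).
Proof.
apply/funext => T1; apply/funext => T2; rewrite conv_diag.
case: asboolP => [OT|nO]; rewrite /diagf; last by rewrite asboolF // => -[].
by case: asboolP => // _; rewrite mulr0.
Qed.

Definition zeta T : R[i] := expi (angle S (origin_tile T)).

Lemma conjc_unit (w : R[i]) : normc w = 1 -> w^* = w^-1.
Proof.
move=> w1; have w0 := normc_unit_neq0 w1; apply: (mulfI w0); rewrite divff //.
by rewrite -sqr_normc normc_norm w1 expr1n.
Qed.

(** Negative powers are built from the adjoint of z, which is its inverse because [zeta] has modulus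
    1. *)
Lemma zpowE (k : int) : zpow S k = diagf (fun T => zeta T ^ k).
Proof.
have z1 : z_punc S = diagf zeta by [].
have zs : pair_fun_star (z_punc S) = diagf (fun T => (zeta T)^-1).
  apply/funext => T1; apply/funext => T2; rewrite /pair_fun_star /z_punc /diagf.
  case: asboolP => [[OT2 E]|n2]; case: asboolP => [[OT1 E']|n1].
  - by rewrite E' conjc_unit // expi_unit.
  - by case: n1; rewrite -E.
  - by case: n2; rewrite -E'.
  - exact: conjc0.
case: k => n /=.
- elim: n => [//|n IH] /=; rewrite IH z1 conv_diag_diag.
  by congr diagf; apply/funext => T; rewrite exprSz.
- have it m : iter m (convolution S (pair_fun_star (z_punc S))) (pair_fun1 S) = diagf (fun
    T => (zeta T)^-1 ^+ m).
    elim: m => [//|m IH] /=; rewrite IH zs conv_diag_diag.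
    by congr diagf; apply/funext => T; rewrite exprS.
  rewrite -[convolution _ _ _]/(iter n.+1 _ _) it.
  by congr diagf; apply/funext => T; rewrite NegzE exprVn.
Qed.

(** The tile at the origin is the tile of index k turned by w, so its phase is that of the tile
    times w. This is where the scalar in front of w^k comes from. *)
Lemma zeta_pnt N i T w (k : 'I_(level_dim N i).+1) : hull_at i T ->
  zeta (pnt T w k) = val w * expi (angle S (level_tile k)).
Proof.
move=> XT; have w1 := circle_unit w; have Nk := level_tile_supertile hS k.
rewrite /zeta (origin_tileE (S := S) (t :=
    plc (val w) (- (cmx (val w) *m puncture (level_tile k))) (level_tile k))).
- have [j [u [v [u1 ->]]]] := supertile_proto hS Nk.
  by rewrite plc_comp !expi_angle // normc_unitM.
- exact: (pt_hull hS _ _ w1 XT).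
- exact: (pt_mem _ w1 XT).
- by rewrite pt_puncture subrr mulmx0.
Qed.

(** The function g times a matrix unit of summand i. Indices are compared as numbers since the
    matrix size depends on j. *)
Definition entry N i (k0 l0 : 'I_(level_dim N i).+1) (g : S1 -> R[i]) : BA N :=
  fun j w => \matrix_(a, b)
    (if (j == i) && (a == k0 :> nat) && (b == l0 :> nat) then g w else 0).

Lemma generatorE N i (k0 l0 : 'I_(level_dim N i).+1) (k : int) :
  convolution S (zpow S k) (e_ N i (level_tile k0) (level_tile l0)) =
  block_fun (entry k0 l0 (fun w => (val w * expi (angle S (level_tile k0))) ^ k)).
Proof.
apply/funext => T1; apply/funext => T2; rewrite zpowE conv_diag.
case: asboolP => [OT|nO]; last first.
  by rewrite block_fun_out // => /(same_block_R_punc hS)[/nO].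
rewrite /e_; case: asboolP => [/(mem_V hS)[T [w [XT /circleP[u <-] -> ->]]]|nV].
  rewrite -[pt _ _ _ _ (level_tile k0)]/(pnt T u k0) -[pt _ _ _ _ (level_tile l0)]/(pnt T u l0).
  by rewrite block_fun_pnt // mxE !eqxx /= zeta_pnt // mulr1.
rewrite mulr0.
have [[j [T [w [a [b [XT E1 E2]]]]]]|nb] := EM (same_block S N T1 T2);
    last by rewrite block_fun_out.
rewrite E1 E2 block_fun_pnt // mxE;
    case: ifP => // /andP[/andP[/eqP ji /eqP ak] /eqP level_block].
subst j; case: nV; apply/(mem_V hS); exists T, (val w); rewrite circle_unit; split=> //.
  by rewrite E1 (val_inj ak).
by rewrite E2 (val_inj level_block).
Qed.

End Algebra.

(** * Lipschitz bounds for powers on the circle *)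

Section Powers.
Variable R : realType.
Local Notation S1 := (set_type (@circle R)).

Lemma normc_unitX (u : R[i]) n : normc u = 1 -> normc (u ^+ n) = 1.
Proof.
move=> u1; elim: n => [|n IH]; first by rewrite expr0 normc1.
by rewrite exprS normc_unitM.
Qed.

Lemma unit_exp_lip (u v : R[i]) n : normc u = 1 -> normc v = 1 ->
  normc (u ^+ n - v ^+ n) <= n%:R * normc (u - v).
Proof.
move=> u1 v1; elim: n => [|n IH]; first by rewrite !expr0 subrr normc0 mul0r.
rewrite !exprS (_ : _ - _ = u * (u ^+ n - v ^+ n) + (u - v) * v ^+ n); last by ring.
apply: le_trans (le_normcD _ _) _; rewrite !normcM u1 mul1r normc_unitX // mulr1.
by rewrite -natr1 mulrDl mul1r lerD2r.
Qed.

Lemma unit_expz_lip (u v : R[i]) (k : int) : normc u = 1 -> normc v = 1 ->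
  normc (u ^ k - v ^ k) <= `|k|%N%:R * normc (u - v).
Proof.
move=> u1 v1; case: k => n; first exact: unit_exp_lip.
rewrite NegzE abszN /=.
have a0 := normc_unit_neq0 (normc_unitX n.+1 u1);
    have b0 := normc_unit_neq0 (normc_unitX n.+1 v1).
rewrite -!exprnN (_ : u ^- n.+1 - v ^- n.+1 = u ^- n.+1 * v ^- n.+1 * (v ^+ n.+1 - u ^+ n.+1)).
  rewrite !normcM !normc_unitV ?normc_unitX // !mul1r normcB.
  exact: unit_exp_lip.
by move: (u ^+ n.+1) (v ^+ n.+1) a0 b0 => a b a0 b0; field; rewrite a0 b0.
Qed.

Lemma power_continuous (c : R[i]) (k : int) : normc c = 1 ->
  continuous (fun w : S1 => (val w * c) ^ k : R[i]^o).
Proof.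
move=> c1; apply/circle_continuous => w e e0.
have n0 : 0 < `|k|%N%:R + 1 :> R by rewrite ltr_wpDl.
exists (e / (`|k|%N%:R + 1)); first by rewrite divr_gt0.
move=> w'; rewrite ltr_pdivlMr // => h.
apply: le_lt_trans (unit_expz_lip _ _ _) _; rewrite ?normc_unitM ?circle_unit //.
rewrite -mulrBl normcM c1 mulr1; apply: le_lt_trans h.
by rewrite mulrC ler_wpM2l ?normc_ge0 // lerDl.
Qed.

End Powers.

(** * The reduced norm *)

Section Norms.
Variable R : realType.
Implicit Types n : nat.

Lemma cabs_normc (z : R[i]^o) : cabs z = normc z.
Proof. by []. Qed.

Lemma hilbert_normE n (v : 'cV[R[i]]_n) :
  hilbert_norm v = Num.sqrt (\sum_k normc (v k 0) ^+ 2).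
Proof. by []. Qed.

Lemma hilbert_norm_ge0 n (v : 'cV[R[i]]_n) : 0 <= hilbert_norm v.
Proof. exact: sqrtr_ge0. Qed.

Lemma hilbert_norm_sqr n (v : 'cV[R[i]]_n) :
  hilbert_norm v ^+ 2 = \sum_k normc (v k 0) ^+ 2.
Proof. by rewrite sqr_sqrtr // sumr_ge0 // => k _; exact: sqr_ge0. Qed.

Lemma hilbert_normZ n (c : R[i]) (v : 'cV[R[i]]_n) :
  hilbert_norm (c *: v) = normc c * hilbert_norm v.
Proof.
rewrite !hilbert_normE -[normc c in RHS]ger0_norm ?normc_ge0 // -sqrtr_sqr -sqrtrM ?sqr_ge0 //.
congr Num.sqrt; rewrite mulr_sumr; apply: eq_bigr => k _.
by rewrite mxE normcM exprMn.
Qed.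

Lemma hilbert_norm0 n : hilbert_norm (0 : 'cV[R[i]]_n) = 0.
Proof. by rewrite -(scale0r (0 : 'cV_n)) hilbert_normZ normc0 mul0r. Qed.

Lemma hilbert_norm_eq0 n (v : 'cV[R[i]]_n) : hilbert_norm v = 0 -> v = 0.
Proof.
move=> /(congr1 (fun x => x ^+ 2)); rewrite hilbert_norm_sqr expr0n /= => /eqP.
rewrite psumr_eq0 => [|k _]; last exact: sqr_ge0.
move=> /allP h; apply/matrixP => k j; rewrite (ord1 j) mxE.
have := h k (mem_index_enum _); rewrite /= sqrf_eq0 => /eqP.
exact: eq0_normc.
Qed.

Lemma matrix_norm_ub n (M : 'M[R[i]]_n) (m : R) : (matrix_norm M <= m%:E)%E ->
  forall v, hilbert_norm (M *m v) <= m * hilbert_norm v.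
Proof.
move=> hM v; have [v0|v0] := eqVneq (hilbert_norm v) 0.
  by rewrite (hilbert_norm_eq0 v0) mulmx0 hilbert_norm0 mulr0.
have vp : 0 < hilbert_norm v by rewrite lt_neqAle eq_sym v0 hilbert_norm_ge0.
rewrite -ler_pdivrMr //.
have -> : hilbert_norm (M *m v) / hilbert_norm v = hilbert_norm (M *m ((hilbert_norm
    v)^-1%:C *: v)).
  by rewrite -scalemxAr hilbert_normZ normc_real ger0_norm ?invr_ge0 ?hilbert_norm_ge0 // mulrC.
rewrite -lee_fin; apply: le_trans hM; apply: ereal_sup_ubound.
exists ((hilbert_norm v)^-1%:C *: v) => //=.
by rewrite hilbert_normZ normc_real ger0_norm ?invr_ge0 ?hilbert_norm_ge0 // mulVf.
Qed.

Lemma esum_classes (T : choiceType) (A K : set T) (J : T -> set T) (a : T -> \bar R) :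
  A = \bigcup_(k in K) J k ->
  (forall k k' x, K k -> K k' -> J k x -> J k' x -> k = k') ->
  (forall x, 0 <= a x)%E ->
  \esum_(x in A) a x = \esum_(k in K) \esum_(x in J k) a x.
Proof.
move=> -> tJ a0; rewrite esum_esum //; apply: reindex_esum => //; split.
- by move=> [/= i j] [Ki Jij]; exists i.
- move=> [/= i1 j1] [/= i2 j2]; rewrite ?inE /=.
  move=> [K1 J1] [K2 J2] j12; congr (_, _) => //.
  by apply: (tJ _ _ j1) => //; rewrite j12.
- by move=> j [i Ki Jij] /=; exists (i, j).
Qed.

Lemma esum_mulr_le (T : choiceType) (A : set T) (c : R) (a : T -> \bar R) : 0 <= c ->
  (forall x, 0 <= a x)%E ->
  (\esum_(x in A) (c%:E * a x) <= c%:E * \esum_(x in A) a x)%E.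
Proof.
move=> c0 a0; apply: ge_ereal_sup => /= _ [X [finX XA] <-].
rewrite -ge0_mule_fsumr //; apply: lee_wpmul2l; first by rewrite lee_fin.
by apply: ereal_sup_ubound; exists X.
Qed.

Lemma esum_sub (T : choiceType) (A B : set T) (a : T -> \bar R) :
  (forall x, 0 <= a x)%E -> B `<=` A -> (\esum_(x in B) a x <= \esum_(x in A) a x)%E.
Proof.
move=> a0 BA; rewrite [leRHS](esumID B) // setIidr // leeDl //.
by apply: esum_ge0.
Qed.

End Norms.

Section RedNorm.
Variables (R : realType) (S : substitution_tiling R).
Hypothesis hS : standing_assumptions S.
Implicit Types (i j : 'I_(st_num S)) (x y v : 'cV[R]_2) (r e : R) (t s : tile R) (T : tiling R).

Local Notation S1 := (set_type (@circle R)).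
Local Notation BA N := (block_algebra R (level_block S N)).

Lemma R_punc_trans T1 T2 T3 : R_punc S T1 T2 -> R_punc S T2 T3 -> R_punc S T1 T3.
Proof.
move=> [OT1 [t T1t ->]] [_ [s]]; rewrite mem_shift_tiling => T1s ->; split=> //.
exists (shift_tile (- - puncture t) s) => //; rewrite shift_tilingD shift_tileE.
by rewrite puncture_plc /sim cmx1_vec opprK opprD addrC.
Qed.

Definition block N i T (w : S1) : set (tiling R) :=
    range (fun l : 'I_(level_dim N i).+1 => pnt T w l).

Lemma block_fsbig (V : Type) (idx : V) (op : Monoid.com_law idx) N i T w (h : tiling R -> V) :
  hull_at i T -> \big[op/idx]_(T3 \in block N i T w) h T3 = \big[op/idx]_(l < (level_dim N
      i).+1) h (pnt T w l).
Proof.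
move=> XT; rewrite (reindex_fsbig (fun l : 'I_(level_dim N i).+1 => pnt T w l) setT).
  rewrite [RHS]fsbig_seq ?index_enum_uniq //; apply: eq_fsbigl.
  by apply/seteqP; split=> // l _ /=; rewrite mem_index_enum.
split; [by move=> l _; exists l| |by move=> _ [l _ <-]; exists l].
by move=> l l' _ _ E; apply: val_inj; have [] := pnt_inj hS XT XT E.
Qed.

Lemma block_esum N i T w (a : tiling R -> R) : hull_at i T -> (forall T', 0 <= a T') ->
  \esum_(T1 in block N i T w) (a T1)%:E = (\sum_(l < (level_dim N i).+1) a (pnt T w l))%:E.
Proof.
move=> XT a0; rewrite esum_fset; first last.
- by move=> T' _; rewrite lee_fin.
- by apply: finite_image; exact: finite_finset.
by rewrite block_fsbig // sumEFin.
Qed.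

Lemma pi_rep_pnt N (F : BA N) T0 xi i T w (k : 'I_(level_dim N i).+1) : hull_at i T ->
  punc_class S T0 (pnt T w k) ->
  pi_rep S T0 (block_fun F) xi (pnt T w k) = \sum_l F i w k l * xi (pnt T w l).
Proof.
move=> XT cT; rewrite /pi_rep (block_sum (N := N) (i := i) (T := T) hS (w := w)) //.
- by apply: eq_bigr => l _; rewrite block_fun_pnt.
- by move=> l; apply: R_punc_trans cT _; exact: pnt_R_punc.
- move=> T3 _ nT3; rewrite block_fun_out ?mul0r // => /(same_block_pnt hS w k _ XT)[l E].
  exact: nT3 E.
Qed.

Lemma l2_sub T0 (B : set (tiling R)) (xi : tiling R -> R[i]) : B `<=` punc_class S T0 ->
  (sqrte (\esum_(T1 in B) (normc (xi T1) ^+ 2)%:E) <= l2_norm S T0 xi)%E.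
Proof.
move=> sB; rewrite /l2_norm lee_sqrt; last first.
  by apply: esum_ge0 => T _; rewrite lee_fin sqr_ge0.
by apply: esum_sub => // T; rewrite lee_fin sqr_ge0.
Qed.

(** Extended by zero from one block, v becomes a vector of norm at most 1 in l^2 of the class, and
    on that block the representation acts as the matrix F i w. *)
Lemma red_norm_ge N (F : BA N) i (w : S1) (v : 'cV[R[i]]_(level_dim N i).+1) :
  hilbert_norm v <= 1 -> ((hilbert_norm (F i w *m v))%:E <= red_norm S (block_fun F))%E.
Proof.
move=> v1; have [T XT] := hull_at_neq0 hS i.
pose T0 := pnt T w (ord0 : 'I_(level_dim N i).+1).
have OT0 : Omega_punc S T0 by case: (pnt_R_punc hS w (ord0 : 'I_(level_dim N i).+1) ord0 XT).
pose xi T' : R[i] := if pselect (exists l : 'I_(level_dim N i).+1, T' = pnt T w l) is left h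
  then v (sval (cid h)) 0 else 0.
have xiE l : xi (pnt T w l) = v l 0.
  rewrite /xi; case: pselect => [h|[]]; last by exists l.
  case: (cid h) => l' /= E; congr (v _ _); apply: val_inj.
  by have [_ _ _ /esym] := pnt_inj hS XT XT E.
have sub : block N i T w `<=` punc_class S T0 by move=> _ [l _ <-]; exact: pnt_R_punc.
have sq (f : tiling R -> R[i]) :
    sqrte (\esum_(T1 in block N i T w) (normc (f T1) ^+ 2)%:E) =
    (hilbert_norm (\col_l f (pnt T w l) : 'cV[R[i]]_(level_dim N i).+1))%:E.
  rewrite block_esum // => [|T']; last exact: sqr_ge0.
  by rewrite /= hilbert_normE; congr (Num.sqrt _)%:E; apply: eq_bigr => l _; rewrite mxE.
have xi1 : (l2_norm S T0 xi <= 1)%E.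
  rewrite /l2_norm (esumID (block N i T w)); last by move=> T' _; rewrite lee_fin sqr_ge0.
  rewrite setIidr // [X in (_ + X)%E]esum1 ?adde0.
    rewrite sq (_ : \col_l _ = v) ?lee_fin //.
    by apply/matrixP => a b; rewrite mxE xiE (ord1 b).
  move=> T' [_ nT']; rewrite (_ : xi T' = 0) ?cabs_normc ?normc0 ?expr0n //.
  by rewrite /xi; case: pselect => // -[l E]; case: nT'; exists l.
apply: le_trans (ereal_sup_ubound _); last by exists T0.
apply: le_trans (ereal_sup_ubound _); last by exists xi.
apply: le_trans (l2_sub _ sub); rewrite sq lee_fin.
rewrite (_ : \col_l _ = F i w *m v) //.
apply/matrixP => a b; rewrite !mxE (ord1 b) pi_rep_pnt //; last exact: pnt_R_punc.
by apply: eq_bigr => l _; rewrite xiE.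
Qed.

(** The representation preserves blocks and acts on each as some F i w, so the squared estimates on
    blocks add up over the class. *)
Lemma red_norm_le N (F : BA N) (m : R) : 0 <= m ->
  (forall i (w : S1), (matrix_norm (F i w) <= m%:E)%E) -> (red_norm S (block_fun F) <= m%:E)%E.
Proof.
move=> m0 hm; apply: ge_ereal_sup => _ [T0 OT0 <-]; apply: ge_ereal_sup => _ [xi xi1 <-].
(* One representative for each block, its point of index 0. *)
pose K := [set T1 | punc_class S T0 T1 /\ exists i T w,
  hull_at i T /\ T1 = pnt T w (ord0 : 'I_(level_dim N i).+1)].
pose J T1 := [set T2 | same_block S N T1 T2].
have cover : punc_class S T0 = \bigcup_(T1 in K) J T1.
  apply/seteqP; split=> T2.
  - move=> cT2; have OT2 : Omega_punc S T2.
      case: cT2 => _ [t T0t ->]; split; first by apply: hull_shift; case: OT0.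
      exists (shift_tile (- puncture t) t); first by exists t.
      by rewrite shift_tileE puncture_plc /sim cmx1_vec subrr.
    have [i [T [w [k [XT E]]]]] := pnt_exists hS N OT2.
    exists (pnt T w (ord0 : 'I_(level_dim N i).+1)).
      split; last by exists i, T, w.
      by apply: R_punc_trans cT2 _; rewrite E; exact: pnt_R_punc.
    by apply/(same_block_pnt hS _ _ _ XT); exists k.
  - by case=> T1 [cT1 _] /(same_block_R_punc hS); exact: R_punc_trans.
have disj T1 T2 T3 : K T1 -> K T2 -> J T1 T3 -> J T2 T3 -> T1 = T2.
  move=> [_ [i [T [w [XT ->]]]]] [_ [j [T' [w' [XT' ->]]]]].
  move=> /(same_block_pnt hS _ _ _ XT)[k ->] /(same_block_pnt hS _ _ _ XT')[l E].
  by have [ij TT ww _] := pnt_inj hS XT XT' E; subst j T' w'.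
have sq0 (f : tiling R -> R[i]) T' : (0 <= (normc (f T') ^+ 2)%:E)%E by rewrite lee_fin sqr_ge0.
have JE i T w : hull_at i T -> J (pnt T w (ord0 : 'I_(level_dim N i).+1)) = block N i T w.
  move=> XT; apply/seteqP; split=> T2.
    by move=> /(same_block_pnt hS _ _ _ XT)[k ->]; exists k.
  by case=> k _ <-; apply/(same_block_pnt hS _ _ _ XT); exists k.
have key : (\esum_(T1 in punc_class S T0) (normc (pi_rep S T0 (block_fun F) xi T1) ^+ 2)%:E <=
            (m ^+ 2)%:E * \esum_(T1 in punc_class S T0) (normc (xi T1) ^+ 2)%:E)%E.
  rewrite (esum_classes cover disj) // [X in (_ <= _ * X)%E](esum_classes cover disj) //.
  apply: le_trans (esum_mulr_le _ _ _); [|exact: sqr_ge0|by move=> ?; apply: esum_ge0].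
  apply: le_esum => T1 [cT1 [i [T [w [XT T1E]]]]]; subst T1; rewrite JE //.
  rewrite !block_esum //; do ?by move=> ?; exact: sqr_ge0.
  pose v : 'cV[R[i]]_(level_dim N i).+1 := \col_l xi (pnt T w l).
  have := matrix_norm_ub (hm i w) v => h.
  have -> : \sum_(l < (level_dim N i).+1) normc (xi (pnt T w l)) ^+ 2 = hilbert_norm v ^+ 2.
    by rewrite hilbert_norm_sqr; apply: eq_bigr => l _; rewrite mxE.
  rewrite (_ : \sum_(l < _) _ = hilbert_norm (F i w *m v) ^+ 2).
    rewrite -EFinM lee_fin -exprMn lerXn2r // ?nnegrE ?mulr_ge0 ?hilbert_norm_ge0 //.
  rewrite hilbert_norm_sqr; apply: eq_bigr => k _; rewrite pi_rep_pnt //.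
    by rewrite mxE; congr (normc _ ^+ 2); apply: eq_bigr => l _; rewrite mxE.
  by apply: R_punc_trans cT1 _; exact: pnt_R_punc.
have xi2 : (\esum_(T1 in punc_class S T0) (normc (xi T1) ^+ 2)%:E <= 1)%E.
  rewrite -[leRHS]mule1 -lee_sqrt ?lee01 // mule1.
  rewrite (_ : sqrte 1 = 1%E); first exact: xi1.
  by rewrite /= sqrtr1.
rewrite /l2_norm -[leRHS](_ : sqrte (m ^+ 2)%:E = m%:E); last first.
  by rewrite /= sqrtr_sqr ger0_norm.
rewrite lee_sqrt ?lee_fin ?sqr_ge0 //; apply: le_trans key _.
rewrite -[leRHS]mule1; apply: lee_wpmul2l => //.
by rewrite lee_fin sqr_ge0.
Qed.

Lemma red_norm_block_fun N (F : BA N) : red_norm S (block_fun F) = nsa_norm F.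
Proof.
apply/le_anti/andP; split; last first.
  rewrite /=; apply: bigmax_le.
    (* The maximum starts at 0, so the reduced norm has to be shown nonnegative, which takes a
       proto-tile; [sa_generated] for the empty patch provides one. *)
    have [i _] : exists i : 'I_(st_num S), True.
      have [|g [m [j _]]] := sa_generated hS (P := set0) _ (@sub0set _ _);
          first exact: finite_set0.
      by exists j.
    have [w _] := @circleP R 1 (normc1 R).
    apply: le_trans (@red_norm_ge _ F i w 0 _); first by rewrite lee_fin hilbert_norm_ge0.
    by rewrite hilbert_norm0.
  move=> i _; apply: ge_ereal_sup => _ [w _ <-]; apply: ge_ereal_sup => _ [v v1 <-].
  exact: red_norm_ge.
have n0 : (0 <= nsa_norm F)%E by rewrite /=; exact: bigmax_ge_id.
have hn i (w : S1) : (matrix_norm (F i w) <= nsa_norm F)%E.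
  rewrite /=; apply: (bigmax_sup i) => //.
  by apply: ereal_sup_ubound; exists w.
(* F is not assumed continuous, so its norm may be infinite. *)
case E : (nsa_norm F) n0 hn => [m| |] n0 hn //; last by rewrite leey.
by apply: red_norm_le => //; rewrite -lee_fin.
Qed.

End RedNorm.

(** * Refinement of blocks *)

Section Refinement.
Variables (R : realType) (S : substitution_tiling R).
Hypothesis hS : standing_assumptions S.
Implicit Types (i j : 'I_(st_num S)) (x y v : 'cV[R]_2) (r e : R) (t s : tile R) (T : tiling R).

Local Notation p := (st_proto (s := S)).
Local Notation Omega := (hull (st_tiling S)).
Local Notation lam := (st_lambda S).
Local Notation S1 := (set_type (@circle R)).
Local Notation BA N := (block_algebra R (level_block S N)).

Definition circM (w b : S1) : S1 :=
    sval (cid (circleP (normc_unitM (circle_unit w) (circle_unit b)))).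

Lemma val_circM (w b : S1) : val (circM w b) = val w * val b.
Proof. by rewrite /circM; case: cid. Qed.

Lemma circM_inj (w b b' : S1) : circM w b = circM w b' -> b = b'.
Proof.
move=> /(congr1 val); rewrite !val_circM => E; apply: val_inj.
by apply: mulfI E; apply: normc_unit_neq0; exact: circle_unit.
Qed.

Lemma supertileS N j : supertile N.+1 j = omega_iter S N (st_subst j).
Proof.
rewrite /supertile /omega_iter iterSr; congr iter.
rewrite /omega bigcup_set1 -[in LHS](plc1 (p j)) omega_tile_proto //; last exact: normc1.
by rewrite scaler0 plt1.
Qed.

Lemma supertile_split N j s : supertile N.+1 j s -> exists i b v t,
  [/\ normc b = 1, st_subst j (plc b v (p i)), supertile N i t & s = plc b (lam ^+ N *: v) t].
Proof.
rewrite supertileS => /omega_iter_bigcup[u ju us].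
have [i [b [v [b1 uE]]]] := subst_proto hS ju; subst u.
by move: us; rewrite omega_iter1 // => -[t Nt <-]; exists i, b, v, t.
Qed.

(* omega(T), moved so that its tile b p_i + v becomes p_i. *)
Definition desubst T b v : tiling R := plt b^-1 (invv b v) (omega S T).

Lemma refine_hull_at j T i b v : hull_at j T -> normc b = 1 -> st_subst j (plc b v (p i)) ->
  hull_at i (desubst T b v).
Proof.
move=> [OT Tp] b1 ju; have b0 := normc_unit_neq0 b1; split.
  by apply: (hull_plt hS); [exact: normc_unitV|exact: sa_omega_hull hS _ OT].
exists (plc b v (p i)); last by rewrite plcK.
exists (p j) => //; rewrite -(plc1 (p j)) omega_tile_proto //; last exact: normc1.
by rewrite scaler0 plt1.
Qed.

(** The rotation b of the tile of omega(p_j) is absorbed into the circle variable, and the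
    translations by lambda^N v cancel. *)
Lemma refine_pt N j T i b v t w : normc b = 1 -> normc w = 1 ->
  pt S N.+1 w T (plc b (lam ^+ N *: v) t) = pt S N (w * b) (desubst T b v) t.
Proof.
move=> b1 w1; have b0 := normc_unit_neq0 b1;
    rewrite /pt /omega_iter iterSr -/(omega_iter S N _).
rewrite -[in LHS](pltVK v b0 (omega S T)) -/(desubst T b v) omega_iter_plt // plt_comp.
congr plt; rewrite puncture_plc /sim mulmxDr -cmxM_vec opprD addrCA.
by rewrite subrr addr0.
Qed.

Lemma refine_supertile N j i b v t : normc b = 1 -> st_subst j (plc b v (p i)) ->
  supertile N i t -> supertile N.+1 j (plc b (lam ^+ N *: v) t).
Proof.
move=> b1 ju Nt; rewrite supertileS; apply/omega_iter_bigcup; exists (plc b v (p i)) => //.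
by rewrite omega_iter1 //; exists t.
Qed.

(* The tile b p_i + v of omega(p_j) whose level N patch contains a given tile of
   omega^(N+1)(p_j), and the index of that tile in omega^N(p_i). *)
Record parent_data N := ParentData { par_i : 'I_(st_num S); par_b : S1; par_v : 'cV[R]_2;
    par_l : 'I_(level_dim N par_i).+1 }.

Definition parent_of N j s (D : parent_data N) :=
    st_subst j (plc (val (par_b D)) (par_v D) (p (par_i D))) /\
  s = plc (val (par_b D)) (lam ^+ N *: par_v D) (level_tile (par_l D)).

Lemma parent_exists N j (k : 'I_(level_dim N.+1 j).+1) : exists D : parent_data N,
    parent_of j (level_tile k) D.
Proof.
have [i [b [v [t [/circleP[u <-] ju /(level_tile_surj hS)[l ->] E]]]]] :=
    supertile_split (level_tile_supertile hS k).
by exists (@ParentData N i u v l).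
Qed.

Definition parent N j (k : 'I_(level_dim N.+1 j).+1) : parent_data N :=
    sval (cid (parent_exists k)).

Lemma parentP N j (k : 'I_(level_dim N.+1 j).+1) : parent_of j (level_tile k) (parent k).
Proof. exact: svalP (cid (parent_exists k)). Qed.

(* Tiles with the same parent lie in the same p_i, so [inord] does not
   truncate. *)
Definition refine_block N (F : BA N) : BA N.+1 := fun j w => \matrix_(k, k')
  (let D := parent k in let D' := parent k' in
   if `[< par_i D = par_i D' /\ par_b D = par_b D' /\ par_v D = par_v D' >]
   then F (par_i D) (circM w (par_b D)) (par_l D) (inord (par_l D')) else 0).

Lemma refine_block_dom N (F : BA N) : nsa_dom F -> nsa_dom (refine_block F).
Proof.
move=> dF j k k'; apply/circle_continuous => w e e0 /=.
have [d d0 hd] := (circle_continuous _).1 (dF (par_i (parent k)) (par_l (parent k)) (inord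
    (par_l (parent k')))) (circM w (par_b (parent k))) e e0.
exists d => // w' ww; rewrite !mxE /=; case: asboolP => _; last first.
  by rewrite subrr normc0.
apply: hd; rewrite !val_circM -mulrBl normcM circle_unit mulr1.
exact: ww.
Qed.

Lemma pnt_refine N j T w (k : 'I_(level_dim N.+1 j).+1) : hull_at j T ->
  hull_at (par_i (parent k)) (desubst T (val (par_b (parent k))) (par_v (parent k))) /\
  pnt T w k = pnt (desubst T (val (par_b (parent k))) (par_v (parent k))) (circM w (par_b
      (parent k))) (par_l (parent k)).
Proof.
move=> XT; have [ju E] := parentP k; have b1 := circle_unit (par_b (parent k)).
split; first exact: refine_hull_at ju.
rewrite /pnt {1}E val_circM; apply: refine_pt => //; exact: circle_unit.
Qed.

(** With the same rotation, two placements differ by a translation, which would be a period. *)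
Lemma desubst_inj T b v v' : Omega T -> normc b = 1 -> desubst T b v = desubst T b v' -> v = v'.
Proof.
move=> OT b1 E; have b0 := normc_unit_neq0 b1.
have O' : Omega (desubst T b v).
  by apply: (hull_plt hS); [exact: normc_unitV|exact: sa_omega_hull hS _ OT].
have [//|nv] := EM (v = v').
have ni : invv b v' - invv b v <> 0.
  move=> /eqP; rewrite subr_eq0 /invv eqr_opp => /eqP /(congr1 (fun y => cmx b *m y)).
  by rewrite -!cmxM_vec divff // !cmx1_vec => vE; apply: nv.
case: (sa_aperiodic hS O' ni).
rewrite shift_tilingE /desubst plt_comp mul1r cmx1_vec addrC subrK.
exact/esym.
Qed.

(** Two points of a level N + 1 block lie in a common level N block exactly when their tiles have
    the same parent. Refinement thus leaves the function on pairs unchanged. *)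
Lemma block_fun_refine N (F : BA N) : block_fun (refine_block F) = block_fun F.
Proof.
apply/funext => T1; apply/funext => T2.
have [[j [T [w [k [k' [XT -> ->]]]]]]|nb] := EM (same_block S N.+1 T1 T2).
  rewrite block_fun_pnt // mxE /=.
  have [X1 E1] := pnt_refine w k XT; have [X2 E2] := pnt_refine w k' XT.
  rewrite E1 E2; case: asboolP => [[Di [Db Dv]]|nD].
    move: (parent k) (parent k') Di Db Dv X1 X2 {E1 E2} => [i b v l] [i' b' v' l'] /= Di Db
        Dv X1 X2.
    by subst i' b' v'; rewrite block_fun_pnt // inord_val.
  rewrite block_fun_out // => /(same_block_pnt hS _ _ _ X1)[l E]; apply: nD.
  have [Di DT Db _] := pnt_inj hS X2 X1 E.
  move: (circM_inj Db) => {}Db; rewrite Di Db; split=> //; split=> //.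
  apply/esym; move: DT; rewrite Db; apply: desubst_inj; [by case: XT|exact: circle_unit].
(* Every level N block is contained in a level N + 1 block. *)
rewrite block_fun_out // block_fun_out // => sb; apply: nb.
have [OT1 _] := same_block_R_punc hS sb.
have [j [T [w [k [XT T1E]]]]] := pnt_exists hS N.+1 OT1.
have [X1 E1] := pnt_refine w k XT.
move: sb; rewrite T1E E1 => /(same_block_pnt hS _ _ _ X1)[l ->].
rewrite -E1; apply/(same_block_pnt hS _ _ _ XT).
have [ju _] := parentP k; have b1 := circle_unit (par_b (parent k)).
have [k' E'] := level_tile_surj hS (refine_supertile b1 ju (level_tile_supertile hS l)).
exists k'; rewrite /pnt -E' val_circM; apply/esym; apply: refine_pt => //; exact: circle_unit.
Qed.

End Refinement.

(** * Density of trigonometric polynomials *)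

Section Trig.
Variable R : realType.
Implicit Types (n m : nat) (e : R).
Local Notation S1 := (set_type (@circle R)).

(* Uniform continuity and boundedness in the form used by Korovkin's method. *)
Lemma quadratic_modulus (g : S1 -> R[i]^o) e : continuous g -> 0 < e ->
  exists2 C : R, 0 <= C & forall u w : S1,
    normc (g u - g w) <= e + C * normc (val u - val w) ^+ 2.
Proof.
move=> /circle_continuous cg e0; apply: contrapT => nh.
have ex n : exists uw : S1 * S1,
    e + n%:R * normc (val uw.1 - val uw.2) ^+ 2 < normc (g uw.1 - g uw.2).
  apply: contrapT => nn; apply: nh; exists n%:R => // u w; rewrite leNgt; apply/negP => h.
  by apply: nn; exists (u, w).
pose c n := sval (cid (ex n)); 
have hc n : e + n%:R * normc (val (c n).1 - val (c n).2) ^+ 2 < normc (g (c n).1 - g (c n).2).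
  exact: (svalP (cid (ex n))).
(* F contains all tails, so limits along F serve as limits of a subsequence. If the limits u and w
   coincide, continuity contradicts [hc]; if not, the quadratic term grows without bound. *)
have [F [FU Foo]] := @ultraFilterLemma _ (nbhs \oo) _.
have lim (f : nat -> S1) : exists a : S1, forall d, 0 < d ->
    F [set n | normc (val (f n) - val a) < d].
  have [|a /circleP[b <-] ha] := ultra_cvg_circle (F := F) (f := fun n => val (f n)).
    by apply: Foo; near=> n => /=; exact: circle_unit.
  by exists b.
have [u hu] := lim (fun n => (c n).1); have [w hw] := lim (fun n => (c n).2).
have limg d : 0 < d -> F [set n | normc (g (c n).1 - g u) < d /\ normc (g (c n).2 - g w) < d].
  move=> d0; have [d1 d10 h1] := cg u _ d0; have [d2 d20 h2] := cg w _ d0.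
  by apply: filterS (ultraI FU (hu _ d10) (hw _ d20)) => n [/h1 ? /h2 ?].
have tri n : normc (g (c n).1 - g (c n).2) <=
    normc (g (c n).1 - g u) + normc (g u - g w) + normc (g (c n).2 - g w).
  have := normc_distm (g (c n).1) (g u) (g (c n).2).
  have := normc_distm (g u) (g w) (g (c n).2).
  by rewrite (normcB (g w)); lra.
have [uw|nuw] := eqVneq u w.
  subst w.
  have e2 : 0 < e / 2 by rewrite divr_gt0.
  have /filter_ex[n [h1 h2]] := limg _ e2.
  have := hc n; have := tri n; rewrite subrr normc0.
  have : 0 <= n%:R * normc (val (c n).1 - val (c n).2) ^+ 2 by rewrite mulr_ge0 // sqr_ge0.
  by move: h1 h2; lra.
pose dl := normc (val u - val w).
have dl0 : 0 < dl.
  rewrite lt_neqAle normc_ge0 andbT eq_sym; apply/eqP => /eq0_normc/eqP.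
  by rewrite subr_eq0 => /eqP/val_inj/eqP; apply/negP.
have dl3 : 0 < dl / 3 by rewrite divr_gt0.
(* Bounds the differences of g along the sequence, with error 1 at each end. *)
pose L := normc (g u - g w) + 2.
have L0 : 0 <= L by rewrite addr_ge0 ?normc_ge0.
pose n0 := Num.bound (L / (dl / 3) ^+ 2).
have hn0 : L / (dl / 3) ^+ 2 < n0%:R by apply: archi_boundP; rewrite divr_ge0 // sqr_ge0.
have Fn0 : F [set n | (n0 <= n)%N] by apply: Foo; exact: nbhs_infty_ge.
have /filter_ex[n [[[/= h1 h2] [/= h3 h4]] /= h5]] :=
  ultraI FU (ultraI FU (limg _ ltr01) (ultraI FU (hu _ dl3) (hw _ dl3))) Fn0.
have far : dl / 3 <= normc (val (c n).1 - val (c n).2).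
  have := normc_distm (val u) (val (c n).1) (val w).
  have := normc_distm (val (c n).1) (val (c n).2) (val w).
  by rewrite (normcB (val u) (val (c n).1)) -/dl; lra.
have far2 : (dl / 3) ^+ 2 <= normc (val (c n).1 - val (c n).2) ^+ 2.
  by rewrite lerXn2r // nnegrE ?normc_ge0 // ltW.
have nn : n0%:R <= n%:R :> R by rewrite ler_nat.
move: hn0; rewrite ltr_pdivrMr ?exprn_gt0 // => hn0.
have := hc n; have := tri n.
have : n0%:R * (dl / 3) ^+ 2 <= n%:R * normc (val (c n).1 - val (c n).2) ^+ 2.
  by apply: ler_pM => //; exact: sqr_ge0.
by rewrite /L in hn0; lra.
Unshelve. all: by end_near. Qed.

Lemma expiMn (a : R) n : expi (a *+ n) = expi a ^+ n.
Proof.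
elim: n => [|n IH]; first by rewrite mulr0n expi0 expr0.
by rewrite mulrS expiD IH exprS.
Qed.

(** Otherwise sin (a / 2) would vanish for a / 2 strictly between 0 and pi. *)
Lemma expi_neq1 (a : R) : 0 < a -> a < pi *+ 2 -> expi a != 1.
Proof.
move=> a0 a2; apply/eqP => /(congr1 (@complex.Re R)) /=.
have -> : a = (a / 2) *+ 2 by rewrite -mulr_natr divfK // pnatr_eq0.
rewrite cos_mulr2n => h.
have : 0 < sin (a / 2).
  by apply: sin_gt0_pi; rewrite divr_gt0 //= ltr_pdivrMr // mulr_natr.
have := cos2Dsin2 (a / 2); move: h; rewrite -mulr_natr.
by move: (cos _) (sin _) => c s; rewrite !expr2; nra.
Qed.

Lemma prim_root n : exists z : R[i], [/\ normc z = 1, z ^+ n.+1 = 1 &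
  forall k, (0 < k <= n)%N -> z ^+ k != 1].
Proof.
pose th : R := pi *+ 2; have th0 : 0 < th by rewrite mulrn_wgt0 // pi_gt0.
exists (expi (th / n.+1%:R)); have n0 : 0 < n.+1%:R :> R by rewrite ltr0n.
split; first exact: expi_unit.
  rewrite -expiMn -[_ *+ n.+1]mulr_natr divfK ?gt_eqF //.
  by rewrite /expi /th cos2pi sin2pi.
move=> k /andP[k0 kn]; rewrite -expiMn -[_ *+ k]mulr_natr; apply: expi_neq1.
  by rewrite mulr_gt0 ?divr_gt0 // ltr0n.
by rewrite mulrAC ltr_pdivrMr // -/th ltr_pM2l // ltr_nat.
Qed.

(* On the circle this is |1 + s|^(2n). *)
Definition kern n (s : R[i]) : R[i] := (1 + s) ^+ n * (1 + s^-1) ^+ n.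

Lemma kernE n s : kern n s = \sum_(a < n.+1) \sum_(b < n.+1)
  ('C(n, a) * 'C(n, b))%:R * (s ^+ a * s^-1 ^+ b).
Proof.
rewrite /kern !exprDn big_distrl /=; apply: eq_bigr => a _; rewrite big_distrr /=.
apply: eq_bigr => b _; rewrite !expr1n !mul1r natrM.
by rewrite -[s ^+ a *+ _]mulr_natl -[s^-1 ^+ b *+ _]mulr_natl; ring.
Qed.

Lemma kern_real n (s : R[i]) : normc s = 1 -> kern n s = ((normc (1 + s) ^+ 2) ^+ n)%:C.
Proof.
move=> s1; have s0 := normc_unit_neq0 s1.
rewrite /kern -exprMn -(conjc_unit s1) -[1 in X in _ * X]conjc1 -rmorphD /= -sqr_normc.
by rewrite normc_norm !rmorphXn.
Qed.

Lemma normc1B2 (s : R[i]) : normc s = 1 -> normc (1 - s) ^+ 2 = 4 - normc (1 + s) ^+ 2.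
Proof.
case: s => a b /= h.
have h2 : a ^+ 2 + b ^+ 2 = 1.
  by rewrite -[LHS]sqr_sqrtr ?h ?expr1n // addr_ge0 // sqr_ge0.
rewrite !sqr_sqrtr ?addr_ge0 ?sqr_ge0 //; move: h2; rewrite !expr2; lra.
Qed.

(** The constant Fourier coefficient of [kern n]. *)
Definition binsq n : nat := \sum_(a < n.+1) 'C(n, a) ^ 2.

Lemma binsqE n : binsq n = 'C(n + n, n).
Proof.
rewrite -binomial.Vandermonde /binsq; apply: eq_bigr => a _.
by rewrite bin_sub ?mulnn // -ltnS.
Qed.

Lemma binsq_gt0 n : (0 < binsq n)%N.
Proof. by rewrite binsqE bin_gt0 leq_addr. Qed.

(** The ratio of consecutive central binomial coefficients, which gives the second moment of the
    kernel. *)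
Lemma binsqS n : (n.+1 * binsq n.+1 = 2 * (n + n).+1 * binsq n)%N.
Proof.
rewrite !binsqE; apply/eqP; rewrite -(eqn_pmul2l (ltn0Sn n)); apply/eqP.
rewrite addSn addnS.
have h1 : (n.+1 * 'C((n + n).+2, n.+1) = (n + n).+2 * 'C((n + n).+1, n))%N.
  by rewrite -mul_bin_diag.
have h2 : (n.+1 * 'C((n + n).+1, n) = (n + n).+1 * 'C(n + n, n))%N.
  by have := mul_bin_down (n + n).+1 n; rewrite -addSn addnK /= => ->.
rewrite h1 mulnCA h2 (_ : (n + n).+2 = 2 * n.+1)%N; last by rewrite mul2n -addnn addnS addSn.
by rewrite !mulnA [(2 * n.+1)%N]mulnC.
Qed.

(** Summation over all (m+1)-th roots of unity kills each power u^(a - b) with 0 < |a - b| <= n <=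
    m, so only the constant coefficient survives: an exact quadrature. *)
Lemma kern_sum n m (z u : R[i]) : normc z = 1 -> normc u = 1 -> z ^+ m.+1 = 1 ->
  (forall k, (0 < k <= m)%N -> z ^+ k != 1) -> (n <= m)%N ->
  \sum_(j < m.+1) kern n (u / z ^+ j) = (m.+1 * binsq n)%:R.
Proof.
move=> z1 u1 zm zk nm; have z0 := normc_unit_neq0 z1; have u0 := normc_unit_neq0 u1.
have zj j := expf_neq0 j z0.
have pw a b : (a < b)%N -> (b <= m)%N -> z ^+ b != z ^+ a.
  move=> ab bm; rewrite -(subnK (ltnW ab)) exprD -subr_eq0 -[X in _ - X]mul1r -mulrBl mulf_eq0.
  rewrite negb_or zj andbT subr_eq0; apply: zk; rewrite subn_gt0 ab /=.
  exact: leq_trans (leq_subr _ _) bm.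
have E : \sum_(j < m.+1) kern n (u / z ^+ j) = \sum_(a < n.+1) \sum_(b < n.+1)
    ('C(n, a) * 'C(n, b))%:R * (u ^+ a / u ^+ b) * \sum_(j < m.+1) (z ^+ b / z ^+ a) ^+ j.
  under eq_bigr do rewrite kernE.
  rewrite exchange_big /=; apply: eq_bigr => a _; rewrite exchange_big /=;
      apply: eq_bigr => b _.
  rewrite mulr_sumr; apply: eq_bigr => j _.
  rewrite invf_div !exprMn !exprVn -!exprM ![(j * _)%N]mulnC -mulrA; congr (_ * _).
  by rewrite [LHS]mulrACA [RHS]mulrACA; congr (_ * _); exact: mulrC.
rewrite E natrM /binsq natr_sum mulr_sumr; apply: eq_bigr => a _.
rewrite (bigD1 a) //= [X in _ + X = _]big1 ?addr0.
  rewrite divff ?expf_neq0 // mulr1 divff //.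
  under eq_bigr do rewrite expr1n.
  by rewrite sumr_const card_ord mulnn mulrC.
move=> b ba.
have xm : (z ^+ b / z ^+ a) ^+ m.+1 = 1.
  by rewrite exprMn exprVn -!exprM ![(_ * m.+1)%N]mulnC !exprM zm !expr1n invr1 mulr1.
have x1 : z ^+ b / z ^+ a != 1.
  rewrite -subr_eq0 -(inj_eq (mulIf (zj a))) mul0r mulrBl mul1r divfK // subr_eq0.
  have an : (a <= m)%N by apply: leq_trans nm; rewrite -ltnS.
  have bn : (b <= m)%N by apply: leq_trans nm; rewrite -ltnS.
  case: (ltngtP a b) => ab; last by move: ba; rewrite -val_eqE /= ab eqxx.
    exact: pw.
  by rewrite eq_sym; exact: pw.
have : (z ^+ b / z ^+ a - 1) * \sum_(j < m.+1) (z ^+ b / z ^+ a) ^+ j = 0 by rewrite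
    -subrX1 xm subrr.
move=> /eqP; rewrite mulf_eq0 subr_eq0 (negbTE x1) /= => /eqP ->.
by rewrite mulr0.
Qed.

(** Built one monomial at a time, to match the induction in [spanned_trig]. *)
Inductive trigpoly : (S1 -> R[i]) -> Prop :=
| trig0 : trigpoly (fun=> 0)
| trigS c (k : int) g : trigpoly g -> trigpoly (fun w => c * val w ^ k + g w).

Lemma trigpolyD g h : trigpoly g -> trigpoly h -> trigpoly (fun w => g w + h w).
Proof.
move=> tg th; elim: tg => [|c k g' _ IH].
  by rewrite (_ : (fun _ => _) = h) //; apply/funext => w; rewrite add0r.
rewrite (_ : (fun _ => _) = fun w => c * val w ^ k + (g' w + h w)); first exact: trigS.
by apply/funext => w; rewrite addrA.
Qed.

Lemma trigpolyM c g : trigpoly g -> trigpoly (fun w => c * g w).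
Proof.
elim=> [|d k g' _ IH].
  by rewrite (_ : (fun _ => _) = fun=> 0); [exact: trig0|apply/funext => w; rewrite mulr0].
rewrite (_ : (fun _ => _) = fun w => (c * d) * val w ^ k + c * g' w); first exact: trigS.
by apply/funext => w; rewrite mulrDr mulrA.
Qed.

Lemma trigpoly_sum n (f : 'I_n -> S1 -> R[i]) :
  (forall j, trigpoly (f j)) -> trigpoly (fun w => \sum_j f j w).
Proof.
elim: n f => [|n IH] f hf.
  by rewrite (_ : (fun _ => _) = fun=> 0); [exact: trig0|apply/funext => w; rewrite big_ord0].
rewrite (_ : (fun _ => _) = fun w => f ord0 w + \sum_j f (lift ord0 j) w).
  by apply: trigpolyD => //; exact: IH.
by apply/funext => w; rewrite big_ord_recl.
Qed.

Lemma trigpoly_monomial c (k : int) : trigpoly (fun w => c * val w ^ k).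
Proof.
rewrite (_ : (fun _ => _) = fun w => c * val w ^ k + 0); first exact: (trigS _ _ trig0).
by apply/funext => w; rewrite addr0.
Qed.

Lemma trigpoly_kern n (z : R[i]) : z != 0 -> trigpoly (fun w => kern n (val w / z)).
Proof.
move=> z0; rewrite (_ : (fun _ => _) = fun w => \sum_(a < n.+1) \sum_(b < n.+1)
  (('C(n, a) * 'C(n, b))%:R * (z ^+ b / z ^+ a)) * val w ^ (Posz a - Posz b)).
  by do 2!apply: trigpoly_sum => ?; exact: trigpoly_monomial.
apply/funext => w; rewrite kernE; apply: eq_bigr => a _; apply: eq_bigr => b _.
have w0 := normc_unit_neq0 (circle_unit w).
rewrite expfzDr // -exprnN -mulrA; congr (_ * _).
rewrite invf_div !exprMn !exprVn -!exprnP.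
by rewrite [LHS]mulrACA [RHS]mulrACA; congr (_ * _); exact: mulrC.
Qed.

(* The approximant is the average of g over the (n+2)-th roots of unity against
   the kernel; since |1 - s|^2 = 4 - |1 + s|^2, the second moment of the kernel
   is 4 - C(2n+2, n+1) / C(2n, n) = 2 / (n + 1). *)
Lemma trig_dense (g : S1 -> R[i]^o) e : continuous g -> 0 < e ->
  exists2 h, trigpoly h & forall w, normc (g w - h w) < e.
Proof.
move=> cg e0; have e2 : 0 < e / 2 by rewrite divr_gt0.
have [C C0 hC] := quadratic_modulus cg e2.
(* The final error is at most e / 2 + 2 C / (n + 1), below e by this choice of n. *)
pose n := Num.bound (4 * C / e).
have hn : 4 * C < n%:R * e.
  by rewrite -ltr_pdivrMr //; apply: archi_boundP; rewrite divr_ge0 ?mulr_ge0 // ltW.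
(* Roots of order n + 2 make the quadrature exact for [kern n.+1] as well, which enters through the
   second moment. *)
have [z [z1 zM zk]] := prim_root n.+1.
have z0 := normc_unit_neq0 z1.
have v_ (j : 'I_n.+2) : exists v : S1, val v = z ^+ j by apply: circleP; exact: normc_unitX.
pose v j : S1 := sval (cid (v_ j)); have vE j : val (v j) = z ^+ j := svalP (cid (v_ j)).
pose D : R := (n.+2 * binsq n)%:R.
have D0 : 0 < D by rewrite ltr0n muln_gt0 binsq_gt0.
pose h (w : S1) : R[i] := (D^-1)%:C * \sum_j g (v j) * kern n (val w / z ^+ j).
exists h.
  apply: trigpolyM; apply: trigpoly_sum => j; apply: trigpolyM; apply: trigpoly_kern.
  exact: expf_neq0.
move=> w; have w1 := circle_unit w.
pose s j := val w / z ^+ j; have s1 j : normc (s j) = 1.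
  by rewrite /s normc_unitM // normc_unitV // normc_unitX.
pose kr m j : R := (normc (1 + s j) ^+ 2) ^+ m.
have kr0 m j : 0 <= kr m j by rewrite exprn_ge0 // sqr_ge0.
have krE m j : kern m (s j) = (kr m j)%:C by rewrite kern_real.
have ksum m : (m <= n.+1)%N -> \sum_(j < n.+2) kr m j = (n.+2 * binsq m)%:R.
  move=> mn; have := kern_sum z1 w1 zM zk mn.
  under eq_bigr do rewrite krE.
  by rewrite -rmorph_sum /= -(rmorph_nat (real_complex R)) => /complexI.
have Dsum : \sum_(j < n.+2) kr n j = D by rewrite ksum.
have gE : g w - h w = (D^-1)%:C * \sum_j (g w - g (v j)) * (kr n j)%:C.
  under [X in _ * X]eq_bigr do rewrite mulrBl.
  rewrite sumrB mulrBr -mulr_sumr -rmorph_sum /= Dsum mulrCA -rmorphM /= mulVf ?gt_eqF //.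
  by rewrite rmorph1 mulr1 /h; under [in LHS]eq_bigr do rewrite krE.
rewrite gE normcM normc_real gtr0_norm ?invr_gt0 //.
rewrite mulrC ltr_pdivrMr //.
apply: le_lt_trans (normc_sum _) _.
(* The quadratic modulus times the kernel, where |w - v_j|^2 = 4 - |1 + s_j|^2 turns the quadratic
   term into a difference of two kernels. *)
have bound j : normc ((g w - g (v j)) * (kr n j)%:C) <=
    (e / 2) * kr n j + C * (4 * kr n j - kr n.+1 j).
  rewrite normcM normc_real ger0_norm //.
  have wv : normc (val w - val (v j)) ^+ 2 = 4 - normc (1 + s j) ^+ 2.
    rewrite -normc1B2 // vE; congr (_ ^+ 2).
    rewrite (_ : val w - z ^+ j = z ^+ j * (s j - 1));
        last by rewrite mulrBr mulr1 mulrC divfK ?expf_neq0.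
    by rewrite normcM normc_unitX // mul1r normcB.
  have := ler_wpM2r (kr0 n j) (hC w (v j)); rewrite wv => hh; apply: le_trans hh _.
  have -> : kr n.+1 j = kr n j * normc (1 + s j) ^+ 2 by rewrite /kr exprSr.
  by rewrite le_eqVlt; apply/orP; left; apply/eqP; ring.
apply: le_lt_trans (ler_sum _ (fun j _ => bound j)) _.
rewrite big_split /= -!mulr_sumr sumrB -mulr_sumr Dsum ksum //.
have kS : (n.+1%:R * (n.+2 * binsq n.+1)%:R = 2 * (n%:R + n%:R + 1) * D :> R).
  by rewrite -natrD natr1 -!natrM mulnCA binsqS mulnCA.
have n1 : 0 < n.+1%:R :> R by rewrite ltr0n.
rewrite -(ltr_pM2l n1) -natr1 in kS *.
rewrite -natr1 mulrDr [X in _ + X]mulrCA mulrBr kS.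
have -> : (n%:R + 1) * (4 * D) - 2 * (n%:R + n%:R + 1) * D = 2 * D by ring.
have nr0 : 0 <= n%:R :> R by [].
have : (C * (2 * D)) * 2 < n%:R * e * D by rewrite [_ * 2](_ : _ = 4 * C * D);
    [rewrite ltr_pM2r|ring].
have eD : 0 < e * D by rewrite mulr_gt0.
have -> : 1 + 1 = 2 :> R by ring.
by move: (n%:R) nr0 => nr nr0; nra.
Qed.

End Trig.

(** * The inductive limit *)

Section CstarClosure.
Variables (R : realType) (A : cstar_algebra R).
Implicit Types (a b c : A) (e : R).

Lemma normE a : `|a| = (cabs a)%:C.
Proof. by rewrite /cabs RRe_real // ger0_real. Qed.

Lemma cabs_ge0 a : 0 <= cabs a.
Proof. by rewrite -lecR -normE normr_ge0. Qed.

Lemma cabsD a b : cabs (a + b) <= cabs a + cabs b.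
Proof. by rewrite -lecR rmorphD /= -!normE ler_normD. Qed.

Lemma cabsN a : cabs (- a) = cabs a.
Proof. by rewrite /cabs normrN. Qed.

Lemma cabsZ (k : R[i]) a : cabs (k *: a) = normc k * cabs a.
Proof. by apply: complexI; rewrite rmorphM /= -!normE normrZ normc_norm. Qed.

Lemma cabsM a b : cabs (cs_mul a b) <= cabs a * cabs b.
Proof. by rewrite -lecR rmorphM /= -!normE cs_normM. Qed.

(** From |b|^2 = |b* b| <= |b*| |b|, applied to a and to its adjoint. *)
Lemma cabs_star a : cabs (cs_star a) = cabs a.
Proof.
have half b : cabs b <= cabs (cs_star b).
  have [->|b0] := eqVneq (cabs b) 0; first exact: cabs_ge0.
  have bp : 0 < cabs b by rewrite lt_neqAle eq_sym b0 cabs_ge0.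
  rewrite -(ler_pM2r bp); apply: le_trans (cabsM _ _).
  by rewrite -lecR rmorphM /= -!normE cs_normC expr2.
by apply/le_anti; rewrite half andbT -{2}(cs_starK a) half.
Qed.

Lemma closureC (P : set A) a :
  closure P a <-> forall e, 0 < e -> exists2 b, P b & cabs (a - b) < e.
Proof.
split=> [cP e e0|h B].
- have : nbhs a [set b | cabs (a - b) < e].
    apply/nbhs_ballP; exists e%:C => /=; first by rewrite ltcR.
    by move=> b; rewrite -ball_normE /= normE ltcR.
  by move=> /cP[b [Pb ab]]; exists b.
- move=> /nbhs_ballP[[e f] /=]; rewrite ltcE /= => /andP[/eqP f0 e0]; subst f => hB.
  have [b Pb ab] := h _ e0; exists b; split=> //; apply: hB.
  by rewrite -ball_normE /= normE -[_ +i* _]/(e%:C) ltcR.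
Qed.

Lemma closure_closure (P : set A) : closure (closure P) = closure P.
Proof. by apply/esym/closure_id; exact: closed_closure. Qed.

Lemma cs_mul_approx a b a' b' e : 0 < e -> e <= 1 -> cabs (a - a') < e -> cabs (b - b') < e ->
  cabs (cs_mul a b - cs_mul a' b') <= e * (cabs a + cabs b + 1).
Proof.
move=> e0 e1 aa bb.
have -> : cs_mul a b - cs_mul a' b' = cs_mul (a - a') b + cs_mul a' (b - b').
  rewrite cs_mulDl cs_mulDr -[- a']scaleN1r -[- b']scaleN1r cs_scalel cs_scaler !scaleN1r.
  by rewrite addrA subrK.
apply: le_trans (cabsD _ _) _.
have h1 := cabsM (a - a') b; have h2 := cabsM a' (b - b').
have h3 : cabs a' <= cabs a + 1.
  have := cabsD a (- (a - a')); rewrite cabsN opprB addrC subrK; lra.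
have b0 := cabs_ge0 b; have a0 := cabs_ge0 a; have a'0 := cabs_ge0 a'.
have x0 := cabs_ge0 (a - a'); have y0 := cabs_ge0 (b - b').
have h4 : cabs (a - a') * cabs b <= e * cabs b by apply: ler_wpM2r => //; exact: ltW.
have h5 : cabs a' * cabs (b - b') <= (cabs a + 1) * e by apply: ler_pM => //; exact: ltW.
lra.
Qed.

Lemma closure_subalgebra (P : set A) : P 0 ->
  (forall (k : R[i]) a b, P a -> P b -> P (k *: a + b)) ->
  (forall a b, P a -> P b -> P (cs_mul a b)) ->
  (forall a, P a -> P (cs_star a)) -> cstar_subalgebra (closure P).
Proof.
move=> P0 Pl Pm Ps; split.
- exact: closed_closure.
- exact: subset_closure.
- move=> k a b /closureC ha /closureC hb; apply/closureC => e e0.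
  have k0 : 0 < normc k + 1 by rewrite ltr_wpDl // normc_ge0.
  have e1 : 0 < e / 2 / (normc k + 1) by rewrite !divr_gt0.
  have e2 : 0 < e / 2 by rewrite divr_gt0.
  have [a' Pa' aa] := ha _ e1; have [b' Pb' bb] := hb _ e2.
  exists (k *: a' + b'); first exact: Pl.
  rewrite opprD addrACA -scalerBr; apply: le_lt_trans (cabsD _ _) _; rewrite cabsZ.
  move: aa; rewrite ltr_pdivlMr // => aa.
  have := cabs_ge0 (a - a'); lra.
- move=> a b /closureC ha /closureC hb; apply/closureC => e e0.
  have K0 : 0 < cabs a + cabs b + 1 by rewrite ltr_wpDl // addr_ge0 // cabs_ge0.
  pose d := Num.min 1 (e / (2 * (cabs a + cabs b + 1))).
  have d0 : 0 < d by rewrite lt_min ltr01 divr_gt0 // mulr_gt0.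
  have d1 : d <= 1 by rewrite ge_min lexx.
  have [a' Pa' aa] := ha _ d0; have [b' Pb' bb] := hb _ d0.
  exists (cs_mul a' b'); first exact: Pm.
  apply: le_lt_trans (cs_mul_approx d0 d1 aa bb) _.
  have : d * (2 * (cabs a + cabs b + 1)) <= e.
    by rewrite -ler_pdivlMr ?mulr_gt0 // ge_min lexx orbT.
  by have : 0 < d * (cabs a + cabs b + 1); [rewrite mulr_gt0|lra].
- move=> a /closureC ha; apply/closureC => e /ha[a' Pa' aa].
  exists (cs_star a'); first exact: Ps.
  by rewrite -{1}(subrK a' a) cs_starD addrK cabs_star.
Qed.

Definition lspan (X : set A) : set A :=
  [set a | exists (m : nat) (k : 'I_m -> R[i]) (x : 'I_m -> A),
             (forall j, X (x j)) /\ a = \sum_(j < m) k j *: x j].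

Lemma lspan0 X : lspan X 0.
Proof. by exists 0%N, (fun=> 0), (fun=> 0); split; [case|rewrite big_ord0]. Qed.

Lemma lspan_lin X (c : R[i]) x a : X x -> lspan X a -> lspan X (c *: x + a).
Proof.
move=> Xx [m [k [y [hy ->]]]].
exists m.+1, (fun j => if unlift ord0 j is Some j' then k j' else c),
  (fun j => if unlift ord0 j is Some j' then y j' else x); split.
  by move=> j; case: unliftP.
rewrite big_ord_recl unlift_none; congr (_ + _).
by apply: eq_bigr => j _; rewrite liftK.
Qed.

Lemma lspanD X a b : lspan X a -> lspan X b -> lspan X (a + b).
Proof.
move=> [m [k [y [hy ->]]]] hb; elim: m k y hy => [|m IH] k y hy.
  by rewrite big_ord0 add0r.
rewrite big_ord_recl -addrA; apply: lspan_lin => //.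
by apply: IH.
Qed.

End CstarClosure.

(** * Sums and products of continuous functions on the circle *)

Section CircleContinuity.
Variable R : realType.
Local Notation S1 := (set_type (@circle R)).
Implicit Types f g : S1 -> R[i]^o.

Lemma circle_continuous_cst (c : R[i]^o) : continuous (fun _ : S1 => c).
Proof.
by apply/circle_continuous => w e e0; exists 1 => // w' _; rewrite subrr normc0.
Qed.

Lemma circle_continuousD f g : continuous f -> continuous g ->
    continuous (fun w => f w + g w : R[i]^o).
Proof. by move=> cf cg w; exact: (cvgD (cf w) (cg w)). Qed.

Lemma circle_continuousM f g : continuous f -> continuous g ->
    continuous (fun w => f w * g w : R[i]^o).
Proof. by move=> cf cg w; exact: (cvgM (cf w) (cg w)). Qed.

Lemma circle_continuous_sum n (f : 'I_n -> S1 -> R[i]^o) : (forall m, continuous (f m)) ->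
  continuous (fun w => \sum_m f m w : R[i]^o).
Proof.
elim: n f => [|n IH] f cf.
  rewrite (_ : (fun _ => _) = fun=> 0); last by apply/funext => w; rewrite big_ord0.
  exact: circle_continuous_cst.
rewrite (_ : (fun _ => _) = fun w => f ord0 w + \sum_m f (lift ord0 m) w); last first.
  by apply/funext => w; rewrite big_ord_recl.
by apply: circle_continuousD => //; exact: IH.
Qed.

End CircleContinuity.

(** * The levels inside the C*-algebra and their limit *)

Section Limit.
Variables (R : realType) (S : substitution_tiling R).
Hypothesis hS : standing_assumptions S.
Variables (A : cstar_algebra R) (iota : Cc_algebra S -> A).
Hypothesis hA : is_completion iota.
Implicit Types (i j : 'I_(st_num S)) (a b : A) (e : R).

Local Notation S1 := (set_type (@circle R)).
Local Notation BA N := (block_algebra R (level_block S N)).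

Definition psi N (F : BA N) : A := iota (block_fun F).

Lemma block_fun_inj N (F G : BA N) : block_fun F = block_fun G -> F = G.
Proof.
move=> E; apply: functional_extensionality_dep => i; apply/funext => w; apply/matrixP => k l.
have [T XT] := hull_at_neq0 hS i.
by have := congr1 (fun f => f (pnt T w k) (pnt T w l)) E; rewrite !block_fun_pnt.
Qed.

Lemma psiD N (F G : BA N) : nsa_dom F -> nsa_dom G -> psi (nsa_add F G) = psi F + psi G.
Proof.
move=> dF dG; rewrite /psi block_fun_add //; have [[_ h _ _ _] _ _] := hA.
by apply: h; exact: block_fun_Cc.
Qed.

Lemma psiZ N c (F : BA N) : nsa_dom F -> psi (nsa_scale c F) = c *: psi F.
Proof.
move=> dF; rewrite /psi block_fun_scale //; have [[_ _ h _ _] _ _] := hA.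
by apply: h; exact: block_fun_Cc.
Qed.

Lemma psiM N (F G : BA N) : nsa_dom F -> nsa_dom G ->
    psi (nsa_mul F G) = cs_mul (psi F) (psi G).
Proof.
move=> dF dG; rewrite /psi block_fun_mul //; have [[_ _ _ h _] _ _] := hA.
by apply: h; exact: block_fun_Cc.
Qed.

Lemma psi_star N (F : BA N) : nsa_dom F -> psi (nsa_star F) = cs_star (psi F).
Proof.
move=> dF; rewrite /psi block_fun_star //; have [[_ _ _ _ h] _ _] := hA.
by apply: h; exact: block_fun_Cc.
Qed.

Lemma cabs_psi N (F : BA N) : nsa_dom F -> (cabs (psi F))%:E = nsa_norm F.
Proof.
move=> dF; rewrite -red_norm_block_fun //; have [_ h _] := hA.
by apply: h; exact: block_fun_Cc.
Qed.

Lemma domD N (F G : BA N) : nsa_dom F -> nsa_dom G -> nsa_dom (nsa_add F G).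
Proof.
move=> dF dG i k l.
rewrite (_ : (fun w => _) = fun w => F i w k l + G i w k l); last by apply/funext => w;
    rewrite /= mxE.
exact: (circle_continuousD (dF i k l) (dG i k l)).
Qed.

Lemma domM N (F G : BA N) : nsa_dom F -> nsa_dom G -> nsa_dom (nsa_mul F G).
Proof.
move=> dF dG i k l.
rewrite (_ : (fun w => _) = fun w => \sum_m F i w k m * G i w m l);
    last by apply/funext => w; rewrite /= mxE.
by apply: circle_continuous_sum => m; exact: (circle_continuousM (dF i k m) (dG i m l)).
Qed.

Lemma domZ N c (F : BA N) : nsa_dom F -> nsa_dom (nsa_scale c F).
Proof.
move=> dF i k l.
rewrite (_ : (fun w => _) = fun w => c * F i w k l); last by apply/funext => w; rewrite /= mxE.
exact: (circle_continuousM (@circle_continuous_cst _ c) (dF i k l)).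
Qed.

Lemma dom_star N (F : BA N) : nsa_dom F -> nsa_dom (nsa_star F).
Proof.
move=> dF i k l; apply/circle_continuous => w e e0.
have [d d0 hd] := (circle_continuous _).1 (dF i l k) w e e0.
exists d => // w' /hd; rewrite /= !mxE -rmorphB /=.
suff -> : forall z : R[i], normc z^* = normc z by [].
by case=> x y /=; rewrite sqrrN.
Qed.

Definition zeroF N : BA N := fun j w => 0.
Arguments zeroF : clear implicits.

Lemma dom_zero N : nsa_dom (zeroF N).
Proof.
move=> i k l; rewrite (_ : (fun w => _) = fun=> 0); last by apply/funext => w; rewrite mxE.
exact: circle_continuous_cst.
Qed.

Lemma psi0 N : psi (zeroF N) = 0.
Proof.
rewrite -[RHS](scale0r (psi (zeroF N))) -(psiZ 0 (@dom_zero N)).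
by congr psi; apply: functional_extensionality_dep => j; apply/funext => w; rewrite /= scale0r.
Qed.

Definition psi_range N : set A := @psi N @` @nsa_dom R (BA N).

Lemma psi_range_lin N (k : R[i]) a b : psi_range N a -> psi_range N b ->
    psi_range N (k *: a + b).
Proof.
move=> [F dF <-] [G dG <-]; exists (nsa_add (nsa_scale k F) G).
  by apply: domD; [apply: domZ; exact: dF|exact: dG].
have dZ : nsa_dom (nsa_scale k F) by apply: domZ; exact: dF.
by rewrite (psiD dZ dG) (psiZ k dF).
Qed.

Lemma psi_range0 N : psi_range N 0.
Proof. by exists (zeroF N); [exact: dom_zero|exact: psi0]. Qed.

Lemma dom_entry N i (k l : 'I_(level_dim N i).+1) (g : S1 -> R[i]) :
  continuous (g : S1 -> R[i]^o) -> nsa_dom (entry k l g).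
Proof.
move=> cg j a b; case E : ((j == i) && (a == k :> nat) && (b == l :> nat)).
  by rewrite (_ : (fun w => _) = g) //; apply/funext => w; rewrite mxE E.
rewrite (_ : (fun w => _) = fun=> 0); last by apply/funext => w; rewrite mxE E.
exact: circle_continuous_cst.
Qed.

Definition generators N : set A :=
    [set a | exists (i : 'I_(st_num S)) (t t' : tile R) (k : int),
    [/\ supertile N i t, supertile N i t'
      & a = iota (convolution S (zpow S k) (e_ N i t t'))]].

Lemma generators_psi N a : generators N a -> exists i (k l : 'I_(level_dim N i).+1) (m : int),
  a = psi (entry k l (fun w => (val w * expi (angle S (level_tile k))) ^ m)).
Proof.
move=> [i [t [t' [m [/(level_tile_surj hS)[k ->] /(level_tile_surj hS)[l ->] ->]]]]].
by exists i, k, l, m; rewrite generatorE.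
Qed.

Lemma lspan_generators_sub N : lspan (generators N) `<=` psi_range N.
Proof.
move=> _ [m [k [x [hx ->]]]]; elim/big_rec: _ => [|j a _ ha]; first exact: psi_range0.
apply: psi_range_lin => //; have [i [k' [l' [z ->]]]] := generators_psi (hx j).
eexists; last by [].
by apply: dom_entry; apply: power_continuous; exact: expi_unit.
Qed.

(** Continuity is carried along because [psi] is linear only on the domain. *)
Definition spanned N (F : BA N) := nsa_dom F /\ lspan (generators N) (psi F).

Lemma spanned_add N (F G : BA N) : spanned F -> spanned G -> spanned (nsa_add F G).
Proof.
move=> [dF sF] [dG sG]; split; first by apply: domD; [exact: dF|exact: dG].
by rewrite (psiD dF dG); exact: lspanD.
Qed.

Lemma spanned0 N : spanned (zeroF N).
Proof. by split; [exact: dom_zero|rewrite psi0; exact: lspan0]. Qed.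

Lemma spanned_trig N i (k l : 'I_(level_dim N i).+1) g : trigpoly g -> spanned (entry k l g).
Proof.
elim=> [|c m h _ [dh sh]].
  rewrite (_ : entry _ _ _ = zeroF N); first exact: spanned0.
  apply: functional_extensionality_dep => j; apply/funext => w; apply/matrixP => a b.
  by rewrite !mxE if_same.
set be := expi (angle S (level_tile k)).
have be1 : normc be = 1 by exact: expi_unit.
pose G : BA N := entry k l (fun w => (val w * be) ^ m).
have dG : nsa_dom G by apply: dom_entry; exact: power_continuous.
(* The generator carries the phase of its first tile; the coefficient c be^(-m) compensates for
   it. *)
have key (x : R[i]) : (c : R[i]) * x ^ m = c * be ^ (- m) * (x * be) ^ m.
  by rewrite expfzMl -mulrA [X in c * X]mulrCA -expfzDr ?normc_unit_neq0 // addNr expr0z mulr1.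
have E : entry k l (fun w => c * val w ^ m + h w) =
    nsa_add (nsa_scale (c * be ^ (- m)) G) (entry k l h).
  apply: functional_extensionality_dep => j; apply/funext => w; apply/matrixP => a b.
  rewrite /= !mxE; case: ifP => _; last by rewrite mulr0 addr0.
  by congr (_ + _); exact: key.
have dZ : nsa_dom (nsa_scale (c * be ^ (- m)) G) by apply: domZ; exact: dG.
split; first by rewrite E; apply: domD; [exact: dZ|exact: dh].
rewrite E (psiD dZ dh) (psiZ _ dG); apply: lspan_lin sh.
exists i, (level_tile k), (level_tile l), m; split;
    [exact: level_tile_supertile|exact: level_tile_supertile|].
by rewrite generatorE.
Qed.

Lemma hilbert_le_sum n (x : 'cV[R[i]]_n) : hilbert_norm x <= \sum_k normc (x k 0).
Proof.
have s0 : 0 <= \sum_k normc (x k 0) by apply: sumr_ge0 => k _; exact: normc_ge0.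
rewrite -[leRHS]ger0_norm // -sqrtr_sqr hilbert_normE ler_sqrt ?sqr_ge0 //.
elim: n x {s0} => [|n IH] x; first by rewrite !big_ord0 expr0n.
rewrite !big_ord_recl.
have := IH (\col_k x (lift ord0 k) 0).
under eq_bigr do rewrite mxE; under [X in _ <= X ^+ 2]eq_bigr do rewrite mxE.
have : 0 <= \sum_(k < n) normc (x (lift ord0 k) 0) by apply: sumr_ge0 => k _; exact: normc_ge0.
have := normc_ge0 (x ord0 0).
set B := \sum_(k < n) normc (x (lift ord0 k) 0).
set C := \sum_(k < n) normc (x (lift ord0 k) 0) ^+ 2.
by move: B C (normc _) => B C D *; nra.
Qed.

(** A crude bound suffices: at a fixed level the matrix sizes are fixed, so the factor n^2 can be
    divided out in advance. *)
Lemma matrix_norm_entries n (M : 'M[R[i]]_n) (d : R) :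
  (forall k l, normc (M k l) <= d) -> (matrix_norm M <= (n%:R * (n%:R * d))%:E)%E.
Proof.
move=> hM; apply: ge_ereal_sup => _ [v v1 <-]; rewrite lee_fin.
apply: le_trans (hilbert_le_sum _) _.
have vl l : normc (v l 0) <= 1.
  apply: le_trans v1; rewrite hilbert_normE -[leLHS]ger0_norm ?normc_ge0 // -sqrtr_sqr.
  rewrite ler_sqrt; last by apply: sumr_ge0 => ? _; exact: sqr_ge0.
  by rewrite (bigD1 l) //= lerDl; apply: sumr_ge0 => ? _; exact: sqr_ge0.
have cst (c : R) : \sum_(k < n) c = n%:R * c by rewrite sumr_const card_ord mulr_natl.
rewrite -cst; apply: ler_sum => k _; rewrite mxE; apply: le_trans (normc_sum _) _.
rewrite -cst; apply: ler_sum => l _; rewrite normcM -[leRHS]mulr1.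
by apply: ler_pM; rewrite ?normc_ge0.
Qed.

Lemma eval_big N (I : finType) (f : I -> BA N) j w k l :
  (\big[@nsa_add R (BA N)/zeroF N]_x f x) j w k l = \sum_x f x j w k l.
Proof.
apply: (big_morph (fun F : BA N => F j w k l)) => [F G|]; last by rewrite mxE.
by rewrite /= mxE.
Qed.

Lemma psi_dense N (F : BA N) : nsa_dom F -> closure (lspan (generators N)) (psi F).
Proof.
move=> dF; apply/closureC => e e0.
(* Divided by the square of the matrix size so that [matrix_norm_entries] returns e / 2. *)
pose d i : R := e / 2 / ((level_dim N i).+1%:R * (level_dim N i).+1%:R).
have n0 i : 0 < (level_dim N i).+1%:R :> R by rewrite ltr0n.
have d0 i : 0 < d i by rewrite !divr_gt0 // mulr_gt0.
have ex i (k l : 'I_(level_dim N i).+1) : exists h, trigpoly h /\ forall w,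
    normc (F i w k l - h w) < d i.
  by have [h th hh] := trig_dense (dF i k l) (d0 i); exists h.
pose h i k l := sval (cid (@ex i k l)).
have hP i k l : trigpoly (h i k l) /\ forall w,
    normc (F i w k l - h i k l w) < d i := svalP (cid (@ex i k l)).
pose H : BA N := \big[@nsa_add R (BA N)/zeroF N]_i \big[@nsa_add R (BA N)/zeroF N]_k
  \big[@nsa_add R (BA N)/zeroF N]_l entry k l (h i k l).
have [dH sH] : spanned H.
  apply: big_ind => [||i _]; [exact: spanned0|exact: spanned_add|].
  apply: big_ind => [||k _]; [exact: spanned0|exact: spanned_add|].
  apply: big_ind => [||l _]; [exact: spanned0|exact: spanned_add|].
  by apply: spanned_trig; have [] := hP i k l.
have HE j w (a b : 'I_(level_dim N j).+1) : H j w a b = h j a b w.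
  rewrite /H !eval_big (bigD1 j) //= [X in _ + X]big1 ?addr0; last first.
    move=> i ij; rewrite !eval_big big1 // => k _; rewrite !eval_big big1 // => l _.
    by rewrite mxE eq_sym (negbTE ij).
  rewrite !eval_big (bigD1 a) //= [X in _ + X]big1 ?addr0; last first.
    move=> k ka; rewrite !eval_big big1 // => l _; rewrite mxE.
    by rewrite [a == k :> nat](_ : _ = false) ?andbF //; apply/negbTE; rewrite eq_sym;
        exact: ka.
  rewrite !eval_big (bigD1 b) //= [X in _ + X]big1 ?addr0; last first.
    move=> l lb; rewrite mxE.
    by rewrite [b == l :> nat](_ : _ = false) ?andbF //; apply/negbTE; rewrite eq_sym;
        exact: lb.
  by rewrite mxE !eqxx.
exists (psi H) => //.
have dN : nsa_dom (nsa_scale (-1) H) by apply: domZ; exact: dH.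
have dD : nsa_dom (nsa_add F (nsa_scale (-1) H)) by apply: domD; [exact: dF|exact: dN].
have -> : psi F - psi H = psi (nsa_add F (nsa_scale (-1) H)).
  by rewrite (psiD dF dN) (psiZ _ dH) scaleN1r.
apply: (@le_lt_trans _ _ (e / 2)); last by rewrite ltr_pdivrMr // ltr_pMr // ltr1n.
rewrite -lee_fin (cabs_psi dD) -red_norm_block_fun //; apply: red_norm_le => //;
    first by rewrite divr_ge0 // ltW.
move=> i w; apply: le_trans (matrix_norm_entries (d := d i) _) _.
  by move=> k l; rewrite /= !mxE HE mulN1r ltW //; have [_] := hP i k l; apply.
rewrite lee_fin /d mulrA mulrC divfK // mulf_neq0 // gt_eqF //.
Qed.

Lemma A_closure N : A_ S iota N = closure (psi_range N).
Proof.
rewrite (_ : A_ S iota N = closure (lspan (generators N))) //.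
apply/seteqP; split; first by apply: closureS; exact: lspan_generators_sub.
rewrite -[X in _ `<=` X]closure_closure; apply: closureS => _ [F dF <-].
exact: psi_dense.
Qed.

Lemma psi_range_subalgebra N : cstar_subalgebra (closure (psi_range N)).
Proof.
apply: closure_subalgebra.
- exact: psi_range0.
- by move=> k a b; exact: psi_range_lin.
- move=> _ _ [F dF <-] [G dG <-]; exists (nsa_mul F G); first by apply: domM;
    [exact: dF|exact: dG].
  exact: (psiM dF dG).
- move=> _ [F dF <-]; exists (nsa_star F); first by apply: dom_star; exact: dF.
  exact: (psi_star dF).
Qed.

Lemma psi_refine N (F : BA N) : psi (refine_block hS F) = psi F.
Proof. by rewrite /psi block_fun_refine. Qed.

Lemma psi_rangeS N : psi_range N `<=` psi_range N.+1.
Proof.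
move=> _ [F dF <-]; exists (refine_block hS F); first by apply: refine_block_dom; exact: dF.
exact: psi_refine.
Qed.

Lemma A_S N : A_ S iota N `<=` A_ S iota N.+1.
Proof. by rewrite !A_closure; apply: closureS; exact: psi_rangeS. Qed.

Lemma A_mono N M : (N <= M)%N -> A_ S iota N `<=` A_ S iota M.
Proof.
move=> /subnK <-; elim: (M - N)%N => [//|m IH]; apply: subset_trans IH _.
exact: A_S.
Qed.

Lemma A_subalgebra N : cstar_subalgebra (A_ S iota N).
Proof. by rewrite A_closure; exact: psi_range_subalgebra. Qed.

Lemma AT_T_subalgebra : cstar_subalgebra (AT_T S iota).
Proof.
apply: closure_subalgebra.
- by exists 0%N => //; have [] := A_subalgebra 0.
- move=> k a b [N _ Na] [M _ Mb]; exists (maxn N M) => //.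
  have [_ _ h _ _] := A_subalgebra (maxn N M).
  by apply: h; [exact: A_mono (leq_maxl _ _) _ Na|exact: A_mono (leq_maxr _ _) _ Mb].
- move=> a b [N _ Na] [M _ Mb]; exists (maxn N M) => //.
  have [_ _ _ h _] := A_subalgebra (maxn N M).
  by apply: h; [exact: A_mono (leq_maxl _ _) _ Na|exact: A_mono (leq_maxr _ _) _ Mb].
- by move=> a [N _ Na]; exists N => //; have [_ _ _ _ h] := A_subalgebra N; exact: h.
Qed.

(** After the injective map [block_fun], refinement is the identity on functions of pairs, so every
    algebraic identity is inherited from there. *)
Lemma refine_block_hom N : star_hom (refine_block hS (N := N)).
Proof.
split.
- by move=> F dF; apply: refine_block_dom; exact: dF.
- by move=> F G _ _; apply: block_fun_inj;
    rewrite block_fun_refine !block_fun_add // !block_fun_refine.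
- by move=> c F _; apply: block_fun_inj;
    rewrite block_fun_refine !block_fun_scale // !block_fun_refine.
- by move=> F G _ _; apply: block_fun_inj;
    rewrite block_fun_refine !block_fun_mul // !block_fun_refine.
- by move=> F _; apply: block_fun_inj;
    rewrite block_fun_refine !block_fun_star // !block_fun_refine.
Qed.

Lemma connecting_psi N m (F : BA N) : nsa_dom F ->
  nsa_dom (connecting (D := fun n => BA n) (fun n => refine_block hS (N := n)) m F) /\
  psi (connecting (D := fun n => BA n) (fun n => refine_block hS (N := n)) m F) = psi F.
Proof.
move=> dF; elim: m => [//|m [dm pm]] /=; split; first by apply: refine_block_dom; exact: dm.
by rewrite psi_refine.
Qed.

Lemma AT_T_is_AT : is_AT_algebra (AT_T S iota).
Proof.
split; first exact: AT_T_subalgebra.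
exists (level_block S), (fun n => refine_block hS (N := n)), psi; split.
- exact: refine_block_hom.
- move=> N; split.
  + move=> F dF; apply: subset_closure; exists N => //; rewrite A_closure.
    by apply: subset_closure; exists F.
  + by move=> F G dF dG; exact: (psiD dF dG).
  + by move=> c F dF; exact: (psiZ c dF).
  + by move=> F G dF dG; exact: (psiM dF dG).
  + by move=> F dF; exact: (psi_star dF).
- by move=> N F _; exact: psi_refine.
(* The sequence of norms is constant: each [psi] is isometric and compatible with the connecting
   maps. *)
- move=> N F dF; rewrite (_ : (fun m => _) = fun=> (cabs (psi F))%:E); first exact: cvg_cst.
  apply/funext => m; have [dm pm] := connecting_psi m dF.
  by rewrite -(cabs_psi dm) pm.
- rewrite /AT_T; apply/seteqP; split.
  + rewrite -[X in _ `<=` X]closure_closure; apply: closureS => a [N _]; rewrite A_closure.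
    by apply: closureS => b Nb; exists N.
  + apply: closureS => a [N _ Na]; exists N => //; rewrite A_closure.
    exact: subset_closure.
Qed.

End Limit.

Theorem theorem4p4 (R : realType) (S : substitution_tiling R)
    (hS : standing_assumptions S)
    (A : cstar_algebra R) (iota : Cc_algebra S -> A)
    (hA : is_completion iota) :
  [/\ (forall N : nat, cstar_subalgebra (A_ S iota N)),
      (forall N : nat, A_ S iota N `<=` A_ S iota N.+1)
    & is_AT_algebra (AT_T S iota)].
Proof.
split; [exact: A_subalgebra|exact: A_S|exact: AT_T_is_AT].
Qed.
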